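(* For every constant $\alpha > 0$ and every function $p = p(n)$ with $p \geq n^{\alpha-1}$, asymptotically almost surely (i.e. with probability tending to $1$ as $n \to \infty$) the edge set of the random graph $G(n,p)$ can be covered by $(1+o(1))np/2$ Hamilton cycles, i.e. there is a family of $(1+o(1))np/2$ Hamilton cycles of $G(n,p)$ such that every edge of $G(n,p)$ lies in at least one of them.
   Context: $G(n,p)$ denotes the binomial random graph on $n$ vertices in which each pair of vertices is an edge independently with probability $p$. *)

(* Defs.v *)
From HB Require Import structures.
From mathcomp Require Import all_boot all_order all_algebra all_fingroup.
From mathcomp Require Import all_classical all_reals all_analysis.
Set Implicit Arguments. Unset Strict Implicit. Unset Printing Implicit Defensive.
Import Order.TTheory GRing.Theory Num.Theory.
Local Open Scope ring_scope.

(* Vertex set of G(n,p) is 'I_n; a graph is a set of edges, an edge being a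
   2-element subset of 'I_n. *)
Definition pairs (n : nat) : {set {set 'I_n}} := [set e : {set 'I_n} | #|e| == 2%N].

Definition gnp_weight (R : realType) (n : nat) (p : R) (G : {set {set 'I_n}}) : R :=
  if G \subset pairs n then p ^+ #|G| * (1 - p) ^+ (#|pairs n| - #|G|)%N else 0.

Definition gnp_prob (R : realType) (n : nat) (p : R) (A : pred {set {set 'I_n}}) : R :=
  \sum_(G | A G) gnp_weight p G.

(* Edge set of the Hamilton cycle s 0, s 1, ..., s (n-1), s 0. *)
Definition cycle_edges (n : nat) (s : {perm 'I_n}) : {set {set 'I_n}} :=
  [set [set s i; s (ordS i)] | i : 'I_n].

Definition hamilton_cycle (n : nat) (G : {set {set 'I_n}}) (s : {perm 'I_n}) : bool :=
  (2 < n)%N && (cycle_edges s \subset G).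

Definition ham_coverable (n : nat) (G : {set {set 'I_n}}) (k : nat) : bool :=
  [exists f : {ffun 'I_k -> {perm 'I_n}},
     [forall i, hamilton_cycle G (f i)] &&
     (G \subset \bigcup_(i < k) cycle_edges (f i))].

(* Main.v *)
(* Idea.  Put L = log2 n, q = 2 L^2.  Split the vertices into q equal parts V_0, ..., V_(q-1)
   and a few leftover vertices.  The complete graph on the parts decomposes into q/2 zigzag
   Hamilton paths, one per round, so that almost every edge joins consecutive parts of exactly
   one round.  In a round, each random bipartite graph between consecutive parts is an almost
   regular expander, so by Hall's theorem all its edges are covered by (1 + o(1)) n p / q of its
   perfect matchings; gluing one matching from each pair gives n/q paths through all the parts.
   To close such a path system to a Hamilton cycle, contract its paths and keep the leftover
   vertices: the edges from path ends to path starts have not been looked at yet, and form a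
   random digraph.  By McDiarmid's coupling it is Hamiltonian with at least the probability of
   the undirected random graph, which is handled by Posa's rotations and sprinkling; the
   exceptional probability is small enough for a union bound over all the matchings.
   The edges missed by all q/2 rounds have maximum degree O(n p / q).  They are covered at the
   cost of O(L) further rounds with three parts each, chosen greedily so that every pair of
   vertices is separated; this costs O(L n p / q) = o(n p) more cycles. *)

Require Import Defs.
From HB Require Import structures.
From mathcomp Require Import all_boot all_order all_algebra all_fingroup.
From mathcomp Require Import boolp reals topology normedtype sequences exp.
From mathcomp Require Import ring lra zify.
Set Implicit Arguments. Unset Strict Implicit. Unset Printing Implicit Defensive.
Import Order.TTheory GRing.Theory Num.Theory.

(** * Random subsets of a finite set *)

Local Open Scope ring_scope.

(** The closing edges must be independent of the matchings. So the matchings are chosen as a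
    function of the edges between consecutive parts alone, and all other coordinates are resampled.
    This asks for three parts or more: with two, the closing edges would run between the same parts
    as the matchings. Constants. With E = e^(-(L+1)) and n < 2^(L+1) one has n E <= 1. Every
    elementary failure probability is brought below E^4, which pays for a union bound over O(n^2)
    events and leaves O(E^2). An expansion factor L + 1 makes a surplus of Delta / L matchings
    enough to regularise a bipartite graph of maximum degree Delta. The value q = 2 L^2 makes the
    degree of the missed edges O(n p / L^2), so that O(L) extra rounds cost O(n p / L); all relative
    errors are then O(1 / L). The hypothesis on p enters as n p >= L^9, which leaves mean degree at
    least L^6 between parts. *)

Section Bernoulli.
Variables (R : realType) (T : finType).
Implicit Types (q : T -> R) (S Z : {set T}) (F : {set T} -> R) (A : pred {set T}).

(** The marginals vary with the coordinate, so the ground set can be all sets of vertices, with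
    marginal p on the pairs and 0 elsewhere. *)
Definition bern q S : R := \prod_x (if x \in S then q x else 1 - q x).
Definition expect q F : R := \sum_S bern q S * F S.
Definition prob q A : R := expect q (fun S => (A S)%:R).
Definition probv q := forall x, 0 <= q x <= 1.

Lemma bern_ge0 q S : probv q -> 0 <= bern q S.
Proof.
move=> hq; apply: prodr_ge0 => x _.
by case/andP: (hq x) => h0 h1; case: ifP => _ //; rewrite subr_ge0.
Qed.

Lemma expect_prod q (f g : T -> R) :
  expect q (fun S => \prod_x (if x \in S then f x else g x)) =
  \prod_x (q x * f x + (1 - q x) * g x).
Proof.
rewrite bigA_distr /=; apply: eq_bigr => S _.
by rewrite -big_split /=; apply: eq_bigr => x _; case: ifP.
Qed.

Lemma eq_expect q F1 F2 : F1 =1 F2 -> expect q F1 = expect q F2.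
Proof. by move=> h; apply: eq_bigr => S _; rewrite h. Qed.

Lemma expect1 q : expect q (fun=> 1) = 1.
Proof.
transitivity (expect q (fun S => \prod_x (if x \in S then 1 else 1))).
  by apply: eq_expect => S; rewrite big1 // => x _; case: ifP.
by rewrite expect_prod big1 // => x _; rewrite !mulr1 subrKC.
Qed.

Lemma expectZ q k F : expect q (fun S => k * F S) = k * expect q F.
Proof. by rewrite mulr_sumr; apply: eq_bigr => S _; rewrite mulrCA. Qed.

Lemma expect_cst q k : expect q (fun=> k) = k.
Proof.
by rewrite -[RHS]mulr1 -(expect1 q) -expectZ; apply: eq_bigr => S _; rewrite mulr1.
Qed.

Lemma expectD q F1 F2 : expect q (fun S => F1 S + F2 S) = expect q F1 + expect q F2.
Proof. by rewrite -big_split; apply: eq_bigr => S _; rewrite mulrDr. Qed.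

Lemma expect_sum q (I : finType) (P : pred I) (F : I -> {set T} -> R) :
  expect q (fun S => \sum_(i | P i) F i S) = \sum_(i | P i) expect q (F i).
Proof.
rewrite /expect exchange_big; apply: eq_bigr => S _.
by rewrite mulr_sumr.
Qed.

Lemma ler_expect q F1 F2 : probv q -> (forall S, F1 S <= F2 S) ->
  expect q F1 <= expect q F2.
Proof. by move=> hq h; apply: ler_sum => S _; rewrite ler_wpM2l // bern_ge0. Qed.

Lemma prob_le1 q A : probv q -> prob q A <= 1.
Proof. by move=> hq; rewrite -(expect1 q); apply: ler_expect => // S; case: (A S). Qed.

Lemma eq_prob q A1 A2 : A1 =1 A2 -> prob q A1 = prob q A2.
Proof. by move=> h; apply: eq_expect => S; rewrite h. Qed.

Lemma prob_sub q A1 A2 : probv q -> (forall S, A1 S -> A2 S) -> prob q A1 <= prob q A2.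
Proof.
move=> hq h; apply: ler_expect => // S.
by move: (h S); case: (A1 S) => // ->.
Qed.

Lemma prob_predC q A : prob q A = 1 - prob q (predC A).
Proof.
apply/eqP; rewrite eq_sym subr_eq -expectD; apply/eqP.
by rewrite -[LHS](expect1 q); apply: eq_expect => S /=; case: (A S); rewrite /= ?addr0 ?add0r.
Qed.

Lemma prob_pred0 q : prob q pred0 = 0.
Proof. exact: expect_cst. Qed.

Lemma prob_exists q (I : finType) (A : I -> pred {set T}) : probv q ->
  prob q (fun S => [exists i, A i S]) <= \sum_i prob q (A i).
Proof.
move=> hq; rewrite -expect_sum; apply: ler_expect => // S.
case: existsP => [[i hi]|_]; last by apply: sumr_ge0.
by rewrite (bigD1 i) //= hi lerDl; apply: sumr_ge0.
Qed.

Lemma prob_exists_le q (I : finType) (A : I -> pred {set T}) b : probv q ->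
  (forall i, prob q (A i) <= b) ->
  prob q (fun S => [exists i, A i S]) <= #|I|%:R * b.
Proof.
move=> hq h; apply: le_trans (prob_exists _ hq) _.
by apply: le_trans (ler_sum _ (fun i _ => h i)) _; rewrite sumr_const mulr_natl.
Qed.

Lemma prob_or q A1 A2 : probv q ->
  prob q (fun S => A1 S || A2 S) <= prob q A1 + prob q A2.
Proof.
move=> hq; rewrite -expectD; apply: ler_expect => // S.
by case: (A1 S); case: (A2 S); rewrite ?addr0 ?add0r // lerDl.
Qed.

Definition comb (phi : T -> bool -> bool -> bool) S Z :=
  [set x | phi x (x \in S) (x \in Z)].

Lemma prod_bool (b : T -> bool) : \prod_x (b x)%:R = [forall x, b x]%:R :> R.
Proof.
case: forallP => [h|/forallP]; first by apply: big1 => x _; rewrite h.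
by rewrite negb_forall => /existsP[x /negbTE hx]; rewrite (bigD1 x) //= hx mul0r.
Qed.

(* Two independent random sets combined coordinatewise are again Bernoulli;
   the choices of [phi] give sprinkling, thinning and resampling. *)
Lemma expect_comb q1 q2 q (phi : T -> bool -> bool -> bool) F :
  (forall x, q x = q1 x * q2 x * (phi x true true)%:R
                 + q1 x * (1 - q2 x) * (phi x true false)%:R
                 + (1 - q1 x) * q2 x * (phi x false true)%:R
                 + (1 - q1 x) * (1 - q2 x) * (phi x false false)%:R) ->
  expect q1 (fun S => expect q2 (fun Z => F (comb phi S Z))) = expect q F.
Proof.
move=> hq.
(* By linearity it suffices to take for [F] the indicator of a single set [Y], and there the
   expectation factors over the coordinates. *)
have key Y : expect q1 (fun S => expect q2 (fun Z => (comb phi S Z == Y)%:R)) = bern q Y.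
  have e S Z : (comb phi S Z == Y)%:R = \prod_x (phi x (x \in S) (x \in Z) == (x \in Y))%:R :> R.
    rewrite prod_bool; congr ((_ : bool)%:R); apply/eqP/forallP => [<- x|h].
      by rewrite inE.
    by apply/setP => x; rewrite inE; apply/eqP.
  transitivity (expect q1 (fun S => expect q2 (fun Z => \prod_x
     (if x \in Z then (phi x (x \in S) true == (x \in Y))%:R
      else (phi x (x \in S) false == (x \in Y))%:R)))).
    apply: eq_expect => S; apply: eq_expect => Z; rewrite e.
    by apply: eq_bigr => x _; case: (x \in Z).
  under eq_expect do rewrite expect_prod.
  pose g b x := q2 x * (phi x b true == (x \in Y))%:R
              + (1 - q2 x) * (phi x b false == (x \in Y))%:R.
  transitivity (expect q1 (fun S => \prod_x (if x \in S then g true x else g false x))).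
    by apply: eq_expect => S; apply: eq_bigr => x _; rewrite /g; case: (x \in S).
  rewrite expect_prod; apply: eq_bigr => x _; rewrite /g hq.
  case: (x \in Y); case: (phi x true true); case: (phi x true false);
     case: (phi x false true); case: (phi x false false) => /=; ring.
have hF X : F X = \sum_Y F Y * (X == Y)%:R.
  rewrite (bigD1 X) //= eqxx mulr1 big1 ?addr0 // => Y /negbTE.
  by rewrite eq_sym => ->; rewrite mulr0.
under eq_expect => S.
  under eq_expect do rewrite hF.
  rewrite expect_sum; under eq_bigr do rewrite expectZ.
  over.
rewrite expect_sum; apply: eq_bigr => Y _.
by rewrite expectZ key mulrC.
Qed.

Lemma expect_union q1 q2 F :
  expect q1 (fun S => expect q2 (fun Z => F (S :|: Z))) =
  expect (fun x => 1 - (1 - q1 x) * (1 - q2 x)) F.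
Proof.
rewrite -[RHS](@expect_comb q1 q2 (fun x => 1 - (1 - q1 x) * (1 - q2 x)) (fun=> orb)) => [|x];
  last by rewrite /=; ring.
apply: eq_expect => S; apply: eq_expect => Z; congr F.
Qed.

(** The parts of a random set inside and outside [P] are independent. This lets a choice made from
    the coordinates in [P] be fixed while the other coordinates are still random. *)
Lemma expect_resample q (P : {set T}) F :
  expect q (fun S => expect q (fun Z => F ((S :&: P) :|: (Z :\: P)))) = expect q F.
Proof.
rewrite -[RHS](@expect_comb q q q (fun x b c => if x \in P then b else c)) => [|x]; last first.
  by case: (x \in P) => /=; ring.
apply: eq_expect => S; apply: eq_expect => Z; congr F.
by apply/setP => x; rewrite !inE; case: (x \in P); rewrite ?andbT ?andbF ?orbF.
Qed.

(** Coupling: thinning the denser set with retention probability [q1 / q2] gives the sparser one as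
    a subset. *)
Lemma prob_mono q1 q2 A : probv q1 -> probv q2 -> (forall x, q1 x <= q2 x) ->
  (forall S Z, S \subset Z -> A S -> A Z) -> prob q1 A <= prob q2 A.
Proof.
move=> h1 h2 h12 hA.
pose r x := q1 x / q2 x.
have hr x : q1 x = q2 x * r x.
  have [q20|q20] := eqVneq (q2 x) 0; last by rewrite /r mulrCA divff ?mulr1.
  by apply/eqP; rewrite q20 mul0r eq_le (proj1 (andP (h1 x))) -[X in _ <= X]q20 h12.
have pr : probv r.
  move=> x; case/andP: (h1 x) => a0 _; case/andP: (h2 x) => b0 _.
  rewrite /r divr_ge0 //=.
  have [q20|q20] := eqVneq (q2 x) 0; first by rewrite q20 invr0 mulr0 ler01.
  by rewrite ler_pdivrMr ?mul1r // lt_neqAle eq_sym q20 b0.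
have -> : prob q1 A = expect q2 (fun S => expect r (fun Z => (A (S :&: Z))%:R)).
  rewrite /prob -(@expect_comb q2 r q1 (fun=> andb)) => [|x]; last by rewrite hr /=; ring.
  apply: eq_expect => S; apply: eq_expect => Z; congr ((A _)%:R).
apply: ler_expect => // S; rewrite -[X in _ <= X](expect_cst r).
apply: ler_expect => // Z; have := hA (S :&: Z) S (subsetIl _ _).
by case: (A (S :&: Z)) => // ->.
Qed.

Lemma prob_miss q (C : {set T}) :
  prob q (fun S => [disjoint S & C]) = \prod_(x in C) (1 - q x).
Proof.
have e S : [disjoint S & C]%:R = \prod_x (if x \in S then (x \notin C)%:R else 1) :> R.
  transitivity (\prod_x ((x \in S) ==> (x \notin C))%:R : R); last first.
    by apply: eq_bigr => x _; case: (x \in S).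
  rewrite prod_bool; congr ((_ : bool)%:R); rewrite disjoint_subset.
  by apply/subsetP/forallP => [h x|h x xS]; [apply/implyP => /h | have := h x; rewrite xS].
rewrite /prob; under eq_expect do rewrite e.
rewrite expect_prod [RHS]big_mkcond; apply: eq_bigr => x _.
by case: (x \in C) => /=; ring.
Qed.

Lemma expect_pow q (C : {set T}) (y : R) :
  expect q (fun S => y ^+ #|S :&: C|) = \prod_(x in C) (1 + q x * (y - 1)).
Proof.
have e S : y ^+ #|S :&: C| = \prod_x (if x \in S then (if x \in C then y else 1) else 1).
  rewrite -prodr_const big_mkcond; apply: eq_bigr => x _.
  by rewrite inE; case: (x \in S); case: (x \in C).
under eq_expect do rewrite e.
rewrite expect_prod [RHS]big_mkcond; apply: eq_bigr => x _.
by case: (x \in C) => /=; ring.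
Qed.

End Bernoulli.

(** * Covering by perfect matchings *)

Local Open Scope nat_scope.

Section Transport.
Variables I J : finType.
Implicit Types (B : I -> J -> bool) (A : {set I}).

Definition nbhd B A : {set J} := [set j | [exists i in A, B i j]].

Lemma nbhdP B A j : reflect (exists2 i, i \in A & B i j) (j \in nbhd B A).
Proof. by rewrite inE; apply: exists_inP. Qed.

Lemma nbhdU B A1 A2 : nbhd B (A1 :|: A2) = nbhd B A1 :|: nbhd B A2.
Proof.
apply/setP => j; rewrite in_setU; apply/nbhdP/orP.
  by case=> i; rewrite inE => /orP[] hi b; [left|right]; apply/nbhdP; exists i.
by case=> /nbhdP[i hi b]; exists i; rewrite ?inE ?hi ?orbT.
Qed.

Lemma nbhdS B A1 A2 : A1 \subset A2 -> nbhd B A1 \subset nbhd B A2.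
Proof.
by move=> /subsetP h; apply/subsetP => j /nbhdP[i /h hi b]; apply/nbhdP; exists i.
Qed.

Lemma sum_setU (K : finType) (w : K -> nat) (X Y : {set K}) :
  \sum_(k in X :|: Y) w k = \sum_(k in X) w k + \sum_(k in Y :\: X) w k.
Proof.
rewrite (big_setID X) /=; congr (_ + _); apply: eq_bigl => k; rewrite !inE.
  by case: (k \in X); rewrite ?andbF ?andbT.
by case: (k \in X).
Qed.

Lemma sum_subset (K : finType) (w : K -> nat) (X Y : {set K}) :
  X \subset Y -> \sum_(k in X) w k <= \sum_(k in Y) w k.
Proof. by move=> /setIidPr h; rewrite [leqRHS](big_setID X) /= h leq_addr. Qed.

Lemma sum_setT (K : finType) (w : K -> nat) : \sum_(k in [set: K]) w k = \sum_k w k.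
Proof. by apply: eq_bigl => k; rewrite inE. Qed.

Lemma sum_restrict (K : finType) (w : K -> nat) (X Y : {set K}) :
  \sum_(k in Y) (if k \in X then w k else 0) = \sum_(k in Y :&: X) w k.
Proof. by rewrite -big_mkcondr; apply: eq_bigl => k; rewrite inE. Qed.

Lemma sum_decr (K : finType) (w : K -> nat) (k0 : K) (Y : {set K}) : 0 < w k0 ->
  \sum_(k in Y) w k = \sum_(k in Y) (w k - (k == k0)) + (k0 \in Y).
Proof.
move=> h0; have [hk|hk] := boolP (k0 \in Y); last first.
  rewrite addn0; apply: eq_bigr => k hkY.
  by case: eqP hkY hk => [->|_ _ _]; [move=> -> | rewrite subn0].
rewrite !(bigD1 k0 hk) /= eqxx addnAC subnK //; congr (_ + _).
by apply: eq_bigr => k /andP[_ /negbTE ->]; rewrite subn0.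
Qed.

(* Hall's theorem with supplies [r] and demands [c], by the usual induction:
   split along a tight set if there is one, otherwise ship one unit anywhere. *)
Lemma transport B (r : I -> nat) (c : J -> nat) :
  \sum_i r i = \sum_j c j ->
  (forall A, \sum_(i in A) r i <= \sum_(j in nbhd B A) c j) ->
  exists X : I -> J -> nat, [/\ forall i, \sum_j X i j = r i,
    forall j, \sum_i X i j = c j & forall i j, 0 < X i j -> B i j].
Proof.
have [N] := ubnP (\sum_i r i); elim: N r c => // N IH r c ltN eqs hall.
have [r0|rpos] := posnP (\sum_i r i).
  exists (fun _ _ => 0); split=> // [i|j]; rewrite big1 //.
    by apply/esym/eqP; move/eqP: r0; rewrite sum_nat_eq0 => /forallP/(_ i).
  by apply/esym/eqP; move/eqP: eqs; rewrite r0 eq_sym sum_nat_eq0 => /forallP/(_ j).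
(* A tight set exhausts the demand of its neighbourhood, so [A] with [nbhd B A] and the two
   complements are separate problems with smaller totals. *)
have [/existsP[A /and3P[tight Apos Alt]]|nA] := boolP [exists A : {set I},
   [&& \sum_(i in A) r i == \sum_(j in nbhd B A) c j, 0 < \sum_(i in A) r i
     & \sum_(i in A) r i < \sum_i r i]].
  move/eqP in tight.
  pose r1 i := if i \in A then r i else 0.
  pose c1 j := if j \in nbhd B A then c j else 0.
  pose r2 i := if i \in ~: A then r i else 0.
  pose c2 j := if j \in ~: nbhd B A then c j else 0.
  have er1 : \sum_i r1 i = \sum_(i in A) r i by rewrite -big_mkcond.
  have ec1 : \sum_j c1 j = \sum_(j in nbhd B A) c j by rewrite -big_mkcond.
  have er2 : \sum_i r2 i = \sum_(i in ~: A) r i by rewrite -big_mkcond.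
  have ec2 : \sum_j c2 j = \sum_(j in ~: nbhd B A) c j by rewrite -big_mkcond.
  have sr : \sum_i r i = \sum_(i in A) r i + \sum_(i in ~: A) r i.
    rewrite (bigID (mem A)) /=; congr (_ + _).
    by apply: eq_bigl => i; rewrite inE.
  have sc : \sum_j c j = \sum_(j in nbhd B A) c j + \sum_(j in ~: nbhd B A) c j.
    rewrite (bigID (mem (nbhd B A))) /=; congr (_ + _).
    by apply: eq_bigl => i; rewrite [in RHS]inE.
  have [||A'|X1 [X1r X1c X1B]] := IH r1 c1.
  - by rewrite er1; lia.
  - by rewrite er1 ec1.
  - rewrite !sum_restrict; apply: leq_trans (hall _) _; apply: sum_subset.
    by rewrite subsetI !nbhdS ?subsetIl ?subsetIr.
  have [||A'|X2 [X2r X2c X2B]] := IH r2 c2.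
  - by rewrite er2; lia.
  - by rewrite er2 ec2; lia.
  (* Hall's condition outside: take it for [A :|: A'] and subtract the equality for [A]. *)
  - rewrite !sum_restrict -!setDE.
    have := hall (A :|: A'); rewrite nbhdU !sum_setU; lia.
  exists (fun i j => X1 i j + X2 i j); split=> [i|j|i j].
  - rewrite big_split /= X1r X2r /r1 /r2 inE.
    by case: (i \in A) => //=; rewrite addn0.
  - rewrite big_split /= X1c X2c /c1 /c2 in_setC.
    by case: (j \in nbhd B A) => //=; rewrite addn0.
  - by rewrite addn_gt0 => /orP[/X1B|/X2B].
have [i0 ri0] : exists i0, 0 < r i0.
  move: rpos; rewrite lt0n sum_nat_eq0 negb_forall => /existsP[i hi].
  by exists i; rewrite lt0n.
have [j0 bij cj0] : exists2 j0, B i0 j0 & 0 < c j0.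
  have := hall [set i0]; rewrite big_set1 => h.
  have : 0 < \sum_(j in nbhd B [set i0]) c j by lia.
  rewrite lt0n sum_nat_eq0 negb_forall => /existsP[j]; rewrite negb_imply => /andP[hj cj].
  by exists j; rewrite ?lt0n //; case/nbhdP: hj => i; rewrite inE => /eqP ->.
pose r' i := r i - (i == i0); pose c' j := c j - (j == j0).
have hr' A : \sum_(i in A) r i = \sum_(i in A) r' i + (i0 \in A) := sum_decr A ri0.
have hc' (Y : {set J}) : \sum_(j in Y) c j = \sum_(j in Y) c' j + (j0 \in Y) := sum_decr Y cj0.
have rT : \sum_i r i = (\sum_i r' i).+1.
  by have := hr' [set: I]; rewrite inE addn1 !sum_setT.
have cT : \sum_j c j = (\sum_j c' j).+1.
  by have := hc' [set: J]; rewrite inE addn1 !sum_setT.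
have [||A|X [Xr Xc XB]] := IH r' c'.
- by lia.
- by lia.
- have hA := hall A; have := hr' A; have := hc' (nbhd B A).
  have [iA|iA] := boolP (i0 \in A).
    have -> : j0 \in nbhd B A by apply/nbhdP; exists i0.
    by lia.
  (* Here the unit shipped lowers the demand near [A] but not the supply of [A]. Either [A] has no
     supply, or it is not tight because [i0] has supply outside [A]; in both cases there is one unit
     to spare. *)
  case: (boolP (j0 \in nbhd B A)) => [jA|_]; last by lia.
  have ltT : \sum_(i in A) r i < \sum_i r i.
    rewrite [ltnRHS](bigID (mem A)) /= -[ltnLHS]addn0 ltn_add2l.
    by rewrite (bigD1 i0) //= addn_gt0 ri0.
  have cpos : 0 < \sum_(j in nbhd B A) c j.
    by rewrite (bigD1 j0) //= addn_gt0 cj0.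
  move: nA; rewrite negb_exists => /forallP/(_ A).
  by rewrite !negb_and => /or3P[] h; lia.
exists (fun i j => X i j + ((i == i0) && (j == j0))); split=> [i|j|i j].
- rewrite big_split /= Xr /r'.
  have [->|ne] := eqVneq i i0; last by rewrite /= big1 ?addn0 ?subn0.
  rewrite (bigD1 j0) //= eqxx big1 => [|j /negbTE-> //]; lia.
- rewrite big_split /= Xc /c'.
  have [->|ne] := eqVneq j j0; last first.
    by rewrite /= big1 ?addn0 ?subn0 // => i _; rewrite andbF.
  rewrite (bigD1 i0) //= eqxx big1 => [|i /negbTE-> //]; lia.
- by rewrite addn_gt0 => /orP[/XB //|]; case: eqP => // ->; case: eqP => // ->.
Qed.

End Transport.

Section Regular.
Variable I : finType.
Implicit Types (M : I -> I -> nat).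

(** Koenig's theorem for multigraphs: the d |A| edges leaving [A] end in its neighbourhood, which
    receives d edges per vertex, so Hall's condition holds with unit supplies and demands. *)
Lemma regular_matching M d : 0 < d ->
  (forall i, \sum_j M i j = d) -> (forall j, \sum_i M i j = d) ->
  exists s : {perm I}, forall i, 0 < M i (s i).
Proof.
move=> d0 Mr Mc.
have [//|A|X [Xr Xc XB]] := @transport I I (fun i j => 0 < M i j) (fun=> 1) (fun=> 1).
  rewrite !sum1_card -(leq_pmul2r d0).
  rewrite -!sum_nat_const -(eq_bigr _ (fun i _ => Mr i)) -(eq_bigr _ (fun i _ => Mc i)).
  rewrite exchange_big /= [leqLHS](bigID (mem (nbhd (fun i j => 0 < M i j) A))) /=.
  rewrite [X in _ + X]big1 ?addn0 => [|j nj].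
    apply: leq_sum => j _; rewrite [leqRHS](bigID (mem A)) /=.
    by rewrite leq_addr.
  apply: big1 => i iA; apply/eqP; rewrite -leqn0 leqNgt.
  by apply: contra nj => h; apply/nbhdP; exists i.
have ex i : exists j, 0 < X i j.
  apply/existsP; rewrite -[X in is_true X]negbK negb_exists.
  apply/negP => /forallP h; have := Xr i.
  by rewrite big1 // => j _; apply/eqP; rewrite -leqn0 leqNgt h.
pose g i := xchoose (ex i).
have gP i : 0 < X i (g i) := xchooseP (ex i).
have ginj : injective g.
  move=> i1 i2 e; apply/eqP/contraT => ne.
  have := Xc (g i1); rewrite (bigD1 i1) //= (bigD1 i2) /=; last by rewrite eq_sym.
  by have := gP i1; have := gP i2; rewrite e; lia.
by exists (perm ginj) => i; rewrite permE; apply: XB.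
Qed.

(** Removes one perfect matching at a time. Multiplicities matter because the regularising flow may
    run along an edge that is to be covered as well. *)
Lemma regular_decomposition d M :
  (forall i, \sum_j M i j = d) -> (forall j, \sum_i M i j = d) ->
  exists F : seq {perm I}, [/\ size F = d,
    forall s i, s \in F -> 0 < M i (s i) &
    forall i j, 0 < M i j -> exists2 s, s \in F & s i = j].
Proof.
elim: d M => [|d IH] M Mr Mc.
  exists [::]; split=> // i j; rewrite lt0n => /negP[].
  by have /eqP := Mr i; rewrite sum_nat_eq0 => /forallP/(_ j).
have [//|s hs] := @regular_matching M d.+1 _ Mr Mc.
pose M' i j := M i j - (j == s i).
have sumdelta (P : pred I) k : P =1 pred1 k -> \sum_(i : I) (P i : nat) = 1.
  by move=> h; rewrite (bigD1 k) //= h /= eqxx big1 // => i /negbTE; rewrite h /= => ->.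
have hM i j : M i j = M' i j + (j == s i).
  by rewrite /M'; case: eqP => [->|_]; have := hs i; lia.
have [i|j|F [sF hF cF]] := IH M'.
- apply/eqP; rewrite -eqSS -(Mr i) -addn1; apply/eqP.
  rewrite -(sumdelta (fun j => j == s i) (s i)) // -big_split /=.
  by apply: eq_bigr => j _; rewrite hM.
- apply/eqP; rewrite -eqSS -(Mc j) -addn1; apply/eqP.
  rewrite -(sumdelta (fun i => j == s i) ((s^-1)%g j)) => [|i] /=; last first.
    by rewrite -(can2_eq (permKV s) (permK s)) eq_sym -(inj_eq (@perm_inj _ s)) permKV eq_sym.
  by rewrite -big_split /=; apply: eq_bigr => i _; rewrite hM.
exists (s :: F); split=> [|s' i|i j]; first by rewrite /= sF.
  rewrite inE => /orP[/eqP->|/hF h]; first exact: hs.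
  by apply: leq_trans (h i) _; rewrite /M' leq_subr.
rewrite hM; have [->|ne] := eqVneq j (s i); first by exists s; rewrite ?mem_head.
by rewrite addn0 => /cF[s' hs' e]; exists s'; rewrite // inE hs' orbT.
Qed.

Definition expanding (J K : finType) (f sz : nat) (B : J -> K -> bool) :=
  forall A : {set J}, 0 < #|A| <= sz -> f * #|A| <= #|nbhd B A|.

(* The residual supplies [D - deg] lie between [D - Delta] and [D], so a
   bipartite [f]-expander can absorb their imbalance as soon as D <= f (D - Delta). *)
Lemma cover_by_matchings (B E : rel I) f sz Delta D :
  (forall i j, E i j -> B i j) ->
  (forall i, #|[set j | E i j]| <= Delta) -> (forall j, #|[set i | E i j]| <= Delta) ->
  Delta <= D -> D <= f * (D - Delta) -> #|I| <= f.+1 * sz ->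
  expanding f sz B -> expanding f sz (fun j i => B i j) ->
  exists F : seq {perm I}, [/\ size F = D,
    forall s i, s \in F -> B i (s i) &
    forall i j, E i j -> exists2 s, s \in F & s i = j].
Proof.
move=> EB dr dc leD Df szI ex1 ex2.
pose r i := D - #|[set j | E i j]|; pose c j := D - #|[set i | E i j]|.
have cardE (P : pred I) : #|[set j | P j]| = \sum_j (P j : nat).
  by rewrite -sum1_card big_mkcond /=; apply: eq_bigr => j _; rewrite inE; case: (P j).
have er i : r i + \sum_j (E i j : nat) = D.
  by have := dr i; rewrite /r cardE; lia.
have ec j : c j + \sum_i (E i j : nat) = D.
  by have := dc j; rewrite /c cardE; lia.
have rc : \sum_i r i = \sum_j c j.
  have : \sum_i (r i + \sum_j (E i j : nat)) = \sum_j (c j + \sum_i (E i j : nat)).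
    by under eq_bigr do rewrite er; under [RHS]eq_bigr do rewrite ec.
  by rewrite !big_split /= exchange_big /=; lia.
have lo (w : I -> nat) (Y : {set I}) : (forall k, D - Delta <= w k) ->
    #|Y| * (D - Delta) <= \sum_(k in Y) w k.
  by move=> h; rewrite -sum_nat_const; apply: leq_sum.
have hi (w : I -> nat) (Y : {set I}) : (forall k, w k <= D) ->
    \sum_(k in Y) w k <= #|Y| * D.
  by move=> h; rewrite -sum_nat_const; apply: leq_sum.
have small (w1 w2 : I -> nat) (C : I -> I -> bool) (A : {set I}) :
    expanding f sz C -> (forall k, w1 k <= D) -> (forall k, D - Delta <= w2 k) ->
    #|A| <= sz -> \sum_(i in A) w1 i <= \sum_(j in nbhd C A) w2 j.
  move=> exC h1 h2 Asz; apply: leq_trans (hi _ _ h1) _.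
  apply: leq_trans (lo _ _ h2); have [->|A0] := posnP #|A|; first by rewrite mul0n.
  have := exC A; rewrite A0 Asz => /(_ isT) hx.
  apply: leq_trans (leq_mul (leqnn #|A|) Df) _.
  by rewrite mulnA [#|A| * f]mulnC leq_mul2r hx orbT.
have hall (A : {set I}) : \sum_(i in A) r i <= \sum_(j in nbhd B A) c j.
  have r1 k : r k <= D by rewrite leq_subr.
  have r2 k : D - Delta <= r k by rewrite leq_sub2l.
  have c1 k : c k <= D by rewrite leq_subr.
  have c2 k : D - Delta <= c k by rewrite leq_sub2l.
  have [Asz|Asz] := leqP #|A| sz; first exact: small.
  have [A' sA' cA'] : exists2 A' : {set I}, A' \subset A & #|A'| = sz.
    exists [set i in take sz (enum A)].
      by apply/subsetP => i; rewrite inE => /mem_take; rewrite mem_enum.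
    by rewrite cardsE (card_uniqP _) ?take_uniq ?enum_uniq // size_take -fintype.cardE Asz.
  (* For large [A] pass to complements: the neighbourhood of [A] misses at most [sz] columns, these
     expand backwards, and their neighbours lie outside [A]. *)
  have bigN : f * sz <= #|nbhd B A|.
    have [-> //|sz0] := posnP sz; first by rewrite muln0.
    apply: leq_trans (subset_leq_card (nbhdS B sA')).
    by have := ex1 A'; rewrite cA' sz0 leqnn => /(_ isT).
  have cN : #|~: nbhd B A| <= sz.
    by have := cardsC (nbhd B A); move: szI; rewrite mulSn; lia.
  have h1 := small c r _ _ ex2 c1 r2 cN.
  have sub : nbhd (fun j i => B i j) (~: nbhd B A) \subset ~: A.
    apply/subsetP => i /nbhdP[j]; rewrite in_setC => nj bij; rewrite inE.
    by apply: contra nj => iA; apply/nbhdP; exists i.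
  have h2 := leq_trans h1 (sum_subset r sub).
  have sr : \sum_i r i = \sum_(i in A) r i + \sum_(i in ~: A) r i.
    rewrite (bigID (mem A)) /=; congr (_ + _).
    by apply: eq_bigl => i; rewrite inE.
  have sc : \sum_j c j = \sum_(j in nbhd B A) c j + \sum_(j in ~: nbhd B A) c j.
    rewrite (bigID (mem (nbhd B A))) /=; congr (_ + _).
    by apply: eq_bigl => i; rewrite [in RHS]inE.
  lia.
have [X [Xr Xc XB]] := transport rc hall.
(* [X + E] is D-regular, so its matchings cover [E]; the correction [X] runs along edges of [B]. *)
have [i|j|F [sF hF cF]] := @regular_decomposition D (fun i j => X i j + E i j).
- by rewrite big_split /= Xr er.
- by rewrite big_split /= Xc ec.
exists F; split=> // [s i sF'|i j hE].
  have := hF s i sF'; rewrite addn_gt0 => /orP[/XB //|].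
  by case h: (E i (s i)) => // _; apply: EB.
by apply: cF; rewrite hE addn1.
Qed.

End Regular.

(** * Posa's rotations *)

Section ConsecutivePairs.
Variable K : eqType.
Implicit Types (a b y : K) (s u v : seq K).

Definition consec s a b := infix [:: a; b] s || infix [:: b; a] s.

Lemma infix2_cat a b s1 s2 : infix [:: a; b] (s1 ++ s2) ->
  [\/ infix [:: a; b] s1, infix [:: a; b] s2 |
      exists u v, s1 = rcons u a /\ s2 = b :: v].
Proof.
elim: s1 => [|x s1 IH] /=; first by move=> h; constructor 2.
move=> /orP[|/IH[h|h|[u [v [-> ->]]]]].
- case: s1 {IH} => [|y s1] /=.
    case: s2 => [|y s2] /=; first by rewrite andbF.
    by move=> /and3P[/eqP-> /eqP-> _]; constructor 3; exists [::], s2.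
  by move=> /and3P[h1 h2 _]; constructor 1; rewrite /= h1 h2 prefix0s.
- by constructor 1; rewrite /= h orbT.
- by constructor 2.
- by constructor 3; exists (x :: u), v.
Qed.

Lemma uniq_split_inj u1 v1 u2 v2 y : uniq (u1 ++ y :: v1) ->
  u1 ++ y :: v1 = u2 ++ y :: v2 -> u1 = u2 /\ v1 = v2.
Proof.
move=> un e; have un2 := un; rewrite e in un2.
have idx u v : uniq (u ++ y :: v) -> index y (u ++ y :: v) = size u.
  rewrite cat_uniq => /and3P[_ /hasPn/(_ y (mem_head _ _)) /negbTE ny _].
  by rewrite index_cat ny /= eqxx addn0.
have sz : size u1 = size u2 by rewrite -(idx _ _ un) e idx.
have /andP[/eqP -> /eqP[->]] : (u1 == u2) && (y :: v1 == y :: v2).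
  by rewrite -eqseq_cat ?sz // e.
by [].
Qed.

Lemma infix2_split a b s : infix [:: a; b] s -> exists u v, s = u ++ a :: b :: v.
Proof. by move=> /infixP[u [v ->]]; exists u, v. Qed.

Lemma consec_split u y v z : uniq (u ++ y :: v) -> consec (u ++ y :: v) y z ->
  (exists v', v = z :: v') \/ (exists u', u = rcons u' z).
Proof.
move=> un /orP[] /infix2_split[u' [v' e]].
  by have [_ ->] := uniq_split_inj un e; left; exists v'.
have [-> _] : u = rcons u' z /\ v = v'.
  by apply: (@uniq_split_inj _ _ _ _ y) => //; rewrite e -cats1 -catA.
by right; exists u'.
Qed.

Lemma infix2_next a b s : uniq s -> infix [:: a; b] s -> next s a = b.
Proof.
move=> un /infix2_split[u [v e]]; move: un; rewrite e => un.
have na : a \notin u.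
  move: un; rewrite cat_uniq => /and3P[_ /hasPn/(_ a (mem_head _ _)) na _].
  exact: na.
rewrite next_nth mem_cat mem_head orbT index_cat (negbTE na) /= eqxx addn0.
case: u {e un na} => [|x u] //=.
by rewrite nth_cat ltnNge leqnSn /= subSnn.
Qed.

Lemma consec_next_prev a b s : uniq s -> consec s a b -> b = next s a \/ b = prev s a.
Proof.
move=> un /orP[h|h]; first by left; rewrite (infix2_next un h).
by right; rewrite -(infix2_next un h) prev_next.
Qed.

End ConsecutivePairs.

Section Posa.
Variables (K : finType) (e : rel K).
Hypothesis esym : symmetric e.
Implicit Types (P Q u v : seq K) (x y z w : K).

Lemma sorted_rcons_cat u y v :
  sorted e (rcons u y ++ v) = sorted e (rcons u y) && path e y v.
Proof. by case: u => [|x u] //=; rewrite cat_path last_rcons. Qed.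

Lemma path_rev_tail y w v : path e w v -> e y (last w v) -> path e y (rev (w :: v)).
Proof.
move=> pv eyl; rewrite lastI rev_rcons /= eyl /= rev_path.
by rewrite (eq_path (e' := e)) // => a b; rewrite esym.
Qed.

(** The prefix [rcons u y] is nonempty, so rotations keep the first vertex of the path. *)
Inductive rotation_of P : seq K -> Prop :=
| rotation_refl : rotation_of P P
| rotation_step u y w v : rotation_of P (rcons u y ++ w :: v) ->
    e y (last w v) -> rotation_of P (rcons u y ++ rev (w :: v)).

Section FromPath.
Variables (x : K) (p : seq K).
Hypotheses (up : uniq (x :: p)) (pp : path e x p).
Hypothesis maxp : forall Q, uniq Q -> sorted e Q -> size Q <= (size p).+1.

Definition rot_ends : {set K} :=
  [set z | `[< exists P, rotation_of (x :: p) P /\ last x P = z >]].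

Lemma rot_endsP z :
  reflect (exists P, rotation_of (x :: p) P /\ last x P = z) (z \in rot_ends).
Proof. by rewrite inE; apply: asboolP. Qed.

Lemma rotation_inv P : rotation_of (x :: p) P ->
  [/\ perm_eq P (x :: p), sorted e P & exists P', P = x :: P'].
Proof.
elim=> [|u y w v hr [pP sP [P' eP]] hyl]; first by split=> //; exists p.
split.
- by rewrite -(permPr pP) perm_cat2l perm_rev.
- move: sP; rewrite !sorted_rcons_cat => /andP[-> /=].
  by move=> /andP[_ pv]; apply: path_rev_tail.
- by case: u eP {hr pP sP} => [|b u] /= [-> _]; eexists.
Qed.

(** A rotation separates only [y] and [w], and it makes [w] an end. So a pair neither of whose
    members ever becomes an end is never separated. *)
Lemma rotation_consec P a b : rotation_of (x :: p) P -> consec (x :: p) a b ->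
  [\/ consec P a b, a \in rot_ends | b \in rot_ends].
Proof.
move=> hr hab; elim: hr => [|u y w v hr IH hyl]; first by constructor 1.
have wS : w \in rot_ends.
  apply/rot_endsP; exists (rcons u y ++ rev (w :: v)); split; first exact: rotation_step.
  by rewrite last_cat rev_cons last_rcons.
have half c d : infix [:: c; d] (rcons u y ++ w :: v) ->
    consec (rcons u y ++ rev (w :: v)) c d \/ d \in rot_ends.
  move=> /infix2_cat[h|h|[u' [v' [_ [<- _]]]]].
  - by left; rewrite /consec infix_catr.
  - by left; rewrite /consec orbC infix_catl // -[[:: d; c]]/(rev [:: c; d]) infix_rev.
  - by right.
case: IH => [/orP[/half[h|h]|/half[h|h]]|h|h].
- by constructor 1.
- by constructor 3.
- by constructor 1; rewrite /consec orbC.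
- by constructor 2.
- by constructor 2.
- by constructor 3.
Qed.

(** Let [y] be adjacent to the last vertex of the rotated path [P], and let [w] follow [y] in [P];
    rotating at [y] makes [w] an end. Were no neighbour of [y] on the original path an end, both
    would still be next to [y] in [P] and differ from [w], hence both would equal the predecessor of
    [y]. *)
Lemma nbr_consec_end y : y \in nbhd e rot_ends -> y \notin rot_ends ->
  exists2 z, z \in rot_ends & consec (x :: p) z y.
Proof.
move=> /nbhdP[s /rot_endsP[P [hP ls]] esy] ynS.
have [permP sP [P' eP]] := rotation_inv hP.
have uP : uniq P by rewrite (perm_uniq permP).
(* Otherwise [y] would extend [P], against maximality. *)
have yP : y \in P.
  apply/contraT => nyP; have := maxp (Q := rcons P y).
  rewrite rcons_uniq nyP uP size_rcons (perm_size permP) ltnn eP /= => /(_ isT).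
  move: sP; rewrite eP /= => pP'; rewrite rcons_path pP' /=.
  by move: ls; rewrite eP /= => ->; rewrite esy => /(_ isT).
case/splitPr: yP hP ls uP permP sP eP => u v hP ls uP permP sP eP.
case: v hP ls uP permP sP eP => [|w v] hP ls uP permP sP eP.
  by case/negP: ynS; apply/rot_endsP; exists (u ++ [:: y]); split=> //; rewrite last_cat.
have wS : w \in rot_ends.
  apply/rot_endsP; exists (rcons u y ++ rev (w :: v)); split.
    apply: rotation_step; first by rewrite cat_rcons.
    by move: ls; rewrite last_cat /= => ->; rewrite esym.
  by rewrite last_cat rev_cons last_rcons.
apply: contrapT => nz.
have good z : consec (x :: p) y z -> z <> w /\ exists u', u = rcons u' z.
  move=> c; have c' : consec (x :: p) z y by rewrite /consec orbC.
  have zS : z \notin rot_ends by apply/negP => zS; apply: nz; exists z.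
  have zw : z <> w by move=> zw; rewrite zw wS in zS.
  split=> //; case: (rotation_consec hP c) => [h|h|h].
  - by case: (consec_split uP h) => // -[v' [zw' _]]; case: zw.
  - by rewrite h in ynS.
  - by rewrite h in zS.
have lS : last x p \in rot_ends.
  by apply/rot_endsP; exists (x :: p); split=> //; apply: rotation_refl.
have [u1 [v1 ep]] : exists u1 v1, x :: p = u1 ++ y :: v1.
  have : y \in x :: p by rewrite -(perm_mem permP) mem_cat mem_head orbT.
  by case/splitPr => u1 v1; exists u1, v1.
(* [y] is not the last vertex of the original path, as that vertex is an end. *)
case: v1 ep => [|b v1] ep.
  by move: ynS lS; rewrite -[last x p]/(last x (x :: p)) ep last_cat /= => /negP.
have [_ [u2 eu]] : b <> w /\ exists u', u = rcons u' b.
  by apply: good; rewrite /consec ep -[[:: y, b & v1]]/([:: y; b] ++ v1) infix_infix.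
(* [y] is not the first vertex either: rotations keep it first, but [b] precedes [y] in [P]. *)
case: (lastP u1) ep => [|{}u1 a] ep.
  move: ep eP uP => [<- _]; rewrite eu; case: u2 {eu} => [|c u2] [-> _] /=.
    by rewrite mem_head.
  by rewrite !(inE, mem_cat) eqxx !orbT.
have [_ [u3 eu3]] : a <> w /\ exists u', u = rcons u' a.
  apply: good; rewrite /consec orbC ep.
  by rewrite -cats1 -catA -[[:: a] ++ _]/([:: a; y] ++ (b :: v1)) infix_infix.
have /rcons_inj[_ ba] : rcons u2 b = rcons u3 a by rewrite -eu.
move: up; rewrite ep ba cat_uniq => /and3P[_ /hasPn/(_ a)].
by rewrite !inE eqxx orbT mem_rcons mem_head => /(_ isT).
Qed.

(** Every neighbour outside [rot_ends] is next to an end on the original path, and each end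
    contributes at most two such vertices. [next] and [prev] wrap around, which can only enlarge the
    bounding set. *)
Lemma card_rot_ends_nbhd : #|rot_ends :|: nbhd e rot_ends| <= 3 * #|rot_ends|.
Proof.
have sub : rot_ends :|: nbhd e rot_ends \subset
    rot_ends :|: (next (x :: p) @: rot_ends :|: prev (x :: p) @: rot_ends).
  apply/subsetP => y; rewrite !in_setU; case yS: (y \in rot_ends) => //= hy.
  have [z zS] := nbr_consec_end hy (negbT yS).
  move=> /(consec_next_prev up)[] ->; apply/orP; [left|right]; exact: imset_f.
apply: leq_trans (subset_leq_card sub) _.
apply: leq_trans (leq_card_setU _ _) _; rewrite mulSn leq_add2l.
apply: leq_trans (leq_card_setU _ _) _.
by rewrite mulSn mul1n leq_add // leq_imset_card.
Qed.

Lemma posa : exists S : {set K}, [/\ S != set0, #|S :|: nbhd e S| <= 3 * #|S| &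
  forall z, z \in S -> exists p', [/\ uniq (x :: p'), path e x p',
     last x p' = z & size p' = size p]].
Proof.
exists rot_ends; split; last 1 first.
- move=> z /rot_endsP[P [hP lP]].
  have [pP sP [P' eP]] := rotation_inv hP; exists P'; split.
  + by rewrite -eP (perm_uniq pP).
  + by move: sP; rewrite eP.
  + by rewrite -lP eP.
  + by have := perm_size pP; rewrite eP => -[].
- apply/set0Pn; exists (last x p); apply/rot_endsP.
  by exists (x :: p); split=> //; apply: rotation_refl.
- exact: card_rot_ends_nbhd.
Qed.

End FromPath.

(* Twofold expansion into the outside, in the form |A u N(A)| > 3|A|. *)
Definition pexpander s0 := forall A : {set K}, 0 < #|A| <= s0 ->
  3 * #|A| < #|A :|: nbhd e A|.

(** Ordered pairs of ends of paths with [k] edges. When no path is longer, adding the edge of such a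
    pair makes progress towards a Hamilton cycle. *)
Definition boosters k : {set K * K} :=
  [set st | `[< exists p', [/\ uniq (st.1 :: p'), path e st.1 p',
     last st.1 p' = st.2 & size p' = k] >]].

Lemma boostersP k s t : reflect (exists p', [/\ uniq (s :: p'), path e s p',
     last s p' = t & size p' = k]) ((s, t) \in boosters k).
Proof. by rewrite inE; apply: asboolP. Qed.

(** Rotations with one end fixed produce more than [s0] other ends; reversing each of these paths
    and rotating again gives more than [s0] partners for each of them. *)
Lemma card_boosters s0 x p : pexpander s0 ->
  uniq (x :: p) -> path e x p ->
  (forall Q, uniq Q -> sorted e Q -> size Q <= (size p).+1) ->
  s0.+1 * s0.+1 <= #|boosters (size p)|.
Proof.
move=> ex up pp maxp.
have large y q : uniq (y :: q) -> path e y q -> size q = size p ->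
    exists2 S : {set K}, s0 < #|S| & forall z, z \in S -> (y, z) \in boosters (size p).
  move=> uq pq sq; have := posa uq pq; rewrite sq => /(_ maxp)[S [Sn Sle Sz]].
  exists S; last by move=> z /Sz h; apply/boostersP.
  rewrite ltnNge; apply/negP => Ss; have := ex S.
  by rewrite card_gt0 Sn Ss /= => /(_ isT); rewrite ltnNge Sle.
have [S1 cS1 hS1] := large x p up pp erefl.
have cols z : z \in S1 -> s0.+1 <= \sum_t ((z, t) \in boosters (size p) : nat).
  move=> /hS1/boostersP[q [uq pq lq sq]].
  have [|||S2 cS2 hS2] := large z (rev (belast x q)).
  - by rewrite -lq -rev_rcons -lastI rev_uniq.
  - by rewrite -lq rev_path (eq_path (e' := e)) // => a b; rewrite esym.
  - by rewrite size_rev size_belast.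
  apply: leq_trans cS2 _; rewrite -sum1_card big_mkcond /=; apply: leq_sum => t _.
  by case: ifP => // /hS2 ->.
rewrite -sum1_card big_mkcond /=.
rewrite (eq_bigr (fun st => ((st.1, st.2) \in boosters (size p) : nat))); last first.
  by case=> a b _ /=; case: (_ \in _).
rewrite -(pair_bigA _ (fun a b => ((a, b) \in boosters (size p) : nat))) /=.
rewrite (bigID (mem S1)) /=; apply: leq_trans (leq_addr _ _).
apply: (@leq_trans (\sum_(z in S1) s0.+1)); last by apply: leq_sum; exact: cols.
by rewrite sum_nat_const leq_mul2r cS1 orbT.
Qed.

(** A closed set of at most [s0] vertices would not expand, and a larger one contains [s0] vertices
    with their neighbourhood. On fewer than [6 * s0 + 2] vertices a closed set and its complement
    cannot both be this large, so the graph is connected. *)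
Lemma pexpander_closed s0 (W : {set K}) : pexpander s0 -> 0 < s0 -> W != set0 ->
  nbhd e W \subset W -> 3 * s0 < #|W|.
Proof.
move=> ex s00 W0 clW.
have [A [sA cA]] : exists A : {set K}, A \subset W /\ #|A| = minn s0 #|W|.
  exists [set i in take s0 (enum W)]; split.
    by apply/subsetP => i; rewrite inE => /mem_take; rewrite mem_enum.
  rewrite cardsE (card_uniqP _) ?take_uniq ?enum_uniq // size_take -fintype.cardE.
  by rewrite /minn; case: ltnP.
rewrite -card_gt0 in W0.
have := ex A; rewrite cA leq_min s00 W0 geq_minl => /(_ isT) h.
have : #|A :|: nbhd e A| <= #|W|.
  by apply/subset_leq_card; rewrite subUset sA (subset_trans _ clW) // nbhdS.
lia.
Qed.

End Posa.

Section Booster.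
Variables (K : finType) (e e' : rel K).
Hypotheses (esym : symmetric e) (e'sym : symmetric e').
Hypothesis sub : subrel e e'.

(** The new edge closes the path to a cycle. If the cycle is not spanning, connectivity gives an
    edge leaving it, and opening the cycle there yields a path with one more vertex. *)
Lemma booster_step s0 k s t : pexpander e s0 -> 0 < s0 -> #|K| < 6 * s0 + 2 ->
  (s, t) \in boosters e k -> e' s t ->
  (exists c : seq K, [/\ uniq c, path.cycle e' c & size c = #|K|]) \/
  (exists Q, [/\ uniq Q, sorted e' Q & size Q = k.+2]).
Proof.
move=> ex s00 ltK /boostersP[p [up pp lp sp]] est.
have cyc : path.cycle e' (s :: p).
  by rewrite /= rcons_path lp e'sym est andbT (sub_path sub).
pose P : {set K} := [set x in s :: p].
have cP : #|P| = (size p).+1 by rewrite cardsE (card_uniqP up).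
have [full|nfull] := eqVneq (~: P) set0.
  left; exists (s :: p); split=> //=.
  by have := cardsC P; rewrite full cards0 addn0 cP.
right.
have [/existsP[v /existsP[u /and3P[vP uP euv]]]|none] :=
  boolP [exists v, exists u, [&& v \notin P, u \in P & e u v]]; last first.
  have no u v : u \in P -> v \notin P -> ~~ e u v.
    move=> uP vP; apply: contra none => euv.
    by apply/existsP; exists v; apply/existsP; exists u; rewrite vP uP.
  have h1 : 3 * s0 < #|P|.
    apply: (pexpander_closed ex) => //.
      by apply/set0Pn; exists s; rewrite inE mem_head.
    apply/subsetP => v /nbhdP[u uP euv]; apply/contraT => vP.
    by rewrite (negbTE (no _ _ uP vP)) in euv.
  have h2 : 3 * s0 < #|~: P|.
    apply: (pexpander_closed ex) => //.
    apply/subsetP => v /nbhdP[u]; rewrite !in_setC => uP euv; apply/negP => vP.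
    by rewrite esym (negbTE (no _ _ vP uP)) in euv.
  by have := cardsC P; lia.
move: uP vP; rewrite !inE -!(in_cons, inE) => uP vP.
have [i c rc] := rot_to uP.
move: cyc; rewrite -(rot_cycle i) rc /= rcons_path => /andP[pc _].
exists (v :: u :: c); split.
- by rewrite cons_uniq -rc mem_rot vP rot_uniq.
- by rewrite /= pc andbT e'sym sub.
- by have := congr1 size rc; rewrite size_rot /= sp => -[<-].
Qed.
End Booster.

(** * Coordinate exchange and first-moment bounds *)

Local Open Scope ring_scope.

Section Tie.
Variables (R : realType) (T : finType) (q : T -> R).
Hypothesis hq : probv q.
Variables e1 e2 : T.
Hypotheses (ne : e1 != e2) (eqq : q e1 = q e2).

Definition swap_coord (S : {set T}) := [set x | tperm e1 e2 x \in S].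

Lemma bern_swap S : bern q (swap_coord S) = bern q S.
Proof.
rewrite /bern (reindex_inj (@perm_inj _ (tperm e1 e2))) /=.
apply: eq_bigr => x _; rewrite inE tpermK.
by case: tpermP => [->|->|//]; rewrite eqq.
Qed.

Definition tie (S : {set T}) := if e1 \in S then e2 |: S else S :\ e2.

Variable F : pred {set T}.
Hypothesis Fmono : forall S Z : {set T}, S \subset Z -> F S -> F Z.
Hypothesis Fsplit : forall S : {set T}, F (e1 |: (e2 |: S)) ->
  F (e1 |: (S :\ e2)) || F (e2 |: (S :\ e1)).

(* Resampling [e2] independently of [e1] can only help: condition on the other
   coordinates; if one of the two alone suffices, exchange them so that it is [e1]. *)
Lemma prob_tie : prob q (fun S => F (tie S)) <= prob q F.
Proof.
(* [C] asks whether [e1] alone suffices. It does not see whether [e1] and [e2] lie in [S], so [Th],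
   which exchanges them when [C] fails, is a measure-preserving involution. *)
pose C S := F (e1 |: (S :\ e2)).
pose Th S := if C S then S else swap_coord S.
have swapE x S : (x \in swap_coord S) = if x == e1 then e2 \in S
    else if x == e2 then e1 \in S else x \in S.
  rewrite inE; case: tpermP => [->|->|/eqP/negbTE-> /eqP/negbTE-> //].
    by rewrite eqxx.
  by rewrite eq_sym (negbTE ne) eqxx.
have CK S : C (swap_coord S) = C S.
  congr F; apply/setP => x; rewrite !in_setU1 !in_setD1 swapE.
  by case: (x == e1) => //=; case: (x == e2).
have swapK S : swap_coord (swap_coord S) = S.
  by apply/setP => x; rewrite !inE tpermK.
have ThK : involutive Th.
  move=> S; rewrite /Th; case CS: (C S); first by rewrite CS.
  by rewrite CK CS swapK.
have -> : prob q F = expect q (fun S => (F (Th S))%:R).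
  rewrite /prob /expect (reindex_inj (inv_inj ThK)) /=.
  by apply: eq_bigr => S _; congr (_ * _); rewrite /Th; case: ifP => // _; rewrite bern_swap.
apply: ler_expect => // S; suff h : F (tie S) -> F (Th S).
  by case: (F (tie S)) h => // ->.
rewrite /tie /Th; case e1S: (e1 \in S) => FS.
  case CS: (C S).
    apply: Fmono CS; apply/subsetP => x; rewrite !in_setU1 in_setD1.
    by case/orP => [/eqP->//|/andP[]].
  have : F (e1 |: (e2 |: S)) by apply: Fmono FS; rewrite subsetUr.
  move=> /Fsplit; rewrite -/(C S) CS /= => F2; apply: Fmono F2.
  apply/subsetP => x; rewrite in_setU1 in_setD1 swapE.
  have [->|xe1] := eqVneq x e1; first by rewrite (negbTE ne).
  by case/orP => [/eqP->|/andP[_ ->]]; rewrite ?eqxx ?e1S ?if_same.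
have h : F (S :\ e2) -> forall Z : {set T}, (forall x, x != e1 -> x != e2 -> x \in S -> x \in Z) -> F Z.
  move=> FS' Z hZ; apply: Fmono FS'; apply/subsetP => x; rewrite in_setD1 => /andP[x2 xS].
  by apply: hZ => //; apply: contraTneq xS => ->; rewrite e1S.
apply: h FS _ _ => x x1 x2 xS; case: (C S) => //.
by rewrite swapE (negbTE x1) (negbTE x2).
Qed.

End Tie.

Section NoEdges.
Variables (R : realType) (T : finType) (q : T -> R) (p : R).
Hypothesis hq : probv q.
Hypothesis hp : 0 <= p <= 1.
Variables (K : finType) (kap : K -> K -> T).

Definition no_edge (A C : {set K}) (S : {set T}) :=
  [forall x in A, forall y in C, kap x y \notin S].

Lemma prob_no_edge (A C : {set K}) :
  (forall x y x' y', x \in A -> x' \in A -> y \in C -> y' \in C ->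
     kap x y = kap x' y' -> x = x' /\ y = y') ->
  (forall x y, x \in A -> y \in C -> q (kap x y) = p) ->
  prob q (no_edge A C) = (1 - p) ^+ (#|A| * #|C|).
Proof.
move=> inj qp; pose k2 (u : K * K) := kap u.1 u.2.
pose E := k2 @: setX A C.
have -> : prob q (no_edge A C) = prob q (fun S => [disjoint S & E]).
  apply: eq_prob => S; rewrite disjoint_sym disjoint_subset; apply/forall_inP/subsetP => [h e|h x xA].
    case/imsetP => -[x y]; rewrite inE /= => /andP[xA yC] ->.
    by have /forall_inP/(_ y yC) := h x xA.
  apply/forall_inP => y yC; apply: (h (kap x y)).
  by apply/imsetP; exists (x, y); rewrite ?inE ?xA.
rewrite prob_miss big_imset /=; last first.
  move=> [x y] [x' y']; rewrite !inE /= => /andP[xA yC] /andP[x'A y'C] e.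
  by have [-> ->] := inj _ _ _ _ xA x'A yC y'C e.
rewrite (eq_bigr (fun=> 1 - p)) => [|[x y]]; last by rewrite inE /= => /andP[xA yC]; rewrite qp.
by rewrite prodr_const cardsX.
Qed.

(** Unifies two uses. With [Pr] always true, [A] and [B] lie on the two sides of a bipartite graph;
    with [Pr A B] meaning [A \subset B], they lie in one graph and [kap] is injective on the pairs
    from [A] to the complement of [B]. *)
Variable Pr : {set K} -> {set K} -> bool.
Hypothesis Prmono : forall A B B' : {set K}, B \subset B' -> Pr A B -> Pr A B'.
Hypothesis Prinj : forall A B x y x' y', Pr A B -> x \in A -> x' \in A ->
  y \notin B -> y' \notin B -> kap x y = kap x' y' -> x = x' /\ y = y'.
Hypothesis Prq : forall A B x y, Pr A B -> x \in A -> y \notin B -> q (kap x y) = p.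

(** Union bound: for |A| = a there are at most N^a choices of A and N^(f a) of B, and the absence of
    edges has probability at most (1 - p)^(a (N - f sz)). The product is at most b^a <= b, and a
    takes at most N values. *)
Lemma prob_no_expansion (f sz : nat) (b : R) : (0 < f)%N ->
  b = #|K|%:R ^+ f.+1 * (1 - p) ^+ (#|K| - f * sz) -> b <= 1 ->
  prob q (fun S => [exists A : {set K}, exists B : {set K},
     [&& Pr A B, (0 < #|A| <= sz)%N, (#|B| <= f * #|A|)%N & no_edge A (~: B) S]])
  <= #|K|%:R * b.
Proof.
move=> f0 eb b1; set N := #|K|; set y := 1 - p.
have y01 : 0 <= y <= 1 by case/andP: hp => p0 p1; rewrite /y; lra.
have y0 : 0 <= y by case/andP: y01.
have b0 : 0 <= b by rewrite eb mulr_ge0 ?exprn_ge0.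
have imcard (I : finType) (g : {ffun I -> K}) : (#|g @: [set: I]| <= #|I|)%N.
  by rewrite -cardsT leq_imset_card.
(* Sets are enumerated as images of functions. A set [B] with fewer than [f * #|A|] elements may get
   a larger image, which [Prmono] allows. *)
pose ev (a : 'I_N) (gA : {ffun 'I_a.+1 -> K}) (gB : {ffun 'I_(f * a.+1) -> K}) S :=
  [&& Pr (gA @: setT) (gB @: setT), #|gA @: setT| == a.+1, (a.+1 <= sz)%N &
      no_edge (gA @: setT) (~: (gB @: setT)) S].
apply: (@le_trans _ _ (prob q (fun S => [exists a : 'I_N, exists gA, exists gB, @ev a gA gB S]))).
  apply: prob_sub => // S /existsP[A /existsP[B /and4P[hP /andP[A0 Asz] cB nE]]].
  have [x0 x0A] : exists x0, x0 \in A by apply/set0Pn; rewrite -card_gt0.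
  have AN : (#|A|.-1 < N)%N by rewrite prednK // max_card.
  have cA : (Ordinal AN).+1 = #|A| by rewrite /= prednK.
  apply/existsP; exists (Ordinal AN); rewrite /ev.
  pose gA := [ffun i : 'I_(Ordinal AN).+1 => nth x0 (enum A) i].
  pose gB := [ffun i : 'I_(f * (Ordinal AN).+1) => nth x0 (enum B) i].
  have eA : gA @: setT = A.
    apply/setP => z; apply/imsetP/idP => [[i _ ->]|zA].
      rewrite ffunE -mem_enum mem_nth // -cardE.
      by apply: leq_trans (ltn_ord i) _; rewrite cA.
    have lt : (index z (enum A) < (Ordinal AN).+1)%N by rewrite cA cardE index_mem mem_enum.
    by exists (Ordinal lt); rewrite // ffunE nth_index // mem_enum.
  have sB : B \subset gB @: setT.
    apply/subsetP => z zB; apply/imsetP.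
    have lt : (index z (enum B) < f * (Ordinal AN).+1)%N.
      by rewrite cA; apply: leq_trans cB; rewrite cardE index_mem mem_enum.
    by exists (Ordinal lt); rewrite // ffunE nth_index // mem_enum.
  apply/existsP; exists gA; apply/existsP; exists gB.
  rewrite eA (Prmono sB hP) /=; apply/and3P; split; rewrite ?prednK //.
  apply/forall_inP => x xA; apply/forall_inP => z; rewrite inE => zB.
  have /forall_inP := forall_inP nE x xA; apply; rewrite inE.
  by apply: contra zB; apply: (subsetP sB).
have each (a : 'I_N) gA gB : prob q (@ev a gA gB) <= (y ^+ (N - f * sz)) ^+ a.+1.
  have [/and3P[h1 /eqP h2 h3]|nh] := boolP [&& Pr (gA @: setT) (gB @: setT),
      #|gA @: setT| == a.+1 & (a.+1 <= sz)%N]; last first.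
    rewrite (_ : prob _ _ = 0) ?exprn_ge0 // -(prob_pred0 q); apply: eq_prob => S.
    by rewrite /ev; apply/negbTE; apply: contra nh => /and4P[-> -> ->].
  rewrite (@eq_prob _ _ _ _ (no_edge (gA @: setT) (~: (gB @: setT)))); last first.
    by move=> S; rewrite /ev h1 h2 eqxx h3.
  rewrite prob_no_edge => [|u v u' v' hu hu' hv hv'|u v hu hv]; last 2 first.
  - by apply: Prinj h1 _ _ _ _; rewrite // -in_setC.
  - by apply: Prq h1 _ _; rewrite // -in_setC.
  rewrite h2 -exprM mulnC; apply: ler_wiXn2l; rewrite ?y0 //; first by case/andP: y01.
  rewrite leq_mul2r; apply/orP; right.
  apply: (@leq_trans (#|gB @: setT| + #|~: (gB @: setT)| - f * sz)).
    by rewrite cardsC.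
  rewrite leq_subLR leq_add2r.
  apply: leq_trans (imcard _ gB) _.
  by rewrite card_ord leq_mul2l h3 orbT.
apply: le_trans (prob_exists _ hq) _; rewrite mulr_natl -[X in b *+ X]card_ord -sumr_const.
apply: ler_sum => a _.
apply: (@le_trans _ _ (b ^+ a.+1)); last first.
  by rewrite -[leRHS]expr1; apply: ler_wiXn2l; rewrite ?b0.
apply: (@le_trans _ _ (#|{ffun 'I_a.+1 -> K}|%:R *
    (#|{ffun 'I_(f * a.+1) -> K}|%:R * (y ^+ (N - f * sz)) ^+ a.+1))).
  by apply: prob_exists_le => // gA; apply: prob_exists_le.
by rewrite !card_ffun !card_ord !natrX eb exprMn -!exprM mulSn exprD mulrA.
Qed.

End NoEdges.

(** * Sprinkling *)

Section Adjacency.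
Variables (T K : finType) (kap : K -> K -> T).

(** [kap x y] is the coordinate of the arc from [x] to [y]. A symmetric [kap] describes a random
    graph, a [kap] injective on ordered pairs a random digraph. *)
Definition adj (S : {set T}) : rel K := fun x y => (x != y) && (kap x y \in S).

Definition hamiltonian (e : rel K) :=
  [exists c : #|K|.-tuple K, uniq c && path.cycle e c].

Lemma hamiltonianP (e : rel K) :
  reflect (exists c : seq K, [/\ uniq c, path.cycle e c & size c = #|K|]) (hamiltonian e).
Proof.
apply: (iffP existsP) => [[c /andP[uc cc]]|[c [uc cc /eqP sc]]].
  by exists c; rewrite size_tuple.
by exists (Tuple sc); rewrite /= uc.
Qed.

Lemma adjS (S Z : {set T}) : S \subset Z -> subrel (adj S) (adj Z).
Proof. by move=> /subsetP h x y /andP[xy /h hk]; rewrite /adj xy. Qed.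

Lemma hamiltonian_sub (e e' : rel K) : subrel e e' -> hamiltonian e -> hamiltonian e'.
Proof.
move=> h /hamiltonianP[c [uc cc sc]]; apply/hamiltonianP; exists c; split=> //.
by case: c cc {uc sc} => //= x c; apply: sub_path.
Qed.

Lemma hamiltonian_mono (S Z : {set T}) : S \subset Z ->
  hamiltonian (adj S) -> hamiltonian (adj Z).
Proof. by move=> /adjS; apply: hamiltonian_sub. Qed.

End Adjacency.

Section Sprinkling.
Variables (R : realType) (T : finType).
Variables (K : finType) (kap : K -> K -> T).
Hypothesis kapC : forall x y, kap x y = kap y x.
Hypothesis kap_inj : forall x y x' y', x != y -> x' != y' -> kap x y = kap x' y' ->
  (x = x' /\ y = y') \/ (x = y' /\ y = x').

Notation adj := (adj kap).
Let N := #|K|.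

Lemma adj_sym S : symmetric (adj S).
Proof. by move=> x y; rewrite /adj eq_sym kapC. Qed.

Lemma pexpander_mono s0 (S Z : {set T}) : S \subset Z ->
  pexpander (adj S) s0 -> pexpander (adj Z) s0.
Proof.
move=> sub ex A hA; apply: leq_trans (ex A hA) _.
apply/subset_leq_card/setUS/subsetP => y /nbhdP[x xA h].
by apply/nbhdP; exists x => //; apply: adjS sub _ _ h.
Qed.

Lemma card_half_kap (B : {set K * K}) : (forall u, u \in B -> u.1 != u.2) ->
  (#|B| <= 2 * #|[set kap u.1 u.2 | u in B]|)%N.
Proof.
move=> hB.
pose B1 := [set u in B | (enum_rank u.1 < enum_rank u.2)%N].
have half (B' : {set K * K}) : B' \subset B -> {in B' &, forall u v, u.1 = v.2 -> u.2 = v.1 -> False} ->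
    (#|B'| <= #|[set kap u.1 u.2 | u in B]|)%N.
  move=> sB hB'; rewrite -(@card_in_imset _ _ (fun u => kap u.1 u.2) B').
    by apply/subset_leq_card/imsetS.
  move=> [x y] [x' y'] h h' /= e.
  have [//||[-> ->]//|[a b]] := kap_inj _ _ e.
  - exact: hB (subsetP sB _ h).
  - exact: hB (subsetP sB _ h').
  - by case: (hB' _ _ h h').
rewrite -(cardsID B1 B) mulSn mul1n leq_add //; apply: half.
- exact: subsetIl.
- move=> [x y] [x' y'] /=; rewrite !inE /= => /and3P[_ _ a] /and3P[_ _ b] h1 h2.
  by rewrite h1 h2 ltnNge ltnW in a.
- exact: subsetDl.
- move=> [x y] [x' y'] /=; rewrite !inE /= negb_and => /andP[/orP[/negbTE ->//|a] xB].
  rewrite negb_and => /andP[/orP[/negbTE ->//|b] x'B] h1 h2.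
  have := hB _ xB; rewrite /= -(inj_eq enum_rank_inj) -val_eqE /= h1 h2 in a *.
  by rewrite neq_ltn; move: a b; rewrite -!leqNgt => a b; lia.
Qed.

Variables (u : T -> R) (pu : R) (s0 M : nat).
Hypothesis hu : probv u.
Hypothesis upu : forall x y, x != y -> u (kap x y) = pu.
Hypotheses (s0pos : (0 < s0)%N) (s0N : (N < 6 * s0 + 2)%N) (hM : (2 * M <= s0.+1 * s0.+1)%N).

(** The marginals of the union of [j] independent random sets with marginals [u]. *)
Definition sprinkle j (x : T) : R := 1 - (1 - u x) ^+ j.

Lemma sprinkle_prob j : probv (sprinkle j).
Proof.
move=> x; case/andP: (hu x) => u0 u1.
have h0 : 0 <= 1 - u x by lra.
have := exprn_ge0 j h0; have : (1 - u x) ^+ j <= 1 by apply: exprn_ile1 => //; lra.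
by rewrite /sprinkle; set z := _ ^+ _; lra.
Qed.

Lemma sprinkle_step k (H S : {set T}) x p : pexpander (adj H) s0 ->
  uniq (x :: p) -> path (adj H) x p -> size p = k ->
  (forall Q, uniq Q -> sorted (adj H) Q -> (size Q <= k.+1)%N) ->
  ~~ [disjoint S & [set kap st.1 st.2 | st in boosters (adj H) k]] ->
  hamiltonian (adj (H :|: S)) \/
  exists Q, [/\ uniq Q, sorted (adj (H :|: S)) Q & size Q = k.+2].
Proof.
move=> ex up pp sp maxp; rewrite -setI_eq0 => /set0Pn[e].
rewrite inE => /andP[eS /imsetP[[s t] hst ee]].
(* A loop would come from a longest path without edges, so [s] would be isolated, against
   expansion. *)
have st : s != t.
  apply/eqP => st; move: hst; rewrite -st => /boostersP[p' [up' pp' lp' sp']].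
  case: p' up' pp' lp' sp' => [|y p'] up' _ lp' k0.
    have := ex [set s]; rewrite cards1 s0pos => /(_ isT); rewrite muln1.
    apply/negP; rewrite -leqNgt.
    suff -> : nbhd (adj H) [set s] = set0 by rewrite setU0 cards1.
    apply/setP => y; rewrite in_set0; apply/negP => /nbhdP[s']; rewrite inE => /eqP -> sy.
    have := maxp [:: s; y]; rewrite -k0 /= sy inE /=.
    by case/andP: sy => -> _ /(_ isT isT).
  by move: up'; rewrite /= -{1}lp' /= mem_last.
have adjst : adj (H :|: S) s t by rewrite /adj st inE -[kap s t]/(kap (s, t).1 (s, t).2) -ee eS orbT.
have [[c [uc cc sc]]|[Q hQ]] := booster_step (adj_sym _) (@adj_sym _)
   (adjS (subsetUl H S)) ex s0pos s0N hst adjst.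
- by left; apply/hamiltonianP; exists c.
- by right; exists Q.
Qed.

(** One sprinkling per induction step. The current longest path has at least [M] booster edges; the
    sprinkling misses them all with probability at most [(1 - pu) ^+ M], and otherwise it gives a
    Hamilton cycle or a longer path. Since [N < k + j], the sprinklings cannot run out. *)
Lemma prob_not_ham_sprinkle j k (H : {set T}) : pexpander (adj H) s0 -> (0 < k)%N ->
  (exists Q, [/\ uniq Q, sorted (adj H) Q & size Q = k]) -> (N < k + j)%N ->
  prob (sprinkle j) (fun S => ~~ hamiltonian (adj (H :|: S))) <= j%:R * (1 - pu) ^+ M.
Proof.
set b := (1 - pu) ^+ M.
elim: j k H => [|j IH] k H ex k0 [Q [uQ sQ szQ]] ltN.
  move: ltN; rewrite addn0 -szQ -(card_uniqP uQ) ltnNge; case/negP; exact: max_card.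
have Npos : (0 < N)%N by apply: leq_trans k0 _; rewrite -szQ -(card_uniqP uQ) max_card.
have [x0 _] : exists x0 : K, x0 \in [set: K] by apply/set0Pn; rewrite -card_gt0 cardsT.
have pu01 : 0 <= 1 - pu <= 1.
  have [y hy] : exists y, x0 != y.
    have : nbhd (adj H) [set x0] \subset [set x0] -> False.
      move=> /(pexpander_closed ex s0pos); rewrite -card_gt0 cards1 => /(_ isT); lia.
    move=> h; apply/not_existsP => hy; apply: h; apply/subsetP => y _.
    by rewrite inE eq_sym; apply/contraT => ne; case: (hy y).
  by have := hu (kap x0 y); rewrite upu // => /andP[]; lra.
have b0 : 0 <= b by apply: exprn_ge0; case/andP: pu01.
have [hamH|nhamH] := boolP (hamiltonian (adj H)).
  rewrite (_ : prob _ _ = 0) ?mulr_ge0 // -(prob_pred0 (sprinkle j.+1)).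
  by apply: eq_prob => S; apply/negbTE/negPn; apply: hamiltonian_mono hamH; apply: subsetUl.
pose P m := [exists t : m.-tuple K, uniq t && sorted (adj H) t].
have Pk : exists m, P m.
  by exists k; apply/existsP; move/eqP in szQ; exists (Tuple szQ); rewrite /= uQ.
have Pb m : P m -> (m <= N)%N.
  by move=> /existsP[t /andP[ut _]]; rewrite -(size_tuple t) -(card_uniqP ut) max_card.
have [m /existsP[t /andP[ut st]] mmax] := ex_maxnP Pk Pb.
have km : (k <= m)%N.
  by apply: mmax; apply/existsP; move/eqP in szQ; exists (Tuple szQ); rewrite /= uQ.
case: m t ut st mmax km => [|m] t ut st mmax km; first by case: k k0 km {szQ ltN}.
have [x [p ep]] : exists x p, (t : seq K) = x :: p.
  by case: (t : seq K) (size_tuple t) => // x p _; exists x, p.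
have sp : size p = m by have := size_tuple t; rewrite ep => -[].
rewrite ep in ut st.
have maxp Z : uniq Z -> sorted (adj H) Z -> (size Z <= m.+1)%N.
  move=> uZ sZ; apply: mmax; apply/existsP; exists (in_tuple Z); by rewrite uZ.
pose C := [set kap st.1 st.2 | st in boosters (adj H) m].
have -> : prob (sprinkle j.+1) (fun S => ~~ hamiltonian (adj (H :|: S))) =
   expect u (fun Z => prob (sprinkle j) (fun S => ~~ hamiltonian (adj (H :|: Z :|: S)))).
  transitivity (expect (fun x => 1 - (1 - u x) * (1 - sprinkle j x))
      (fun S => (~~ hamiltonian (adj (H :|: S)))%:R)).
    have eqs : sprinkle j.+1 =1 (fun x => 1 - (1 - u x) * (1 - sprinkle j x)).
      by move=> y; rewrite /sprinkle exprS; set z := (1 - u y) ^+ j; ring.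
    apply: eq_bigr => S _; congr (_ * _); apply: eq_bigr => y _.
    by rewrite eqs.
  rewrite -expect_union; apply: eq_expect => Z; apply: eq_expect => S.
  by rewrite setUA.
have mk : (0 < m)%N.
  have [m0|//] := posnP m.
  have : nbhd (adj H) [set x] \subset [set x].
    apply/subsetP => y /nbhdP[x']; rewrite inE => /eqP -> /[dup] axy /andP[xy _].
    have uxy : uniq [:: x; y] by rewrite /= inE xy.
    have sxy : sorted (adj H) [:: x; y] by rewrite /= axy.
    by have := maxp _ uxy sxy; rewrite m0.
  by move=> /(pexpander_closed ex s0pos); rewrite -card_gt0 cards1 => /(_ isT); lia.
have Cdiag st' : st' \in boosters (adj H) m -> st'.1 != st'.2.
  case: st' => s t' /boostersP[p' [up' _ lp' sp']] /=.
  case: p' up' lp' sp' => [|y p'] up' lp' sp'.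
    by move: mk; rewrite -sp'.
  apply/eqP => e; move: up'; rewrite /= e -lp' /= mem_last; by [].
have cC : (M <= #|C|)%N.
  have := card_half_kap Cdiag; rewrite -/C.
  have := card_boosters (@adj_sym H) ex ut st; rewrite sp => /(_ maxp).
  lia.
have missC : prob u (fun Z => [disjoint Z & C]) <= b.
  rewrite prob_miss (eq_bigr (fun=> 1 - pu)) => [|e /imsetP[st' hst ->]]; last first.
    by rewrite upu ?Cdiag.
  by rewrite prodr_const; apply: ler_wiXn2l; case/andP: pu01.
apply: (@le_trans _ _ (expect u (fun Z => [disjoint Z & C]%:R + j%:R * b))); last first.
  by rewrite expectD expect_cst -natr1 mulrDl mul1r addrC lerD2l.
apply: ler_expect => // Z.
have [dj|ndj] := boolP [disjoint Z & C].
  by apply: le_trans (prob_le1 _ (sprinkle_prob j)) _; rewrite lerDl mulr_ge0.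
rewrite add0r.
have [hamZ|[Q' hQ']] := sprinkle_step ex ut st sp maxp ndj.
  rewrite (_ : prob _ _ = 0) ?mulr_ge0 // -(prob_pred0 (sprinkle j)).
  by apply: eq_prob => S; apply/negbTE/negPn; apply: hamiltonian_mono hamZ; apply: subsetUl.
apply: (IH m.+2) => //; last by apply: leq_trans ltN _; rewrite addSnnS leq_add2r.
  by apply: pexpander_mono ex; apply: subsetUl.
by exists Q'.
Qed.

End Sprinkling.

(** * Hamilton cycles in random digraphs *)

Lemma bernoulli_ineq (R : realDomainType) (x : R) n : 0 <= x <= 1 ->
  1 - n%:R * x <= (1 - x) ^+ n.
Proof.
move=> /andP[x0 x1]; elim: n => [|n IH]; first by rewrite expr0; lra.
have h : (1 - n%:R * x) * (1 - x) <= (1 - x) ^+ n * (1 - x).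
  by apply: ler_wpM2r => //; lra.
rewrite exprSr; apply: le_trans h; rewrite -natr1.
have : 0 <= n%:R * x * x by rewrite !mulr_ge0.
by set y := n%:R; nra.
Qed.

Section Hamiltonicity.
Variables (R : realType) (T : finType) (q : T -> R) (p : R).
Hypothesis hq : probv q.
Hypothesis hp : 0 <= p <= 1.
Variables (K : finType).
Let N := #|K|.
Variables (s0 M : nat).
Hypotheses (s0pos : (0 < s0)%N) (s0N : (N < 6 * s0 + 2)%N) (hM : (2 * M <= s0.+1 * s0.+1)%N).

(** The first term bounds the failure of expansion at density p / 2, the second the failure of N
    sprinklings at density p / (2 N). *)
Definition ham_failure : R :=
  N%:R * (N%:R ^+ 4 * (1 - p / 2) ^+ (N - 3 * s0)) +
  N%:R * (1 - p / (2 * N%:R)) ^+ M.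

Hypothesis small : N%:R ^+ 4 * (1 - p / 2) ^+ (N - 3 * s0) <= 1.

Lemma prob_not_hamiltonian_sym (kap : K -> K -> T) :
  (forall x y, kap x y = kap y x) ->
  (forall x y x' y', x != y -> x' != y' -> kap x y = kap x' y' ->
     (x = x' /\ y = y') \/ (x = y' /\ y = x')) ->
  (forall x y, x != y -> q (kap x y) = p) ->
  prob q (fun S => ~~ hamiltonian (adj kap S)) <= ham_failure.
Proof.
move=> kapC kap_inj qp.
have [N0|Npos] := posnP N.
  rewrite (_ : prob _ _ = 0); last first.
    rewrite -(prob_pred0 q); apply: eq_prob => S; apply/negbTE/negPn/hamiltonianP.
    by exists [::]; split.
  by rewrite /ham_failure N0 !mul0r addr0.
have NR : 1 <= N%:R :> R by rewrite ler1n.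
have N2 : 0 < 2 * N%:R :> R by lra.
(* One half of the density goes to the expander, the other half is divided among [N] sprinklings. By
   Bernoulli's inequality the union [q2] is no denser than [q]. *)
pose q1 x := q x / 2; pose u x := q x / (2 * N%:R).
have hq1 : probv q1 by move=> x; case/andP: (hq x) => ? ?; rewrite /q1; lra.
have hu : probv u.
  move=> x; case/andP: (hq x) => ? ?; rewrite /u divr_ge0 ?ler_pdivrMr //; lra.
have hu1 x : u x * N%:R = q x / 2.
  rewrite /u; field; lra.
pose q2 x := 1 - (1 - q1 x) * (1 - sprinkle u N x).
have hq2 : probv q2.
  move=> x; case/andP: (hq1 x) => a1 a2; case/andP: (sprinkle_prob hu N x) => b1 b2.
  by rewrite /q2; set y := sprinkle _ _ _ in b1 b2 *; apply/andP; split; nra.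
have q2q x : q2 x <= q x.
  have := bernoulli_ineq N (hu x); rewrite mulrC hu1 => h.
  rewrite /q2 /sprinkle opprB addrC; case/andP: (hq1 x) => a1 a2.
  have hx : q x = 2 * q1 x by rewrite /q1; field.
  rewrite hx in h *; set y := _ ^+ _ in h *.
  have : y <= 1 by rewrite /y; apply: exprn_ile1; case/andP: (hu x) => ? ?; lra.
  nra.
have step1 : prob q (fun S => ~~ hamiltonian (adj kap S)) <=
    prob q2 (fun S => ~~ hamiltonian (adj kap S)).
  have e f : prob f (fun S => ~~ hamiltonian (adj kap S)) =
      1 - prob f (fun S => hamiltonian (adj kap S)) by rewrite prob_predC; congr (_ - _);
      apply: eq_prob => S /=; rewrite negbK.
  rewrite !e lerD2l lerN2; apply: prob_mono => // S Z; exact: hamiltonian_mono.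
apply: le_trans step1 _; rewrite /prob /q2 -expect_union.
set bb := (1 - p / (2 * N%:R)) ^+ M.
have bb0 : 0 <= bb.
  rewrite exprn_ge0 // subr_ge0 ler_pdivrMr //; case/andP: hp => ? ?; lra.
apply: (@le_trans _ _ (expect q1 (fun H =>
    (~~ `[< pexpander (adj kap H) s0 >])%:R + N%:R * bb))).
  apply: ler_expect => // H; case: (asboolP (pexpander (adj kap H) s0)) => ex /=; last first.
    apply: le_trans (prob_le1 _ (sprinkle_prob hu N)) _.
    by rewrite lerDl mulr_ge0.
  rewrite add0r; apply: (@prob_not_ham_sprinkle _ _ _ _ kapC kap_inj u _ s0 M hu _ s0pos s0N hM N 1) => //.
  - by move=> x y xy; rewrite /u qp.
  - have [x0 _] : exists x0 : K, x0 \in [set: K] by apply/set0Pn; rewrite -card_gt0 cardsT.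
    by exists [:: x0].
rewrite expectD expect_cst /ham_failure -/bb lerD2r.
pose Pr (A B : {set K}) := A \subset B.
have := @prob_no_expansion R T q1 (p / 2) hq1 _ K kap Pr _ _ _ 3 s0 _ isT erefl small.
rewrite -/N => ne; apply: le_trans (ne _ _ _ _).
- apply: prob_sub => // H /asboolPn nex.
  have [A hA] : exists A : {set K}, (0 < #|A| <= s0)%N /\ (#|A :|: nbhd (adj kap H) A| <= 3 * #|A|)%N.
    apply: contrapT => no; apply: nex => A hA; rewrite ltnNge; apply/negP => h.
    by apply: no; exists A.
  apply/existsP; exists A; apply/existsP; exists (A :|: nbhd (adj kap H) A).
  rewrite /Pr subsetUl; case: hA => -> -> /=.
  apply/forall_inP => x xA; apply/forall_inP => y; rewrite !inE negb_or => /andP[yA yN].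
  apply: contra yN => h; apply/exists_inP; exists x => //; rewrite /adj h andbT.
  by apply: contraNneq yA => <-.
- by case/andP: hp => ? ?; apply/andP; split; lra.
- by move=> A B B' sB; rewrite /Pr => sA; apply: subset_trans sB.
- move=> A B x y x' y' sA xA x'A yB y'B e.
  have neq z w : z \in A -> w \notin B -> z != w.
    by move=> zA wB; apply: contraNneq wB => <-; apply: (subsetP sA).
  have [//|[a b]] := kap_inj _ _ _ _ (neq _ _ xA yB) (neq _ _ x'A y'B) e.
  by have := neq _ _ xA y'B; rewrite a eqxx.
- move=> A B x y sA xA yB; rewrite /q1 qp //.
  by apply: contraNneq yB => <-; apply: (subsetP sA).
Qed.

Section Directed.
Variable kap : K -> K -> T.
Hypothesis kap_inj : forall x y x' y', x != y -> x' != y' -> kap x y = kap x' y' ->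
  (x = x' /\ y = y') \/ (x = y' /\ y = x').
Hypothesis qp : forall x y, x != y -> q (kap x y) = p.
Hypothesis N3 : (2 < N)%N.

(* The arc [x -> y] read off the coordinate of the opposite arc when [(y, x)] is tied. *)
Definition tied (Z : seq (K * K)) x y := if (y, x) \in Z then kap y x else kap x y.

(** A Hamilton cycle on at least three vertices does not contain both arcs between two vertices.
    This gives the splitting hypothesis of [prob_tie]. *)
Lemma next_next_neq (c : seq K) a b : uniq c -> size c = N -> a \in c ->
  next c a = b -> next c b <> a.
Proof.
move=> uc sc ac nab nba; have [i d rd] := rot_to ac.
have ur : uniq (a :: d) by rewrite -rd rot_uniq.
have sr : size (a :: d) = N by rewrite -rd size_rot.
move: nab nba; rewrite -!(next_rot i uc) rd.
case: d ur sr {rd} => [|y [|z d]] ur sr; try by move: N3; rewrite -sr.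
rewrite /= eqxx => yb; rewrite -yb; case: eqP ur => [->|_] ur; first by rewrite /= inE eqxx in ur.
by rewrite eqxx => za; rewrite /= za !inE eqxx !orbT in ur.
Qed.

(** Unties one pair. If both arcs share a coordinate nothing changes; otherwise a cycle for the tied
    coordinates is one for the set [tie], and [prob_tie] applies. *)
Lemma prob_ham_tied_step Z a b : a != b -> (a, b) \notin Z -> (b, a) \notin Z ->
  prob q (fun S => hamiltonian (adj (tied ((a, b) :: Z)) S)) <=
  prob q (fun S => hamiltonian (adj (tied Z) S)).
Proof.
move=> ab abZ baZ; set e1 := kap a b; set e2 := kap b a.
have tiedE x y : tied ((a, b) :: Z) x y = if (x, y) == (b, a) then e1 else tied Z x y.
  by rewrite /tied inE !xpair_eqE andbC; case: (x =P b) => [->|//] /=; case: (y =P a) => [->|].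
have [e12|e12] := eqVneq e1 e2.
  apply: prob_sub => // S; apply: hamiltonian_sub => x y /andP[xy h].
  rewrite /adj xy; move: h; rewrite tiedE; case: eqP => // -[-> ->].
  by rewrite /tied (negbTE abZ) -/e2 -e12.
have tied1 x y : x != y -> tied Z x y = e1 -> (x, y) = (a, b).
  move=> xy; rewrite /tied; case: ifP => [yxZ|_] e.
    have yx : y != x by rewrite eq_sym.
    have [[h1 h2]|[h1 h2]] := kap_inj yx ab e.
      by rewrite h1 h2 (negbTE abZ) in yxZ.
    by rewrite h1 h2 (negbTE baZ) in yxZ.
  have [[-> ->] //|[h1 h2]] := kap_inj xy ab e.
  by move: e12; rewrite -e h1 h2 eqxx.
have tied2 x y : x != y -> tied Z x y = e2 -> (x, y) = (b, a).
  have ba : b != a by rewrite eq_sym.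
  move=> xy; rewrite /tied; case: ifP => [yxZ|_] e.
    have yx : y != x by rewrite eq_sym.
    have [[h1 h2]|[h1 h2]] := kap_inj yx ba e.
      by rewrite h1 h2 (negbTE baZ) in yxZ.
    by rewrite h1 h2 (negbTE abZ) in yxZ.
  have [[-> ->] //|[h1 h2]] := kap_inj xy ba e.
  by move: e12; rewrite -e h1 h2 eqxx.
have mono (S S' : {set T}) : S \subset S' -> hamiltonian (adj (tied Z) S) -> hamiltonian (adj (tied Z) S').
  exact: hamiltonian_mono.
apply: le_trans (prob_tie hq e12 _ mono _); last 2 first.
- by rewrite !qp // eq_sym.
- move=> S /hamiltonianP[c [uc cc sc]].
  have restr e e' : e != e' ->
     (forall x, x \in c -> tied Z x (next c x) != e') ->
     (forall x, x \in c -> adj (tied Z) (e1 |: (e2 |: S)) x (next c x)) ->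
     (e == e1) && (e' == e2) || (e == e2) && (e' == e1) ->
     hamiltonian (adj (tied Z) (e |: (S :\ e'))).
    move=> ee' hne hin hcase; apply/hamiltonianP; exists c; split=> //.
    apply: cycle_from_next => // x xc; have /andP[xn h] := hin x xc.
    rewrite /adj xn; move: h (hne x xc); rewrite !in_setU1 in_setD1.
    case/orP: hcase => /andP[/eqP-> /eqP->].
      by case/or3P => [->//|/eqP->|->]; [rewrite eqxx | move=> ->; rewrite orbT].
    by case/or3P => [/eqP->|->//|->]; [rewrite eqxx | move=> ->; rewrite orbT].
  have hin x : x \in c -> adj (tied Z) (e1 |: (e2 |: S)) x (next c x).
    by move=> xc; apply: next_cycle cc xc.
  (* A cycle through the arc from [a] to [b] avoids the opposite arc and hence [e2]; any other cycle
     avoids [e1]. *)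
  have [/eqP nab|nab] := boolP (next c a == b).
    apply/orP; left.
    apply: restr => //; last by rewrite !eqxx.
    move=> x xc; apply/eqP => h; have /andP[xn _] := hin x xc.
    have [xb na] := tied2 _ _ xn h.
    have ac : a \in c by rewrite -na mem_next.
    by apply: (next_next_neq uc sc ac nab); rewrite -xb.
  apply/orP; right; apply: restr => //; last by rewrite !eqxx orbT.
    by rewrite eq_sym.
  move=> x xc; apply/eqP => h; have /andP[xn _] := hin x xc.
  by have [xa nb] := tied1 _ _ xn h; rewrite -xa nb eqxx in nab.
apply: prob_sub => // S; apply: hamiltonian_sub => x y /andP[xy].
rewrite tiedE /adj xy /=; case: eqP => [[-> ->]|nxy].
  by rewrite /tie /tied (negbTE abZ) => ->; rewrite setU11.
have n2 : tied Z x y != e2 by apply/eqP => h; apply: nxy; apply: tied2.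
by move=> h; rewrite /tie; case: ifP => _; rewrite ?in_setU1 ?in_setD1 ?n2 ?h ?orbT.
Qed.

(* McDiarmid's coupling: the random digraph is at least as likely to be
   Hamiltonian as the random graph, which is the fully tied digraph. *)
Lemma prob_not_hamiltonian : prob q (fun S => ~~ hamiltonian (adj kap S)) <= ham_failure.
Proof.
pose lt (u : K * K) := (enum_rank u.1 < enum_rank u.2)%N.
(* One orientation of each pair, chosen by rank: tying all of these makes the coordinates
   symmetric. *)
pose Z := [seq u <- enum {: K * K} | lt u].
have tieall : prob q (fun S => hamiltonian (adj (tied Z) S)) <=
    prob q (fun S => hamiltonian (adj kap S)).
  have : uniq Z by rewrite filter_uniq // enum_uniq.
  have : all lt Z by apply: filter_all.
  elim: Z => [|[a b] Z IH]; first by [].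
  move=> /= /andP[ltab allZ] /andP[abZ uZ]; apply: le_trans (IH allZ uZ).
  apply: prob_ham_tied_step => //.
    by apply/eqP => ab; move: ltab; rewrite /lt /= ab ltnn.
  by apply/negP => /(allP allZ); rewrite /lt /= ltnNge ltnW.
have memZ x y : ((x, y) \in Z) = (enum_rank x < enum_rank y)%N.
  by rewrite mem_filter mem_enum andbT.
have tri x y : x != y -> (enum_rank y < enum_rank x)%N = ~~ (enum_rank x < enum_rank y)%N.
  rewrite -(inj_eq enum_rank_inj) -val_eqE neq_ltn /=.
  by case: ltngtP.
have e (f : K -> K -> T) : prob q (fun S => ~~ hamiltonian (adj f S)) =
    1 - prob q (fun S => hamiltonian (adj f S)).
  by rewrite prob_predC; congr (_ - _); apply: eq_prob => S /=; rewrite negbK.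
apply: (@le_trans _ _ (prob q (fun S => ~~ hamiltonian (adj (tied Z) S)))).
  by rewrite !e lerD2l lerN2.
apply: prob_not_hamiltonian_sym.
- move=> x y; have [->//|xy] := eqVneq x y.
  by rewrite /tied !memZ tri //; case: (_ < _)%N.
- move=> x y x' y' xy x'y'; rewrite /tied.
  have yx : y != x by rewrite eq_sym.
  have y'x' : y' != x' by rewrite eq_sym.
  by case: ifP => _; case: ifP => _ e'; have [//|//|[-> ->]|[-> ->]] := kap_inj _ _ e'; auto.
- by move=> x y xy; rewrite /tied; case: ifP => _; rewrite qp // eq_sym.
Qed.

End Directed.
End Hamiltonicity.

(** * Closing a path system to a Hamilton cycle *)

Local Open Scope nat_scope.

Lemma set2_inj (T : finType) (a b c d : T) : [set a; b] = [set c; d] ->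
  (a = c /\ b = d) \/ (a = d /\ b = c).
Proof.
move=> /setP h; have := h a; have := h b; have := h c; have := h d; rewrite !inE !eqxx ?orbT /=.
move=> /orP[]/eqP hd /orP[]/eqP hc /esym/orP[]/eqP hb /esym/orP[]/eqP ha; subst; by auto.
Qed.

Lemma next_nth_ord n (w : n.-tuple 'I_n) (i : 'I_n) : uniq w ->
  tnth w (ordS i) = next w (tnth w i).
Proof.
move=> uw; rewrite !(tnth_nth i) next_nth mem_nth ?size_tuple //.
rewrite index_uniq ?size_tuple //.
have sw := size_tuple w; case: (tval w) sw => [|y p] /= sw.
  by have := ltn_ord i; rewrite -[X in (_ < X)%N -> _]sw.
have := ltn_ord i; rewrite -[X in (_ < X)%N -> _]sw ltnS leq_eqVlt => /orP[/eqP ei|lt].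
  by rewrite ei sw modnn /= nth_default.
have lt' : (i.+1 < n)%N by apply: leq_trans (eq_leq sw).
by rewrite modn_small //= (set_nth_default y).
Qed.

Lemma perm_of_cycle n (G : {set {set 'I_n}}) (w : seq 'I_n) : (2 < n)%N ->
  uniq w -> size w = n -> path.cycle (fun u v => [set u; v] \in G) w ->
  exists2 s : {perm 'I_n}, hamilton_cycle G s &
    forall u v, infix [:: u; v] w -> [set u; v] \in cycle_edges s.
Proof.
move=> n2 uw /eqP sw cw; pose t := Tuple sw.
have tinj : injective (tnth t) by apply/tuple_uniqP.
exists (perm tinj).
  rewrite /hamilton_cycle n2; apply/subsetP => e /imsetP[i _ ->].
  by rewrite !permE next_nth_ord //; apply: (next_cycle cw); apply: mem_tnth.
move=> u v h; have uw' : u \in w.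
  by apply: (mem_subseq (infixW h)); rewrite mem_head.
have /tnthP[i ui] : u \in t by [].
by apply/imsetP; exists i; rewrite // !permE next_nth_ord // -ui (infix2_next uw h).
Qed.

Section PathSystem.
Variables (n m l : nat) (c : nat -> 'I_m -> 'I_n).
Hypothesis cinj : forall j j' a a', (j <= l)%N -> (j' <= l)%N ->
  c j a = c j' a' -> j = j' /\ a = a'.
Hypothesis l2 : (1 < l)%N.

Definition rest : {set 'I_n} := [set u | [forall j : 'I_l.+1, forall a, u != c j a]].
(** Vertices of the contracted digraph: [inl a] is the path starting at the [a]-th vertex of part 0,
    and [inr u] is a leftover vertex, regarded as a path without edges. *)
Definition node := ('I_m + {u : 'I_n | u \in rest})%type.

Lemma restP u : reflect (forall j a, (j <= l)%N -> u <> c j a) (u \in rest).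
Proof.
rewrite inE; apply: (iffP forallP) => [h j a jl|h j].
  by have /forallP/(_ a)/eqP := h (Ordinal (jl : (j < l.+1)%N)).
by apply/forallP => a; apply/eqP; apply: h; rewrite -ltnS.
Qed.

(** Contracting [m] paths with [l] edges each loses [m * l] vertices. *)
Lemma card_node : (#|{: node}| + m * l)%N = n.
Proof.
rewrite card_sum card_ord card_sig.
pose f (u : 'I_l.+1 * 'I_m) := c u.1 u.2.
have finj : injective f.
  move=> [j a] [j' a'] /cinj /= /(_ (ltn_ord j) (ltn_ord j'))[e ->].
  by congr (_, _); apply: val_inj.
have -> : #|[pred u | u \in rest]| = #|~: (f @: setT)|.
  apply: eq_card => u; change ((u \in rest) = (u \in ~: (f @: setT))).
  rewrite in_setC; apply/restP/idP => [h|h j a jl e].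
    by apply/imsetP => -[[j a] _ e]; apply: (h j a) => //; rewrite -ltnS.
  by case/imsetP: h; exists (Ordinal (jl : (j < l.+1)%N), a).
have := cardsC (f @: setT); rewrite card_imset // cardsT card_prod !card_ord; lia.
Qed.

Definition node_start (x : node) := match x with inl a => c 0 a | inr u => val u end.
Definition node_end (pi : {perm 'I_m}) (x : node) :=
  match x with inl a => c l (pi a) | inr u => val u end.
(** The arc from [x] to [y] is the edge from the end of the path [x] to the start of [y]; [pi] sends
    the index of a path in part 0 to its index in part [l]. *)
Definition node_edge pi x y : {set 'I_n} := [set node_end pi x; node_start y].

Lemma node_start_inj : injective node_start.
Proof.
move=> [a|u] [b|v] //=.
- by move=> /cinj[] // _ ->.
- by move=> e; case: (restP _ (valP v) 0 a).
- by move=> e; case: (restP _ (valP u) 0 b).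
- by move=> /val_inj ->.
Qed.

Lemma node_end_inj pi : injective (node_end pi).
Proof.
move=> [a|u] [b|v] //=.
- by move=> /cinj[] // _ /perm_inj ->.
- by move=> e; case: (restP _ (valP v) l (pi a)).
- by move=> e; case: (restP _ (valP u) l (pi b)).
- by move=> /val_inj ->.
Qed.

Lemma node_end_start pi x y : node_end pi x = node_start y -> x = y.
Proof.
case: x y => [a|u] [b|v] //=.
- by move=> /cinj[] // l0; move: l2; rewrite l0.
- by move=> e; case: (restP _ (valP v) l (pi a)).
- by move=> e; case: (restP _ (valP u) 0 b).
- by move=> /val_inj ->.
Qed.

(** The second alternative does occur: both arcs between two leftover vertices are the same edge.
    This is why Hamiltonicity was proved for coordinates that opposite arcs may share. *)
Lemma node_edge_inj pi x y x' y' : x != y -> x' != y' ->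
  node_edge pi x y = node_edge pi x' y' -> (x = x' /\ y = y') \/ (x = y' /\ y = x').
Proof.
move=> _ _ /set2_inj[[/node_end_inj-> /node_start_inj->]|]; first by left.
by move=> [/node_end_start-> /esym/node_end_start->]; right.
Qed.

Lemma card_node_edge pi x y : x != y -> #|node_edge pi x y| = 2.
Proof.
by move=> xy; rewrite cards2 (contra_neq _ xy) // => /node_end_start.
Qed.

Lemma card_consecutive j a b : (j < l)%N -> #|[set c j a; c j.+1 b]| = 2.
Proof.
move=> jl; rewrite cards2; case: eqP => // /cinj[] //; first exact: ltnW.
lia.
Qed.

(* This is where [1 < l] enters: the edges closing up the path system are
   disjoint from those between consecutive parts. *)
Lemma node_edge_consecutive pi x y j a b : (j < l)%N ->
  node_edge pi x y <> [set c j a; c j.+1 b].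
Proof.
move=> jl; have jl' := ltnW jl.
have pos j' a' : (j' <= l)%N ->
   (node_end pi x = c j' a' -> j' = l) /\ (node_start y = c j' a' -> j' = 0%N).
  move=> j'l; split; [case: x => [z|u] /= e | case: y => [z|u] /= e].
  - by case: (cinj _ _ e).
  - by case: (restP _ (valP u) j' a').
  - by case: (cinj _ _ e).
  - by case: (restP _ (valP u) j' a').
move=> /set2_inj[[/(proj1 (pos _ _ jl')) e1 /(proj2 (pos _ _ jl)) e2]|]; first by [].
by move=> [/(proj1 (pos _ _ jl)) e1 /(proj2 (pos _ _ jl')) e2]; lia.
Qed.

Variable F : nat -> {perm 'I_m}.

(** [compose_upto j a] is the index in part [j] of the path that starts at index [a] of part 0. *)
Fixpoint compose_upto j : {perm 'I_m} :=
  if j is j'.+1 then (compose_upto j' * F j')%g else 1%g.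

Definition block (x : node) : seq 'I_n :=
  match x with
  | inl a => [seq c j (compose_upto j a) | j <- iota 0 l.+1]
  | inr u => [:: val u]
  end.

Variable G : {set {set 'I_n}}.
Hypothesis FG : forall j a, (j < l)%N -> [set c j a; c j.+1 (F j a)] \in G.
Let e : rel 'I_n := fun u v => [set u; v] \in G.

Lemma blockE x : exists2 r, block x = node_start x :: r &
  path e (node_start x) r /\ last (node_start x) r = node_end (compose_upto l) x.
Proof.
case: x => [a|u]; last by exists [::].
exists [seq c j (compose_upto j a) | j <- iota 1 l].
  by rewrite /= perm1.
suff h k i : (i + k <= l)%N ->
    path e (c i (compose_upto i a)) [seq c j (compose_upto j a) | j <- iota i.+1 k] /\
    last (c i (compose_upto i a)) [seq c j (compose_upto j a) | j <- iota i.+1 k] =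
      c (i + k) (compose_upto (i + k) a).
  by have := h l 0; rewrite add0n /= perm1; apply.
elim: k i => [|k IH] i ik /=; first by rewrite addn0.
have [h1 h2] := IH i.+1 ltac:(lia); rewrite h1 h2 addSnnS; split=> //.
by rewrite andbT /e permM; apply: FG; lia.
Qed.

Lemma block_infix j a : (j < l)%N ->
  infix [:: c j (compose_upto j a); c j.+1 (F j (compose_upto j a))] (block (inl a)).
Proof.
move=> jl; rewrite /block.
have -> : l.+1 = (j + (2 + (l.-1 - j)))%N by lia.
rewrite iotaD map_cat; apply: infix_catl; rewrite iotaD map_cat; apply: infix_catr.
by rewrite /= add0n permM !eqxx.
Qed.

Lemma path_flatten x (t : seq node) :
  path (fun x y => e (node_end (compose_upto l) x) (node_start y)) x t ->
  path e (node_end (compose_upto l) x) (flatten (map block t)) /\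
  last (node_end (compose_upto l) x) (flatten (map block t)) =
    node_end (compose_upto l) (last x t).
Proof.
elim: t x => [//|y t IH] x /= /andP[exy /IH[h1 h2]].
have [r -> [pr lr]] := blockE y.
by rewrite cat_path last_cat /= exy pr lr h1 h2.
Qed.

(** Replaces each node of the contracted cycle by its path. *)
Lemma ham_of_node_cycle : (2 < n)%N ->
  hamiltonian (adj (node_edge (compose_upto l)) G) ->
  exists2 s : {perm 'I_n}, hamilton_cycle G s &
    forall j a, (j < l)%N -> [set c j a; c j.+1 (F j a)] \in cycle_edges s.
Proof.
move=> n2 /hamiltonianP[t [ut ct st]].
have memt x : x \in t.
  by have [_ ->] := uniq_min_size ut (fun x _ => mem_enum predT x) (eq_leq (etrans (esym (cardE predT)) (esym st))); rewrite ?mem_enum.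
pose w := flatten (map block t).
have memblock x u : u \in block x -> u \in w.
  by move=> h; apply/flattenP; exists (block x) => //; apply: map_f.
have memw u : u \in w.
  have [ur|/restP nr] := boolP (u \in rest).
    by apply: (memblock (inr (exist _ u ur))); rewrite mem_head.
  have [j [a [jl ->]]] : exists j a, (j <= l)%N /\ u = c j a.
    apply: contrapT => no; apply: nr => j a jl e'; apply: no; by exists j, a.
  apply: (memblock (inl ((compose_upto j)^-1 a)%g)).
  apply/mapP; exists j; rewrite ?permKV //.
  by rewrite mem_iota.
have sw : size w = n.
  rewrite size_flatten /shape -map_comp sumnE big_map.
  have pt : perm_eq t (enum {: node}).
    by apply: uniq_perm; rewrite ?enum_uniq // => x; rewrite memt mem_enum.
  rewrite (perm_big _ pt) /= big_enum /= -[RHS]card_node.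
  rewrite card_sum card_ord card_sig -(card_sig (mem rest)).
  rewrite (@big_sumType _ _ _ _ _ predT) /=.
  rewrite (eq_bigr (fun=> l.+1)) => [|a _]; last by rewrite /= size_map size_iota.
  rewrite sum_nat_const card_ord mulnS [X in (_ + X = _)%N]sum1_card.
  by rewrite addnAC; congr (_ + _ + _); apply: eq_card.
(* The list has length [n] and meets every vertex, so it has no repetition. *)
have uw : uniq w.
  apply: (@leq_size_uniq _ (enum 'I_n)); rewrite ?enum_uniq //.
  by rewrite sw -cardE card_ord.
have cw : path.cycle e w.
  rewrite /w; clear -ct FG cinj l2; case: t ct => [//|x t] ct.
  have ct' : path (fun x y => e (node_end (compose_upto l) x) (node_start y)) x (rcons t x).
    by apply: sub_path ct => y z /andP[].
  have [h1 _] := path_flatten ct'.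
  have [r er [pr lr]] := blockE x.
  rewrite -cats1 map_cat flatten_cat /= cats0 er cat_path /= in h1.
  case/and3P: h1 => h3 h4 h5.
  by rewrite /= er /= rcons_path cat_path last_cat pr lr h3.
have [s hs hsw] := perm_of_cycle n2 uw sw cw.
exists s => // j a jl; apply: hsw.
(* The edge at index [a] of part [j] lies on the path whose index in part 0 is the preimage of
   [a]. *)
have ->: a = compose_upto j ((compose_upto j)^-1 a)%g by rewrite permKV.
apply: (infix_trans (block_infix _ jl)).
rewrite /w; case/splitPr: (memt (inl ((compose_upto j)^-1 a)%g)) => t1 t2.
by rewrite map_cat flatten_cat /=; apply: infix_infix.
Qed.

End PathSystem.

(** * One round of the covering *)

Section Round.
Variables (n m l : nat) (c : nat -> 'I_m -> 'I_n).
Hypothesis cinj : forall j j' a a', (j <= l)%N -> (j' <= l)%N ->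
  c j a = c j' a' -> j = j' /\ a = a'.
Hypotheses (l2 : (1 < l)%N) (n2 : (2 < n)%N).
(** Selects the edges to be covered; the matchings themselves may use any edge between consecutive
    parts. The zigzag rounds take all edges, the extra rounds only those missed before. *)
Variable Q : pred {set 'I_n}.

Definition edge_at j a b : {set 'I_n} := [set c j a; c j.+1 b].
Definition round_edges : {set {set 'I_n}} :=
  [set e | [exists j : 'I_l, exists a, exists b, e == edge_at j a b]].

Lemma edge_at_inj j a b a' b' : (j < l)%N -> edge_at j a b = edge_at j a' b' ->
  a = a' /\ b = b'.
Proof.
move=> jl /set2_inj[[h1 h2]|[h1 h2]].
  have [_ ->] := cinj (ltnW jl) (ltnW jl) h1.
  by have [_ ->] := cinj jl jl h2.
by have [/n_Sn] := cinj (ltnW jl) jl h1.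
Qed.

Definition bounded_degree Delta (S : {set {set 'I_n}}) :=
  [forall j : 'I_l, forall a,
     (#|[set b | (edge_at j a b \in S) && Q (edge_at j a b)]| <= Delta)%N &&
     (#|[set b | (edge_at j b a \in S) && Q (edge_at j b a)]| <= Delta)%N].

Definition round_covered D (S : {set {set 'I_n}}) :=
  [exists f : {ffun 'I_D -> {perm 'I_n}},
     [forall i, hamilton_cycle S (f i)] &&
     [forall j : 'I_l, forall a, forall b,
        (edge_at j a b \in S) && Q (edge_at j a b) ==>
        [exists i, edge_at j a b \in cycle_edges (f i)]]].

Section Choice.
Variable D : nat.

Definition matchings_ok (S : {set {set 'I_n}}) (f : {ffun 'I_l -> D.-tuple {perm 'I_m}}) :=
  [forall j : 'I_l, [forall i, forall a, edge_at j a (tnth (f j) i a) \in S] &&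
     [forall a, forall b, (edge_at j a b \in S) && Q (edge_at j a b) ==>
        [exists i, tnth (f j) i a == b]]].

Lemma matchings_ok_restrict S f : matchings_ok (S :&: round_edges) f = matchings_ok S f.
Proof.
have mem (j : 'I_l) a b : (edge_at j a b \in S :&: round_edges) = (edge_at j a b \in S).
  rewrite in_setI andbC; case: (_ \in S); rewrite ?andbF // andbT inE.
  by apply/existsP; exists j; apply/existsP; exists a; apply/existsP; exists b.
apply: eq_forallb => j; congr (_ && _).
  by apply: eq_forallb => i; apply: eq_forallb => a; rewrite mem.
by apply: eq_forallb => a; apply: eq_forallb => b; rewrite mem.
Qed.

(** [pick] depends only on the predicate, so the chosen matchings are a function of the edges
    between consecutive parts. The default value keeps the later events defined when no choice
    exists. *)
Definition chosen S := odflt [ffun=> [tuple of nseq D 1%g]] [pick f | matchings_ok S f].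

Lemma chosen_restrict S : chosen (S :&: round_edges) = chosen S.
Proof.
rewrite /chosen; congr odflt; apply: eq_pick => f; exact: matchings_ok_restrict.
Qed.

Definition matching_of (f : {ffun 'I_l -> D.-tuple {perm 'I_m}}) (i : 'I_D) j : {perm 'I_m} :=
  if insub j is Some j' then tnth (f j') i else 1%g.

Definition closing f i := compose_upto (matching_of f i) l.

Lemma matching_ofE f i (j : 'I_l) : matching_of f i j = tnth (f j) i.
Proof. by rewrite /matching_of insubT ?ltn_ord // => h; congr (tnth (f _) i); apply: val_inj. Qed.

Lemma round_covered_of_chosen S f : matchings_ok S f ->
  (forall i, hamiltonian (adj (@node_edge n m l c (closing f i)) S)) -> round_covered D S.
Proof.
move=> /forallP ok hh.
have FS i j a : (j < l)%N -> [set c j a; c j.+1 (matching_of f i j a)] \in S.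
  move=> jl; have /andP[/forallP/(_ i)/forallP/(_ a) h _] := ok (Ordinal jl).
  by move: h; rewrite -(matching_ofE f i (Ordinal jl)).
have ex i : exists s : {perm 'I_n}, hamilton_cycle S s /\
    forall j a, (j < l)%N -> [set c j a; c j.+1 (matching_of f i j a)] \in cycle_edges s.
  by have [s h1 h2] := ham_of_node_cycle cinj l2 (FS i) n2 (hh i); exists s.
have [g hg] := choice ex.
apply/existsP; exists [ffun i => g i]; apply/andP; split.
  by apply/forallP => i; rewrite ffunE; case: (hg i).
apply/forallP => j; apply/forallP => a; apply/forallP => b; apply/implyP => he.
have /andP[_ /forallP/(_ a)/forallP/(_ b)/implyP/(_ he)/existsP[i /eqP ib]] := ok j.
apply/existsP; exists i; rewrite ffunE /edge_at -ib -matching_ofE.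
by have [_ h] := hg i; apply: h.
Qed.

End Choice.

Section Probability.
Local Open Scope ring_scope.
Variables (R : realType) (p : R) (f sz Delta D s0 M : nat).
Hypothesis hp : 0 <= p <= 1.
Let q (e : {set 'I_n}) : R := if e \in pairs n then p else 0.
Let N := #|{: node l c}|.
Hypotheses (f0 : (0 < f)%N) (leD : (Delta <= D)%N) (Df : (D <= f * (D - Delta))%N)
  (szm : (m <= f.+1 * sz)%N).
Hypotheses (s0pos : (0 < s0)%N) (s0N : (N < 6 * s0 + 2)%N) (hM : (2 * M <= s0.+1 * s0.+1)%N)
  (N3 : (2 < N)%N).

Lemma probv_pairs : probv q.
Proof. by move=> e; rewrite /q; case: ifP => // _; rewrite lexx ler01. Qed.

Let bexp : R := m%:R ^+ f.+1 * (1 - p) ^+ (m - f * sz).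
Hypothesis bexp1 : bexp <= 1.
Hypothesis small : N%:R ^+ 4 * (1 - p / 2) ^+ (N - 3 * s0) <= 1.

Definition nonexpanding (kap : 'I_m -> 'I_m -> {set 'I_n}) (S : {set {set 'I_n}}) :=
  [exists A : {set 'I_m}, exists B : {set 'I_m},
     [&& true, (0 < #|A| <= sz)%N, (#|B| <= f * #|A|)%N & no_edge kap A (~: B) S]].

Lemma expanding_of_not_nonexpanding kap S : ~~ nonexpanding kap S ->
  expanding f sz (fun a b => kap a b \in S).
Proof.
move=> ne A hA; rewrite leqNgt; apply: contra ne => lt.
apply/existsP; exists A; apply/existsP; exists (nbhd (fun a b => kap a b \in S) A).
rewrite hA ltnW //=; apply/forall_inP => a aA; apply/forall_inP => b.
by rewrite !inE; apply: contra => h; apply/exists_inP; exists a.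
Qed.

Lemma prob_nonexpanding (kap : 'I_m -> 'I_m -> {set 'I_n}) :
  (forall a b a' b', kap a b = kap a' b' -> a = a' /\ b = b') ->
  (forall a b, #|kap a b| = 2%N) ->
  prob q (nonexpanding kap) <= m%:R * bexp.
Proof.
move=> inj c2.
have := @prob_no_expansion R _ q p probv_pairs hp 'I_m kap (fun _ _ => true) _ _ _ f sz bexp f0.
rewrite card_ord; apply => //.
- by move=> A B a b a' b' _ _ _ _ _; apply: inj.
- by move=> A B a b _ _ _; rewrite /q inE c2 eqxx.
Qed.

(** Outside [bad1] all bipartite graphs expand in both directions, so covering matchings exist;
    outside [bad2] each of the [D] path systems made from them closes up. *)
Lemma prob_round_failure :
  prob q (fun S => bounded_degree Delta S && ~~ round_covered D S) <=
  l%:R * (2 * (m%:R * bexp)) + D%:R * ham_failure p (node l c) s0 M.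
Proof.
have hq := probv_pairs.
pose bad1 (S : {set {set 'I_n}}) := [exists j : 'I_l,
  nonexpanding (edge_at j) S || nonexpanding (fun a b => edge_at j b a) S].
(* [S] determines the matchings and [Z] provides the closing edges; the event of interest has
   [Z = S]. *)
pose bad2 (S Z : {set {set 'I_n}}) := [exists i : 'I_D,
  ~~ hamiltonian (adj (@node_edge n m l c (closing (chosen D S) i)) Z)].
have bad S : bounded_degree Delta S && ~~ round_covered D S -> bad1 S || bad2 S S.
  move=> /andP[/forallP deg]; apply: contraNT; rewrite negb_or => /andP[nb1 nb2].
  have ex (j : 'I_l) : exists F : D.-tuple {perm 'I_m},
      (forall i a, edge_at j a (tnth F i a) \in S) /\
      (forall a b, (edge_at j a b \in S) && Q (edge_at j a b) -> exists i, tnth F i a = b).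
    move: nb1; rewrite negb_exists => /forallP/(_ j); rewrite negb_or => /andP[n1 n2'].
    have /forallP dj := deg j.
    have [|a|a||F [/eqP sF hF cF]] := @cover_by_matchings 'I_m
       (fun a b => edge_at j a b \in S)
       (fun a b => (edge_at j a b \in S) && Q (edge_at j a b)) f sz Delta D
       _ _ _ leD Df _ (expanding_of_not_nonexpanding n1) (expanding_of_not_nonexpanding n2').
    - by move=> a b /andP[].
    - by case/andP: (dj a).
    - by case/andP: (dj a).
    - by rewrite card_ord.
    exists (Tuple sF); split=> [i a|a b /cF[s sF' <-]].
      by apply: hF; apply: mem_tnth.
    by have /tnthP[i ->] : s \in Tuple sF by []; exists i.
  have [g hg] := choice ex.
  have ok : matchings_ok S (chosen D S).
    rewrite /chosen; case: pickP => [//|/(_ [ffun j => g j])] /negbT/negP[].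
    apply/forallP => j; rewrite ffunE; have [h1 h2] := hg j; apply/andP; split.
      by apply/forallP => i; apply/forallP => a.
    apply/forallP => a; apply/forallP => b; apply/implyP => /h2[i e].
    by apply/existsP; exists i; apply/eqP.
  apply: (round_covered_of_chosen ok) => i.
  by move: nb2; rewrite negb_exists => /forallP/(_ i); rewrite negbK.
apply: le_trans (prob_sub hq bad) _; apply: le_trans (prob_or _ _ hq) _; apply: lerD.
  rewrite -[X in X%:R * _]card_ord; apply: prob_exists_le => // j.
  apply: le_trans (prob_or _ _ hq) _; rewrite mulr_natl mulr2n; apply: lerD.
    apply: prob_nonexpanding => [a b a' b'|a b]; first exact: edge_at_inj.
    exact: (card_consecutive cinj).
  apply: prob_nonexpanding => [a b a' b' /edge_at_inj[] // -> -> //|a b].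
  exact: (card_consecutive cinj).
(* The closing edges never join consecutive parts, so on a spliced set the two roles are played by
   two independent random sets. *)
have resample (S Z : {set {set 'I_n}}) :
    bad2 ((S :&: round_edges) :|: (Z :\: round_edges)) ((S :&: round_edges) :|: (Z :\: round_edges))
    = bad2 S Z.
  set W := _ :|: _; apply: eq_existsb => i.
  have -> : chosen D W = chosen D S.
    rewrite -chosen_restrict -[RHS]chosen_restrict; congr chosen.
    by apply/setP => e; rewrite !inE; case: [exists _, _]; rewrite ?andbF ?andbT ?orbF.
  set kap := node_edge _; have ae : adj kap W =2 adj kap Z.
    move=> x y; rewrite /adj; congr (_ && _).
    have nr : kap x y \notin round_edges.
      apply/negP; rewrite inE => /existsP[j /existsP[a /existsP[b /eqP]]].
      exact: (node_edge_consecutive cinj l2).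
    by rewrite in_setU in_setI in_setD (negbTE nr) andbF.
  by congr (~~ _); apply/idP/idP; apply: hamiltonian_sub => x y; rewrite ae.
rewrite /prob -(expect_resample _ round_edges).
rewrite -[leRHS](expect_cst q); apply: ler_expect => // S.
(* With [S] fixed the path systems are fixed, while their closing edges are still random. *)
under eq_expect do rewrite resample.
rewrite -[X in X%:R * _]card_ord; apply: prob_exists_le => // i.
apply: (prob_not_hamiltonian hq hp s0pos s0N hM small) => //.
- exact: (node_edge_inj cinj l2).
- by move=> x y xy; rewrite /q inE (card_node_edge cinj l2).
Qed.

End Probability.
End Round.

(** * Designs of rounds *)

Local Open Scope nat_scope.

Section Zigzag.
Variable h : nat.
Hypothesis h0 : 0 < h.

(* The i-th zigzag Hamilton path i, i+1, i-1, i+2, ... of K_2h: consecutive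
   residues add up to 2i or 2i+1 modulo 2h. *)
Definition zigzag i j :=
  if odd j then i + uphalf j else if j./2 <= i then i - j./2 else i + 2 * h - j./2.

Lemma zigzag_lt i j : i < h -> j < 2 * h -> zigzag i j < 2 * h.
Proof. rewrite /zigzag => ih jh; case: ifP => [oj|ej]; last case: ifP; lia. Qed.

Lemma zigzag_inj i j j' : i < h -> j < 2 * h -> j' < 2 * h ->
  zigzag i j = zigzag i j' -> j = j'.
Proof.
rewrite /zigzag => ih jh jh'.
by case: ifP => oj; case: ifP => oj'; repeat (case: ifP => ?); lia.
Qed.

(** Modulo 2h, two residues with sum 2i + b are i + d and i + b - d; the one among the h residues
    after i is taken as i + d. *)
Lemma zigzag_arith i b x y : i < h -> b <= 1 -> x < 2 * h -> y < 2 * h -> x <> y ->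
  x + y = 2 * i + b \/ x + y = 2 * i + b + 2 * h ->
  exists d z w, [/\ (z = x /\ w = y) \/ (z = y /\ w = x), 1 <= d, d + 1 <= h + b,
     z = i + d & w = if d <= i + b then i + b - d else i + b + 2 * h - d].
Proof.
move=> ih b1 xh yh xy hs.
have [hx|hx] := boolP ((i < x) && (x <= i + h)).
  case/andP: hx => hx1 hx2; exists (x - i), x, y; split; [by left|lia| |lia|].
    by case: b b1 hs => [|[|]] // _ []; lia.
  by case: hs => hs; case: ifP; lia.
exists (y - i), y, x; move: hx; rewrite negb_and -!leqNgt -ltnNge => /orP hx.
have hy : i < y by case: hx; case: hs; lia.
split; [by right|lia| |lia|].
  by case: b b1 hs => [|[|]] // _ []; case: hx; lia.
by case: hs => hs; case: ifP; case: hx; lia.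
Qed.

Lemma zigzag_cover x y : x < 2 * h -> y < 2 * h -> x <> y ->
  exists2 j, j.+1 < 2 * h &
    let i := ((x + y) %% (2 * h))./2 in
    i < h /\ ((zigzag i j = x /\ zigzag i j.+1 = y) \/ (zigzag i j = y /\ zigzag i j.+1 = x)).
Proof.
move=> xh yh xy.
have [s es [hs1 hs2]] : exists2 s, (x + y) %% (2 * h) = s & s < 2 * h /\ (x + y = s \/ x + y = s + 2 * h).
  have [lt|ge] := ltnP (x + y) (2 * h); first by exists (x + y); rewrite ?modn_small //; split; [|left].
  exists (x + y - 2 * h); last by split; [lia | right; lia].
  have -> : x + y = 1 * (2 * h) + (x + y - 2 * h) by lia.
  by rewrite modnMDl modn_small; lia.
rewrite es /=; have := odd_double_half s; rewrite -mul2n.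
move: s./2 (odd s) {es} => i b; rewrite addnC => es.
have ih : i < h by lia.
have hs : x + y = 2 * i + b \/ x + y = 2 * i + b + 2 * h by rewrite es.
have [|d [z [w [hzw d1 dh hz hw]]]] := zigzag_arith ih _ xh yh xy hs; first by case: b {hs es}.
have {hz hw} [j jh [[hj hj']|[hj hj']]] : exists2 j, j.+1 < 2 * h &
    (zigzag i j = z /\ zigzag i j.+1 = w) \/ (zigzag i j = w /\ zigzag i j.+1 = z).
  (* The pair i + d, i + b - d is traversed from position 2d - 2 if the sum is odd (b = 1) and from
     2d - 1 if it is even. *)
  clear hs hs1 hs2 hzw es xh yh xy; case: b dh hw => /= dh hw.
    exists (2 * d - 2); first by lia.
    right; rewrite /zigzag.
    have -> : odd (2 * d - 2) = false by lia.
    have -> : odd (2 * d - 2).+1 by lia.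
    have -> : (2 * d - 2)./2 = d - 1 by lia.
    have -> : uphalf (2 * d - 2).+1 = d by lia.
    by move: hw; do 2 case: ifP; lia.
  exists (2 * d - 1); first by lia.
  left; rewrite /zigzag.
  have -> : odd (2 * d - 1) by lia.
  have -> : odd (2 * d - 1).+1 = false by lia.
  have -> : (2 * d - 1).+1./2 = d by lia.
  have -> : uphalf (2 * d - 1) = d by lia.
  by move: hw; do 2 case: ifP; lia.
- by exists j => //; split=> //; rewrite hj hj'; case: hzw => -[-> ->]; [left|right].
- by exists j => //; split=> //; rewrite hj hj'; case: hzw => -[-> ->]; [right|left].
Qed.
End Zigzag.

Section ZigzagGrid.
Variables (n h : nat).
Hypotheses (n0 : 0 < n) (h0 : 0 < h).
Let q := 2 * h.
Let m := n %/ q.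
Let r := n %% q.
Hypothesis hm : h <= m.

Definition ord_of (v : nat) : 'I_n := insubd (Ordinal n0) v.

Lemma ord_ofK v : v < n -> ord_of v = v :> nat.
Proof. by move=> vn; rewrite /ord_of insubdK. Qed.

(* Residue classes of size m + 1 drop their i-th member in round i. *)
Definition grid_val i z a := z + q * (a + ((z < r) && (i <= a))).
Definition grid i j (a : 'I_m) : 'I_n := ord_of (grid_val i (zigzag h i j) a).

Let q0 : 0 < q. Proof. by rewrite /q; lia. Qed.
Let nE : n = m * q + r. Proof. exact: divn_eq. Qed.

Lemma grid_val_lt i z a : z < q -> a < m -> grid_val i z a < n.
Proof.
move=> zq am; rewrite /grid_val nE.
have h1 : q * a + q <= m * q by rewrite -mulnSr mulnC leq_mul2r am orbT.
case: (ltnP z r) => zr /=; last by rewrite addn0; lia.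
case: (i <= a); last by rewrite addn0; lia.
by rewrite addn1 mulnSr; lia.
Qed.

Lemma grid_val_mod i z a : z < q -> grid_val i z a %% q = z.
Proof. by move=> zq; rewrite /grid_val addnC mulnC modnMDl modn_small. Qed.

Lemma grid_val_div i z a : z < q -> grid_val i z a %/ q = a + ((z < r) && (i <= a)).
Proof. by move=> zq; rewrite /grid_val addnC mulnC divnMDl // divn_small // addn0. Qed.

Lemma grid_inj i j j' a a' : i < h -> j <= q.-1 -> j' <= q.-1 ->
  grid i j a = grid i j' a' -> j = j' /\ a = a'.
Proof.
move=> ih jq j'q; have jq1 : j < q by lia. have j'q1 : j' < q by lia.
move=> /(congr1 val); rewrite /= !ord_ofK ?grid_val_lt ?zigzag_lt // => e.
have ez : zigzag h i j = zigzag h i j'.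
  by have := congr1 (modn^~ q) e; rewrite !grid_val_mod ?zigzag_lt.
split; first exact: zigzag_inj ez.
have := congr1 (divn^~ q) e; rewrite !grid_val_div ?zigzag_lt // ez => h1.
by apply: val_inj => /=; move: h1; case: (_ < r) => /=; last lia; do 2 case: leqP; lia.
Qed.

(** A vertex is skipped in at most one round, the one numbered by its position in its class. With
    the same leftover vertices in every round, all edges at them would be missed. *)
Definition skipped i (v : 'I_n) := (v %% q < r) && (v %/ q == i).

Lemma grid_surj i (v : 'I_n) : i < h -> ~~ skipped i v ->
  exists a : 'I_m, v = ord_of (grid_val i (v %% q) a).
Proof.
move=> ih; rewrite /skipped negb_and => hv.
have vE := divn_eq v q; have vq : v %% q < q by rewrite ltn_mod.
have vm : v %/ q <= m by apply: leq_div2r; exact: ltnW.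
have vm' : r <= v %% q -> v %/ q < m.
  move=> rv; rewrite ltn_neqAle vm andbT; apply/eqP => e.
  by have := ltn_ord v; rewrite {2}nE vE e; lia.
pose a := v %/ q - ((v %% q < r) && (i < v %/ q)).
have am : a < m.
  move: hv vm'; rewrite /a; case: (ltnP (v %% q) r) => /= vr.
    by move=> /eqP ne _; case: (ltnP i (v %/ q)) => h1; lia.
  by rewrite subn0 => _; apply.
exists (Ordinal am); apply: val_inj => /=.
rewrite ord_ofK ?grid_val_lt // /grid_val [LHS]vE addnC [_ * q]mulnC; congr (_ + q * _).
move: hv; rewrite /a; case: (ltnP (v %% q) r) => /= vr; last by rewrite subn0 addn0.
by move=> /eqP ne; case: (ltnP i (v %/ q)) => h1; rewrite ?subn0; case: leqP; lia.
Qed.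

Definition uncovered (e : {set 'I_n}) := [forall i : 'I_h, e \notin round_edges q.-1 (grid i)].

(** Two classes are consecutive in the round given by half their sum, so a pair of vertices is
    missed only if the classes coincide or an endpoint is skipped in that round. *)
Lemma uncoveredPn (u v : 'I_n) : uncovered [set u; v] ->
  let i := ((u + v) %% q)./2 in
  [\/ u %% q = v %% q, u %/ q = i | v %/ q = i].
Proof.
move=> unc i; have uq : u %% q < q by rewrite ltn_mod.
have vq : v %% q < q by rewrite ltn_mod.
have [e|/eqP ne] := eqVneq (u %% q) (v %% q); first by constructor 1.
have [j jq] := zigzag_cover h0 uq vq ne; rewrite modnDm -/q -/i => -[ih hz].
have [su|nsu] := boolP (skipped i u); first by constructor 2; case/andP: su => _ /eqP.
have [sv|nsv] := boolP (skipped i v); first by constructor 3; case/andP: sv => _ /eqP.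
have [a ua] := grid_surj ih nsu; have [b vb] := grid_surj ih nsv.
have /negP[] := forallP unc (Ordinal ih).
have jq' : j < q.-1 by lia.
rewrite inE; apply/existsP; exists (Ordinal jq').
case: hz => -[z1 z2].
  apply/existsP; exists a; apply/existsP; exists b; apply/eqP.
  by rewrite /edge_at /grid /= z1 z2 -ua -vb.
apply/existsP; exists b; apply/existsP; exists a; apply/eqP.
by rewrite /edge_at /grid /= z1 z2 -ua -vb setUC.
Qed.

(** The class of [v] has at most m + 1 vertices. If [v] is skipped, the sum of the classes is known
    up to parity, leaving 2 (m + 1) choices of u. If u is skipped, the sum modulo q determines both
    its class and its position, leaving q choices. *)
Lemma uncovered_degree (v : 'I_n) :
  #|[set u : 'I_n | uncovered [set v; u]]| <= 3 * m.+1 + q.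
Proof.
have divm (u : 'I_n) : u %/ q < m.+1 by rewrite ltnS leq_div2r // ltnW.
have half_lt (u : 'I_n) : (u + v) %% q < q by rewrite ltn_mod.
have recover (u u' : 'I_n) : u %/ q = u' %/ q -> (u + v) %% q = (u' + v) %% q -> u = u'.
  move=> e1 e2; apply: val_inj => /=; rewrite (divn_eq u q) (divn_eq u' q) e1; congr (_ + _).
  by apply/eqP; rewrite -(eqn_modDr v) e2.
pose A1 := [set u : 'I_n | u %% q == v %% q].
pose A2 := [set u : 'I_n | v %/ q == ((u + v) %% q)./2].
pose A3 := [set u : 'I_n | u %/ q == ((u + v) %% q)./2].
have sub : [set u : 'I_n | uncovered [set v; u]] \subset A1 :|: (A2 :|: A3).
  apply/subsetP => u; rewrite !inE => /uncoveredPn; rewrite addnC.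
  by case=> ->; rewrite eqxx ?orbT.
apply: leq_trans (subset_leq_card sub) _.
apply: leq_trans (leq_card_setU _ _) _.
have c1 : #|A1| <= m.+1.
  rewrite -[leqRHS]card_ord -(@card_in_imset _ _ (fun u : 'I_n => Ordinal (divm u)) A1) ?max_card //.
  move=> u u'; rewrite !inE => /eqP e1 /eqP e2 /(congr1 val) /= e3.
  by apply: recover => //; rewrite -[in LHS]modnDml -[in RHS]modnDml e1 e2.
have c2 : #|A2| <= 2 * m.+1.
  have -> : 2 * m.+1 = #|{: bool * 'I_m.+1}| by rewrite card_prod card_bool card_ord.
  rewrite -(@card_in_imset _ _ (fun u : 'I_n => (odd ((u + v) %% q), Ordinal (divm u))) A2) ?max_card //.
  move=> u u'; rewrite !inE => /eqP e1 /eqP e2 [e3 e4]; apply: recover => //.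
  by rewrite -[LHS]odd_double_half -[RHS]odd_double_half e3 -e1 -e2.
have c3 : #|A3| <= q.
  rewrite -[leqRHS]card_ord -(@card_in_imset _ _ (fun u : 'I_n => Ordinal (half_lt u)) A3) ?max_card //.
  move=> u u'; rewrite !inE => /eqP e1 /eqP e2 /(congr1 val) /= e3.
  by apply: recover; rewrite // e1 e2 e3.
apply: leq_trans (leq_add c1 (leq_trans (leq_card_setU _ _) (leq_add c2 c3))) _; lia.
Qed.

End ZigzagGrid.

(** * Extra rounds with three parts that separate every pair of vertices *)

Section ThreeParts.
Variable n : nat.
Hypothesis n0 : 0 < n.
Let k := n %/ 3.

Definition triple_pos j a := ord_of n0 (j * k + a).
Definition triple (s : {perm 'I_n}) j (a : 'I_k) : 'I_n := s (triple_pos j a).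

Lemma triple_pos_lt j (a : 'I_k) : j <= 2 -> j * k + a < n.
Proof.
move=> j2; have := ltn_ord a; have := divn_eq n 3; rewrite -/k.
have : j * k <= 2 * k by rewrite leq_mul2r j2 orbT.
lia.
Qed.

Lemma triple_pos_inj j j' (a a' : 'I_k) : j <= 2 -> j' <= 2 ->
  triple_pos j a = triple_pos j' a' -> j = j' /\ a = a'.
Proof.
move=> j2 j'2 /(congr1 val) /=; rewrite !ord_ofK ?triple_pos_lt // => e.
have k0 : 0 < k by case: a {e} => a /=; lia.
have ej : j = j'.
  have := congr1 (divn^~ k) e.
  by rewrite !divnMDl // !divn_small // !addn0.
by split=> //; apply: val_inj => /=; move: e; rewrite ej; lia.
Qed.

Lemma triple_inj s j j' (a a' : 'I_k) : j <= 2 -> j' <= 2 ->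
  triple s j a = triple s j' a' -> j = j' /\ a = a'.
Proof. by move=> j2 j'2 /perm_inj; apply: triple_pos_inj. Qed.

Definition triple_pairs : {set 'I_n * 'I_n} :=
  [set (triple_pos x.1.1 x.1.2, triple_pos x.1.1.+1 x.2) | x : 'I_2 * 'I_k * 'I_k].

Lemma card_triple_pairs : #|triple_pairs| = 2 * k * k.
Proof.
rewrite card_imset ?card_prod ?card_ord // => -[[j a] b] [[j' a'] b'] /=.
case=> /triple_pos_inj h1 /triple_pos_inj h2.
have lt2 (i : 'I_2) : i <= 2 by apply: ltnW.
have [e1 ->] := h1 (lt2 _) (lt2 _); have [_ ->] := h2 (ltn_ord j) (ltn_ord j').
by congr (_, _, _); apply: val_inj.
Qed.

Lemma triple_pairs_neq x y : (x, y) \in triple_pairs -> x != y.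
Proof.
case/imsetP => -[[j a] b] _ /= [-> ->]; apply/eqP => /triple_pos_inj[].
- exact: ltnW.
- exact: ltn_ord.
- lia.
Qed.

Definition captured (s : {perm 'I_n}) : {set 'I_n * 'I_n} :=
  [set uv | (((s^-1)%g uv.1, (s^-1)%g uv.2) \in triple_pairs)].

Lemma capturedP s u v : (u, v) \in captured s ->
  exists j (a b : 'I_k), j < 2 /\ [set u; v] = edge_at (triple s) j a b.
Proof.
rewrite inE /= => /imsetP[[[j a] b] _ [/= e1 e2]].
by exists j, a, b; split; rewrite // /edge_at /triple -e1 -e2 !permKV.
Qed.

Definition offdiag : {set 'I_n * 'I_n} := [set uv | uv.1 != uv.2].

Lemma card_offdiag : #|offdiag| = n * n.-1.
Proof.
have -> : offdiag = ~: [set (u, u) | u : 'I_n].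
  apply/setP => -[u v]; rewrite !inE /=; congr (~~ _).
  apply/eqP/imsetP => [->|[w _ [-> ->]] //]; by exists v.
have := cardsC [set (u, u) | u : 'I_n].
rewrite card_imset => [|u v [] //]; rewrite card_prod !card_ord.
move=> hh; have -> : n * n.-1 = n * n - n by rewrite -subn1 mulnBr muln1.
by rewrite -hh addKn.
Qed.

Definition capture_count u v := #|[set s : {perm 'I_n} | (u, v) \in captured s]|.

(** The symmetric group is transitive on ordered pairs of distinct vertices, so all such pairs are
    captured by equally many arrangements. *)
Lemma capture_count_le u v u' v' : u != v -> u' != v' ->
  capture_count u v <= capture_count u' v'.
Proof.
move=> uv u'v'; pose t1 := tperm u u'; pose t2 := tperm (t1 v) v'.
pose t := (t1 * t2)%g.
have tv : t v = v' by rewrite permM tpermL.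
have tu : t u = u'.
  rewrite permM tpermL tpermD //; last by rewrite eq_sym.
  by rewrite -(tpermL u u') -/t1 (inj_eq perm_inj) eq_sym.
rewrite /capture_count -(card_imset (mem [set s : {perm 'I_n} | (u, v) \in captured s]) (mulIg t)).
apply/subset_leq_card/subsetP => s' /imsetP[s]; rewrite !inE /= => hs ->.
by rewrite invMg !permM -{1}tu -tv !permK.
Qed.

Lemma sum_captured u v (P : {set 'I_n * 'I_n}) : P \subset offdiag -> u != v ->
  \sum_(s : {perm 'I_n}) #|captured s :&: P| = #|P| * capture_count u v.
Proof.
  move=> sP uv; transitivity (\sum_(s : {perm 'I_n}) \sum_(x in P) (x \in captured s : nat)).
    apply: eq_bigr => s _; rewrite -sum1_card [RHS]big_mkcond [LHS]big_mkcond /=.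
    by apply: eq_bigr => x _; rewrite inE andbC; case: (x \in P); case: (x \in captured s).
  rewrite exchange_big /= -sum_nat_const; apply: eq_bigr => -[x y] xP.
  have xy : x != y by have := subsetP sP _ xP; rewrite inE.
  transitivity (capture_count x y); last first.
    by apply/eqP; rewrite eqn_leq !capture_count_le.
  rewrite /capture_count -sum1_card [RHS]big_mkcond /=.
  by apply: eq_bigr => s _; rewrite [s \in _]in_set; case: ifP.
Qed.

Lemma capture_countE u v : u != v -> capture_count u v * (n * n.-1) = n`! * (2 * k * k).
Proof.
move=> uv; have := sum_captured (subxx offdiag) uv; rewrite card_offdiag [in RHS]mulnC => <-.
rewrite (eq_bigr (fun=> 2 * k * k)) => [|s _].
  by rewrite sum_nat_const card_Sn.
rewrite -card_triple_pairs.
have -> : captured s :&: offdiag = captured s.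
  apply/setIidPl/subsetP => -[x y]; rewrite !inE /= => /triple_pairs_neq.
  by rewrite (inj_eq perm_inj).
pose g (x : 'I_n * 'I_n) := (s x.1, s x.2).
have ginj : injective g by move=> [a b] [a' b'] [/perm_inj-> /perm_inj->].
rewrite -[RHS](card_imset _ ginj); apply: eq_card => -[x y].
apply/idP/imsetP => [hx|[[a b] hab [-> ->]]].
  by exists ((s^-1)%g x, (s^-1)%g y); [move: hx; rewrite inE | rewrite /g /= !permKV].
by rewrite inE /= !permK.
Qed.

Hypothesis nbig : n * n.-1 <= 10 * (k * k).

(** On average an arrangement captures a proportion 2 k^2 / (n (n - 1)) of the ordered pairs in [P];
    this is close to 2/9, and at least 1/5 by [nbig]. *)
Lemma capture_fifth (P : {set 'I_n * 'I_n}) : P \subset offdiag ->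
  exists s, #|P| <= 5 * #|captured s :&: P|.
Proof.
move=> sP; apply: contrapT => no.
have lt s : 5 * #|captured s :&: P| < #|P|.
  by rewrite ltnNge; apply/negP => h; apply: no; exists s.
have [/eqP P0|/set0Pn[[u v] uvP]] := boolP (P == set0).
  by have := lt 1%g; rewrite P0 setI0 !cards0.
have uv : u != v by have := subsetP sP _ uvP; rewrite inE.
have h1 : 5 * (#|P| * capture_count u v) < n`! * #|P|.
  rewrite -(sum_captured sP uv) big_distrr /= -card_Sn -sum_nat_const.
  apply: (@leq_trans (\sum_(s : {perm 'I_n}) #|P|)); last first.
    by rewrite (eq_bigl (fun s : {perm 'I_n} => s \in 'S_n)) // => s; rewrite inE.
  rewrite (bigD1 (1%g : {perm 'I_n})) //= [leqRHS](bigD1 (1%g : {perm 'I_n})) //=.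
  by rewrite -addSn; apply: leq_add; [apply: lt | apply: leq_sum => s _; apply: ltnW].
have P1 : 0 < #|P| by apply/card_gt0P; exists (u, v).
have h2 : 5 * capture_count u v < n`!.
  by rewrite -(ltn_pmul2r P1) -mulnA [capture_count u v * _]mulnC.
have n1 : 0 < n * n.-1.
  by rewrite -card_offdiag card_gt0; apply/set0Pn; exists (u, v); rewrite inE.
have : 5 * (n`! * (2 * k * k)) < n`! * (n * n.-1).
  by rewrite -(capture_countE uv) mulnA ltn_pmul2r.
rewrite mulnCA ltn_pmul2l ?fact_gt0 // => h3.
by move: nbig; rewrite leqNgt => /negP[]; move: h3; rewrite -mulnA mulnA.
Qed.

(** Each greedily chosen arrangement leaves at most 4/5 of the pairs, so after [K] of them fewer
    than one is left. *)
Lemma capture_all K : 4 ^ K * (n * n) < 5 ^ K ->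
  exists s : K.-tuple {perm 'I_n}, forall u v : 'I_n, u != v ->
    exists i : 'I_K, exists j (a b : 'I_k), j < 2 /\ [set u; v] = edge_at (triple (tnth s i)) j a b.
Proof.
move=> hK.
have [s hs] : exists s : K.-tuple {perm 'I_n},
    5 ^ K * #|offdiag :\: \bigcup_(i < K) captured (tnth s i)| <= 4 ^ K * #|offdiag|.
  elim: (K) => [|K' [s IH]].
    by exists [tuple]; rewrite !expn0 !mul1n subset_leq_card // subsetDl.
  set P := offdiag :\: _ in IH; have [t ht] := capture_fifth (subsetDl _ _ : P \subset offdiag).
  exists [tuple of t :: s].
  have sub : offdiag :\: \bigcup_(i < K'.+1) captured (tnth [tuple of t :: s] i) \subset P :\: captured t.
    rewrite big_ord_recl tnth0 /P setDDl setUC setDS //; apply: setSU.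
    by apply/bigcupsP => i _; apply: (bigcup_max i); rewrite ?tnthS.
  have := subset_leq_card sub; have := cardsID (captured t) P.
  rewrite setIC !expnS; set X := #|_ :\: \bigcup_(i < _.+1) _|; move: ht IH.
  move: #|captured t :&: P| #|P :\: captured t| #|P| #|offdiag| X (5 ^ K') (4 ^ K').
  move=> a b c d X x y h1 h2 h3 h4.
  have h5 : 5 * X <= 4 * c by lia.
  have h6 : x * (5 * X) <= x * (4 * c) by rewrite leq_mul2l h5 orbT.
  lia.
exists s => u v uv.
have uo : (u, v) \in offdiag by rewrite inE.
have [cap|ncap] := boolP ((u, v) \in \bigcup_(i < K) captured (tnth s i)).
  by case/bigcupP: cap => i _ /capturedP[j [a [b h]]]; exists i, j, a, b.
have : 0 < #|offdiag :\: \bigcup_(i < K) captured (tnth s i)|.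
  by apply/card_gt0P; exists (u, v); rewrite inE ncap uo.
move=> h1; have h2 : #|offdiag| <= n * n by rewrite card_offdiag leq_mul2l leq_pred orbT.
have h3 : 4 ^ K * #|offdiag| <= 4 ^ K * (n * n) by rewrite leq_mul2l h2 orbT.
by move: hs hK h3 h1; set X := #|_ :\: _|; case: X => // X; nia.
Qed.
End ThreeParts.

(** * Quantitative estimates *)

Local Open Scope ring_scope.

Section Chernoff.
Variables (R : realType) (T : finType) (q : T -> R).
Hypothesis hq : probv q.

Lemma expR_pow_le (x : R) k : 0 <= 1 + x -> (1 + x) ^+ k <= expR (k%:R * x).
Proof.
by move=> x0; rewrite mulrC expRM_natr; apply: lerXn2r; rewrite ?nnegrE ?expR_ge0 ?expR_ge1Dx.
Qed.

(** Markov's inequality for the power of 1 + la with exponent |S :&: C|, where la = eps / 2; the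
    bound e^(la - la^2) <= 1 + la replaces the logarithm. *)
Lemma chernoff (C : {set T}) (p mu eps : R) (k Delta : nat) :
  (forall x, x \in C -> q x <= p) -> 0 <= p -> (#|C| <= k)%N -> mu = p * k%:R ->
  0 < eps <= 1 / 2 -> (1 + eps) * mu <= Delta%:R ->
  prob q (fun S => (Delta < #|S :&: C|)%N) <= expR (- (eps ^+ 2 * mu / 8)).
Proof.
move=> qp p0 Ck emu /andP[e0 e1] hD; pose la := eps / 2.
have la0 : 0 < la by rewrite /la; lra.
have la1 : la <= 1 / 4 by rewrite /la; lra.
have mu0 : 0 <= mu by rewrite emu mulr_ge0.
pose w := expR (- (la - la ^+ 2) * Delta%:R).
have w0 : 0 < w by apply: expR_gt0.
have lad : 0 <= la - la ^+ 2 by nra.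
(* Since (1 + la) (1 - la + la^2) = 1 + la^3. *)
have inv : expR (la - la ^+ 2) <= 1 + la.
  have h : 1 <= (1 + la) * expR (- (la - la ^+ 2)).
    apply: (@le_trans _ _ ((1 + la) * (1 - (la - la ^+ 2)))); first by nra.
    by rewrite ler_pM2l ?expR_ge1Dx //; lra.
  by rewrite expRN ler_pdivlMr ?mul1r ?expR_gt0 // in h.
have markov S : (Delta < #|S :&: C|)%N%:R <= w * (1 + la) ^+ #|S :&: C|.
  have la1' : 1 <= 1 + la by lra.
  case: ltnP => h; last by rewrite mulr_ge0 ?expR_ge0 ?exprn_ge0 //; lra.
  apply: (@le_trans _ _ (w * (1 + la) ^+ Delta)); last first.
    by rewrite ler_pM2l // ler_weXn2l // ltnW.
  have : expR (la - la ^+ 2) ^+ Delta <= (1 + la) ^+ Delta.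
    by apply: lerXn2r; rewrite ?nnegrE ?expR_ge0 //; lra.
  rewrite -expRM_natr => h2; rewrite -(@ler_pM2l _ w) // in h2; apply: le_trans h2.
  by rewrite /w -expRD mulNr addNr expR0.
apply: le_trans (ler_expect hq markov) _; rewrite expectZ expect_pow.
have h1 : \prod_(x in C) (1 + q x * (1 + la - 1)) <= expR (la * mu).
  apply: (@le_trans _ _ (\prod_(x in C) expR (la * p))).
    apply: ler_prod => x xC; case/andP: (hq x) => q0 q1.
    have qpx : q x * la <= la * p by rewrite mulrC ler_pM2l // qp.
    have q0' : 0 <= q x * la by rewrite mulr_ge0 // ltW.
    have -> : 1 + la - 1 = la by ring.
    by apply/andP; split; [rewrite addr_ge0 | apply: le_trans (expR_ge1Dx _); rewrite lerD2l].
  rewrite prodr_const -expRM_natr ler_expR emu -mulrA ler_pM2l // ler_wpM2l //.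
  by rewrite ler_nat.
apply: le_trans (ler_wpM2l (ltW w0) h1) _; rewrite /w -expRD ler_expR.
have : (la - la ^+ 2) * ((1 + eps) * mu) <= (la - la ^+ 2) * Delta%:R by apply: ler_wpM2l.
(* The slack over the claimed exponent, nonnegative because [eps <= 1 / 2]. *)
have : 0 <= mu * eps ^+ 2 * (1 / 8 - eps / 4) by rewrite !mulr_ge0 ?exprn_ge0 //; lra.
have -> : - (la - la ^+ 2) * Delta%:R = - ((la - la ^+ 2) * Delta%:R) by ring.
move: (_ * Delta%:R) => d h2 h3.
suff -> : eps ^+ 2 * mu / 8 = (la - la ^+ 2) * ((1 + eps) * mu) - la * mu
    - mu * eps ^+ 2 * (1 / 8 - eps / 4) by lra.
by rewrite /la; field.
Qed.

End Chernoff.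

(** A quarter of the vertices meets both demands on [s0]: six times it, up to rounding, exceeds [k],
    for connectivity, and three times it leaves a quarter of the vertices outside the
    neighbourhoods. *)
Lemma quarter_bounds k : [/\ (k <= 4 * (k - 3 * (k %/ 4)))%N, (k <= 4 * (k %/ 4).+1)%N &
  (8 <= k)%N -> (0 < k %/ 4)%N /\ (k < 6 * (k %/ 4) + 2)%N].
Proof. by split; lia. Qed.

Lemma half_bounds k : (2 * k./2 <= k)%N /\ (k <= 2 * k./2 + 1)%N.
Proof. by split; lia. Qed.

Section SmallFailure.
Variables (R : realType) (n m l L : nat) (c : nat -> 'I_m -> 'I_n) (Q : pred {set 'I_n}).
Variable p : R.
Hypothesis cinj : forall j j' a a', (j <= l)%N -> (j' <= l)%N ->
  c j a = c j' a' -> j = j' /\ a = a'.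
Hypotheses (l2 : (1 < l)%N) (hp : 0 <= p <= 1) (L8 : (8 <= L)%N) (nL : (n < 2 ^ L.+1)%N)
  (pm : L%:R ^+ 6 <= p * m%:R).
Let E : R := expR (- L.+1%:R).

Lemma nat_le_expR k : (k <= n)%N -> k%:R <= expR L.+1%:R :> R.
Proof.
move=> kn; apply: (@le_trans _ _ ((2 ^ L.+1)%:R)).
  by rewrite ler_nat (leq_trans kn) // ltnW.
rewrite natrX -[X in expR X]mul1r expRM_natr; apply: lerXn2r; rewrite ?nnegrE ?expR_ge0 //.
by apply: le_trans (expR_ge1Dx _); lra.
Qed.

(** The common form of the failure bounds: about n^b choices, each failing with probability (1 -
    x)^r. As n <= e^(L + 1), the choices cost b (L + 1) in the exponent, and a gain of k (L + 1)
    remains. *)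
Lemma pow_tail_le (x : R) a b k r : (a <= n)%N -> 0 <= x <= 1 ->
  (b + k)%:R * L.+1%:R <= x * r%:R -> a%:R ^+ b * (1 - x) ^+ r <= E ^+ k.
Proof.
move=> an /andP[x0 x1] h.
apply: (@le_trans _ _ (expR L.+1%:R ^+ b * expR (r%:R * - x))).
  apply: ler_pM; rewrite ?exprn_ge0 //; first by lra.
    by apply: lerXn2r; rewrite ?nnegrE ?expR_ge0 ?nat_le_expR.
  by apply: expR_pow_le; lra.
rewrite /E -!expRM_natr -expRD ler_expR; move: h; rewrite natrD.
by move: (r%:R) (b%:R) (k%:R) (L.+1%:R) => r' b' k' L'; nra.
Qed.

(** Expansion by L + 1 makes a surplus of Delta / L matchings enough; [sz] is then about m / (L +
    2), so that [f.+1 * sz] reaches [m]. *)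
Let f := L.+1.
Let sz := (m %/ L.+2).+1.
Let N := #|{: node l c}|.
Let s0 := (N %/ 4)%N.
Let M := (s0.+1 * s0.+1)./2.

Lemma L_ge8 : 8 <= L%:R :> R. Proof. by rewrite (ler_nat _ 8). Qed.
Lemma natrS_L : L.+1%:R = L%:R + 1 :> R. Proof. by rewrite -natr1. Qed.

Lemma part_large : (0 < m)%N /\ L%:R ^+ 6 <= m%:R :> R.
Proof.
have L8' := L_ge8; case/andP: hp => p0 p1.
have h : L%:R ^+ 6 <= m%:R :> R by apply: (le_trans pm); rewrite ler_piMl.
split=> //; rewrite -(ltr_nat R); apply: lt_le_trans h; apply: exprn_gt0; lra.
Qed.

Lemma nodes_le : (m <= N)%N /\ (N <= n)%N.
Proof.
have := card_node cinj l2; rewrite -/N => h; split; last by apply: leq_trans (eq_leq h); rewrite leq_addr.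
by rewrite /N card_sum card_ord leq_addr.
Qed.

(** About m / (L + 2) vertices lie outside the neighbourhood and there are about m^(L + 3) choices,
    so p m has to exceed about L^3; [pm] provides L^6. *)
Lemma expansion_failure_small : m%:R ^+ f.+2 * (1 - p) ^+ (m - f * sz) <= E ^+ 4.
Proof.
have L8' := L_ge8; have [m0 mL] := part_large; have [mN Nn] := nodes_le.
case/andP: (hp) => p0 p1.
apply: pow_tail_le => //; first exact: leq_trans Nn.
have h1 : m%:R <= (m - f * sz)%:R + (f * sz)%:R :> R by rewrite -natrD ler_nat; lia.
have h2 : (f * sz)%:R * (L%:R + 2) <= (L%:R + 1) * (m%:R + L%:R + 2) :> R.
  have h : (m %/ L.+2)%:R * (L%:R + 2) <= m%:R :> R.
    have -> : L%:R + 2 = L.+2%:R :> R by rewrite -!natr1; ring.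
    by rewrite -natrM ler_nat leq_trunc_div.
  by rewrite /f /sz natrM -!natr1; nra.
have h3 : m%:R - (L%:R + 1) * (L%:R + 2) <= (m - f * sz)%:R * (L%:R + 2) :> R by nra.
rewrite /f natrD -!natr1; move: L8' pm h3 p0 p1; set r := (m - _)%:R; move: L%:R m%:R => l' m'.
move=> L8' pm' h3 p0 p1.
have h4 : p * m' - (l' + 1) * (l' + 2) <= p * r * (l' + 2) by nra.
have h5 : (l' + 2 + 2 + 4) * (l' + 1) * (l' + 2) + (l' + 1) * (l' + 2) <= l' ^+ 6.
  have h6 : l' ^+ 6 = l' ^+ 3 * (l' ^+ 3) by ring.
  have h7 : 512 <= l' ^+ 3 by rewrite (_ : 512 = 8 ^+ 3) ?lerXn2r ?nnegrE //; [lra | ring].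
  have : 512 * l' ^+ 3 <= l' ^+ 6 by rewrite h6 ler_wpM2r //; lra.
  nra.
have l2' : 0 < l' + 2 by lra.
rewrite -(ler_pM2r l2'); nra.
Qed.

Lemma E_bounds : 0 < E /\ 2 * E <= 1.
Proof.
have L8' := L_ge8; split; first by apply: expR_gt0.
have : 2 <= expR L.+1%:R :> R by apply: le_trans (expR_ge1Dx _); rewrite natrS_L; lra.
by rewrite /E expRN; move=> h; rewrite ler_pdivrMr ?expR_gt0 ?mul1r.
Qed.

(** 768 is 6 times 128: the sprinkling exponent p M / (2 N) is at least p N / 128 and has to reach 6
    (L + 1). *)
Lemma pow6_ge : 768 * (L%:R + 1) <= L%:R ^+ 6 :> R.
Proof.
have L8' := L_ge8; move: L%:R L8' => x x8.
have h2 : 64 <= x ^+ 2 by nra.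
have -> : x ^+ 6 = x * (x * (x ^+ 2 * x ^+ 2)) by ring.
have h4 : 64 * 64 <= x ^+ 2 * x ^+ 2 by nra.
have h5 : 8 * (64 * 64) <= x * (x ^+ 2 * x ^+ 2) by nra.
nra.
Qed.

Lemma nodes_pm : L%:R ^+ 6 <= p * N%:R /\ L%:R ^+ 6 <= N%:R :> R.
Proof.
have [mN _] := nodes_le; case/andP: hp => p0 p1; have [_ mL] := part_large.
have h : m%:R <= N%:R :> R by rewrite ler_nat.
by split; [apply: le_trans pm _; rewrite ler_wpM2l | apply: le_trans mL h].
Qed.

Lemma quarter_nodes : N%:R <= 4 * (N - 3 * s0)%:R :> R.
Proof. by rewrite -(natrM _ 4) ler_nat; case: (quarter_bounds N). Qed.

Lemma posa_failure_small : N%:R ^+ 5 * (1 - p / 2) ^+ (N - 3 * s0) <= E ^+ 5.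
Proof.
have L8' := L_ge8; have [mN Nn] := nodes_le; have [pN NL] := nodes_pm.
case/andP: (hp) => p0 p1; have hq := quarter_nodes; have h6 := pow6_ge.
apply: pow_tail_le => //; first by apply/andP; split; lra.
rewrite natrS_L; have : p * N%:R <= p * (4 * (N - 3 * s0)%:R) by rewrite ler_wpM2l.
have -> : (5 + 5)%:R = 10 :> R by [].
set r := (N - _)%:R; set x := L%:R in L8' h6 *; nra.
Qed.

Lemma sprinkling_failure_small : N%:R ^+ 1 * (1 - p / (2 * N%:R)) ^+ M <= E ^+ 5.
Proof.
have L8' := L_ge8; have [mN Nn] := nodes_le; have [pN NL] := nodes_pm.
case/andP: (hp) => p0 p1; have h6 := pow6_ge.
have Npos : 0 < N%:R :> R by apply: lt_le_trans NL; apply: exprn_gt0; lra.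
have N6 : 6 <= N%:R :> R by apply: le_trans NL; apply: le_trans h6; lra.
have u01 : 0 <= p / (2 * N%:R) <= 1.
  apply/andP; split; first by rewrite divr_ge0 //; lra.
  by rewrite ler_pdivrMr; lra.
apply: pow_tail_le => //.
have hM : N%:R * N%:R <= 64 * M%:R :> R.
  have h1 : N%:R <= 4 * s0.+1%:R :> R.
    by rewrite -(natrM _ 4) ler_nat; case: (quarter_bounds N).
  have h2 : s0.+1%:R * s0.+1%:R <= 2 * M%:R + 1 :> R.
    have h3 : (s0.+1 * s0.+1 <= 2 * M + 1)%N := proj2 (half_bounds _).
    by rewrite -natrM; apply: le_trans (_ : (2 * M + 1)%:R <= _); rewrite ?ler_nat // natrD natrM.
  move: h1 h2 N6; move: s0.+1%:R N%:R M%:R => a b d h1 h2 h3; nra.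
have -> : p / (2 * N%:R) * M%:R = p * M%:R / (2 * N%:R) by ring.
have N2 : 0 < 2 * N%:R :> R by lra.
rewrite ler_pdivlMr // natrS_L.
have -> : (1 + 5)%:R = 6 :> R by [].
have h7 : p * (N%:R * N%:R) <= p * (64 * M%:R) by rewrite ler_wpM2l.
move: pN h6 h7 Npos; move: N%:R M%:R => b d; set y := L%:R + 1; set z := L%:R ^+ 6.
move=> pN h6 h7 b0; have : 768 * y * b <= p * b * b by rewrite ler_wpM2r; lra.
nra.
Qed.

Lemma ham_failure_small : ham_failure p (node l c) s0 M <= E ^+ 4.
Proof.
have [E0 E1] := E_bounds; rewrite /ham_failure -/N mulrA -exprS.
apply: le_trans (lerD posa_failure_small sprinkling_failure_small) _.
rewrite -mulr2n -mulr_natl exprS mulrA -[leRHS]mul1r ler_wpM2r //.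
by rewrite exprn_ge0 // ltW.
Qed.

Lemma posa_failure_le1 : N%:R ^+ 4 * (1 - p / 2) ^+ (N - 3 * s0) <= 1.
Proof.
have [E0 E1] := E_bounds; have [mN Nn] := nodes_le; have [pN NL] := nodes_pm.
have [m0 _] := part_large; case/andP: (hp) => p0 p1.
apply: (@le_trans _ _ (E ^+ 5)); last by apply: exprn_ile1; lra.
apply: le_trans posa_failure_small; rewrite ler_wpM2r ?exprn_ge0 //; first by lra.
by rewrite ler_weXn2l // ler1n (leq_trans m0).
Qed.

Lemma expansion_failure_le1 : m%:R ^+ f.+1 * (1 - p) ^+ (m - f * sz) <= 1.
Proof.
have [E0 E1] := E_bounds; have [m0 _] := part_large; case/andP: (hp) => p0 p1.
apply: (@le_trans _ _ (E ^+ 4)); last by apply: exprn_ile1; lra.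
apply: le_trans expansion_failure_small; rewrite ler_wpM2r ?exprn_ge0 //; first by lra.
by rewrite ler_weXn2l // ler1n.
Qed.

Let q (e : {set 'I_n}) : R := if e \in pairs n then p else 0.

(** [D] exceeds [Delta] by more than Delta / L, hence [D <= f * (D - Delta)]; the failure terms are
    each at most [E ^+ 4]. *)
Lemma prob_round_failure_small Delta D : D = (Delta + (Delta %/ L).+1)%N ->
  prob q (fun S => bounded_degree l c Q Delta S && ~~ round_covered l c Q D S)
    <= (2 * l + D)%:R * E ^+ 4.
Proof.
move=> eD; have [mN Nn] := nodes_le; have [pN NL] := nodes_pm.
have Nbig : (8 <= N)%N.
  rewrite -(ler_nat R); apply: le_trans NL; apply: le_trans pow6_ge; have := L_ge8; lra.
have DE : (D <= f * (D - Delta))%N.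
  rewrite eD addKn /f; have : (Delta < (Delta %/ L).+1 * L)%N by rewrite ltn_ceil // (leq_trans _ L8).
  by rewrite mulnC mulSn => /ltnW h; rewrite addnC leq_add2l.
have leD : (Delta <= D)%N by rewrite eD leq_addr.
have szm : (m <= f.+1 * sz)%N by rewrite /f /sz mulnC ltnW // ltn_ceil.
have n3 : (2 < n)%N by apply: leq_trans Nn; apply: leq_trans Nbig.
have [_ _ /(_ Nbig)[s01 s02]] := quarter_bounds N.
have N3 : (2 < N)%N by apply: leq_trans Nbig.
apply: le_trans (prob_round_failure cinj l2 n3 Q hp (ltn0Sn L) leD DE szm s01 s02
  (proj1 (half_bounds _)) N3 expansion_failure_le1 posa_failure_le1) _.
have -> : (2 * l + D)%:R * E ^+ 4 = l%:R * (2 * E ^+ 4) + D%:R * E ^+ 4.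
  by rewrite natrD natrM; ring.
apply: lerD.
  rewrite ler_wpM2l // ler_wpM2l // mulrA -exprS.
  exact: expansion_failure_small.
by rewrite ler_wpM2l // ham_failure_small.
Qed.

End SmallFailure.

(** * The covering of a typical graph *)

Lemma ham_coverable_of_seq n (G : {set {set 'I_n}}) (s : seq {perm 'I_n}) :
  (forall t, t \in s -> hamilton_cycle G t) ->
  (forall e, e \in G -> exists2 t, t \in s & e \in cycle_edges t) ->
  ham_coverable G (size s).
Proof.
move=> hs cs; apply/existsP; exists [ffun i => tnth (in_tuple s) i]; apply/andP; split.
  by apply/forallP => i; rewrite ffunE; apply: hs; apply: mem_tnth.
apply/subsetP => e /cs[t ts et].
have /tnthP[i ti] : t \in in_tuple s by [].
by apply/bigcupP; exists i; rewrite // ffunE -ti.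
Qed.

Lemma round_coveredP n m l (c : nat -> 'I_m -> 'I_n) (Q : pred {set 'I_n}) D S :
  round_covered l c Q D S -> exists s : D.-tuple {perm 'I_n},
    (forall t, t \in s -> hamilton_cycle S t) /\
    (forall j a b, (j < l)%N -> edge_at c j a b \in S -> Q (edge_at c j a b) ->
       exists2 t, t \in s & edge_at c j a b \in cycle_edges t).
Proof.
move=> /existsP[f /andP[/forallP hf /forallP cf]].
exists [tuple f i | i < D]; split=> [t /mapP[i _ ->]//|j a b jl eS eQ].
have /forallP/(_ a)/forallP/(_ b) := cf (Ordinal jl).
rewrite eS eQ /= => /existsP[i hi]; exists (f i) => //.
by apply: map_f; rewrite mem_enum.
Qed.

Section Levels.
Variables (n L : nat).
Hypothesis n0 : (0 < n)%N.
Let h := (L * L)%N.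
Let q := (2 * h)%N.
Let K := (8 * L.+1)%N.
Variable s : K.-tuple {perm 'I_n}.
Hypothesis hs : forall u v : 'I_n, u != v ->
  exists i : 'I_K, exists j (a b : 'I_(n %/ 3)), (j < 2)%N /\ [set u; v] = edge_at (triple n0 (tnth s i)) j a b.

Let rest_pred : pred {set 'I_n} := uncovered h n0.

Lemma coverable_of_rounds (G : {set {set 'I_n}}) D0 D1 : G \subset pairs n ->
  (forall i : 'I_h, round_covered q.-1 (grid (h := h) n0 i) xpredT D0 G) ->
  (forall t : 'I_K, round_covered 2 (triple n0 (tnth s t)) rest_pred D1 G) ->
  ham_coverable G (h * D0 + K * D1)%N.
Proof.
move=> sG c0 c1.
have [g0 hg0] := choice (fun i => round_coveredP (c0 i)).
have [g1 hg1] := choice (fun i => round_coveredP (c1 i)).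
pose ss := flatten [seq tval (g0 i) | i <- enum 'I_h] ++ flatten [seq tval (g1 t) | t <- enum 'I_K].
have sz (k D : nat) (g : 'I_k -> D.-tuple {perm 'I_n}) :
    size (flatten [seq tval (g i) | i <- enum 'I_k]) = (k * D)%N.
  rewrite size_flatten /shape -map_comp sumnE big_map (eq_bigr (fun=> D)) => [|i _]; last by rewrite /= size_tuple.
  by rewrite big_enum /= sum_nat_const card_ord.
have <- : size ss = (h * D0 + K * D1)%N by rewrite size_cat !sz.
have mem0 i t : t \in g0 i -> t \in ss.
  by move=> ht; rewrite mem_cat; apply/orP; left; apply/flattenP; exists (tval (g0 i)) => //; apply/mapP; exists i; rewrite ?mem_enum.
have mem1 i t : t \in g1 i -> t \in ss.
  by move=> ht; rewrite mem_cat; apply/orP; right; apply/flattenP; exists (tval (g1 i)) => //; apply/mapP; exists i; rewrite ?mem_enum.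
apply: ham_coverable_of_seq => [t|e eG].
  by rewrite mem_cat => /orP[] /flattenP[_ /mapP[i _ ->]]; [case: (hg0 i) | case: (hg1 i)]; move=> hh _; apply: hh.
have [unc|] := boolP (rest_pred e).
  have := subsetP sG e eG; rewrite inE => /cards2P[u [v [uv euv]]].
  have [i [j [a [b [j2 eab]]]]] := hs uv.
  have [_ /(_ j a b j2)] := hg1 i; rewrite -eab -euv => /(_ eG unc)[t ht et].
  by exists t => //; apply: mem1 ht.
rewrite negb_forall => /existsP[i]; rewrite negbK inE => /existsP[j /existsP[a /existsP[b /eqP eab]]].
have [_ /(_ j a b (ltn_ord j))] := hg0 i; rewrite -eab => /(_ eG isT)[t ht et].
by exists t => //; apply: mem0 ht.
Qed.

End Levels.

Section Degrees.
Variables (n m l : nat) (c : nat -> 'I_m -> 'I_n).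
Hypothesis cinj : forall j j' a a', (j <= l)%N -> (j' <= l)%N ->
  c j a = c j' a' -> j = j' /\ a = a'.
Variable Q : pred {set 'I_n}.

Definition star j a : {set {set 'I_n}} := [set edge_at c j a b | b : 'I_m].
Definition costar j a : {set {set 'I_n}} := [set edge_at c j b a | b : 'I_m].

Lemma card_star j a : (#|star j a| <= m)%N.
Proof. by apply: leq_trans (leq_imset_card _ _) _; rewrite card_ord. Qed.

Lemma card_costar j a : (#|costar j a| <= m)%N.
Proof. by apply: leq_trans (leq_imset_card _ _) _; rewrite card_ord. Qed.

(** Turns degrees into sizes of sets of edges at one vertex, to which tail bounds and inclusions
    apply. *)
Lemma bounded_degree_inj Delta (S : {set {set 'I_n}}) :
  (forall j a (X : {set {set 'I_n}}), (j < l)%N ->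
     X \subset star j a \/ X \subset costar j a ->
     (forall e, e \in X -> e \in S /\ Q e) -> (#|X| <= Delta)%N) ->
  bounded_degree l c Q Delta S.
Proof.
move=> hX; apply/forallP => j; apply/forallP => a; apply/andP; split.
  rewrite -(@card_in_imset _ _ (edge_at c j a)) => [|b b' _ _ /(edge_at_inj cinj (ltn_ord j))[] //].
  apply: (hX j a _ (ltn_ord j)); first by left; apply/subsetP => e /imsetP[b _ ->]; apply: imset_f.
  by move=> e /imsetP[b]; rewrite inE => /andP[h1 h2] ->.
rewrite -(@card_in_imset _ _ (fun b => edge_at c j b a)) => [|b b' _ _ /(edge_at_inj cinj (ltn_ord j))[] //].
apply: (hX j a _ (ltn_ord j)); first by right; apply/subsetP => e /imsetP[b _ ->]; apply: imset_f.
by move=> e /imsetP[b]; rewrite inE => /andP[h1 h2] ->.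
Qed.

End Degrees.

(** As 2 * 4^4 < 5^4 and n^2 <= 2^(2 (L + 1)), a number 8 (L + 1) of arrangements suffices. *)
Lemma pow4_5_bound n L : (n < 2 ^ L.+1)%N -> (4 ^ (8 * L.+1) * (n * n) < 5 ^ (8 * L.+1))%N.
Proof.
move=> nL; have -> : (8 * L.+1 = 4 * (2 * L.+1))%N by lia.
rewrite !(expnM _ 4); apply: (@leq_ltn_trans ((4 ^ 4) ^ (2 * L.+1) * 2 ^ (2 * L.+1))%N).
  by apply: leq_mul => //; rewrite mul2n -addnn expnD leq_mul // ltnW.
by rewrite -expnMn ltn_exp2r.
Qed.

Lemma third_square_bound n : (100 <= n)%N -> (n * n.-1 <= 10 * (n %/ 3 * (n %/ 3)))%N.
Proof.
move=> n100; have h : (n <= 3 * (n %/ 3) + 2)%N by lia.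
have k32 : (32 <= n %/ 3)%N by lia.
move: (n %/ 3)%N h k32 => k h k32; have : (n.-1 <= n)%N by lia.
move=> h1; apply: leq_trans (leq_mul h (leq_trans h1 h)) _; nia.
Qed.

(** * Choice of parameters and the number of cycles *)

Section Main.
Variables (R : realType) (n L : nat) (p : R).
Hypotheses (hp : 0 <= p <= 1) (L16 : (16 <= L)%N) (nL : (n < 2 ^ L.+1)%N)
  (np : L%:R ^+ 9 <= p * n%:R).
Let h := (L * L)%N.
Let q := (2 * h)%N.
Let m := (n %/ q)%N.
Let k := (n %/ 3)%N.
Let K := (8 * L.+1)%N.
(** The mean degree of a vertex into one part. *)
Let x : R := p * m%:R.

Lemma L_ge16 : 16 <= L%:R :> R. Proof. by rewrite (ler_nat _ 16). Qed.

Lemma n_ge_pow9 : (L ^ 9 <= n)%N.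
Proof.
rewrite -(ler_nat R) natrX; apply: (le_trans np).
by case/andP: hp => p0 p1; rewrite ler_piMl.
Qed.

Lemma part_size_bounds : [/\ (L ^ 6 <= m)%N, (n <= 2 * q * m)%N, (q * m <= n)%N & (100 <= n)%N].
Proof.
have L9 := n_ge_pow9.
have q0 : (0 < q)%N by rewrite /q /h; lia.
have h3 : (q * m <= n)%N by rewrite mulnC leq_trunc_div.
have h4 : (n < m.+1 * q)%N by rewrite ltn_ceil.
have e9 : (L ^ 9 = L ^ 2 * (L * L ^ 6))%N by rewrite -expnS -expnD.
have q2 : (q = 2 * L ^ 2)%N by rewrite /q /h expnS expn1.
have L2 : (0 < L ^ 2)%N by rewrite expn_gt0; lia.
have L6 : (16 <= L ^ 6)%N by rewrite expnS; have := expn_gt0 L 5; nia.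
have h1 : (L ^ 6 <= m)%N.
  have h5 : (L ^ 2 * (L * L ^ 6) < L ^ 2 * (m.+1 * 2))%N.
    by rewrite -e9; apply: leq_ltn_trans L9 _; move: h4; rewrite q2; nia.
  by rewrite ltn_pmul2l // in h5; nia.
split=> //; first by nia.
by apply: leq_trans L9; rewrite e9; nia.
Qed.

(** Dividing L^9 by 2 q = 4 L^2 leaves L^7 / 4. *)
Lemma part_degree_ge_pow6 : L%:R ^+ 6 <= x.
Proof.
have [_ h2 _ _] := part_size_bounds; case/andP: (hp) => p0 p1; have L16' := L_ge16.
have h3 : n%:R <= 4 * L%:R ^+ 2 * m%:R :> R.
  have -> : 4 * L%:R ^+ 2 * m%:R = (2 * q * m)%:R :> R.
    by rewrite /q /h !natrM; ring.
  by rewrite ler_nat.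
have h4 : p * n%:R <= p * (4 * L%:R ^+ 2 * m%:R) by rewrite ler_wpM2l.
have h5 : L%:R ^+ 9 <= 4 * L%:R ^+ 2 * x by apply: (le_trans np); apply: (le_trans h4); rewrite /x; lra.
have l2 : 0 < L%:R ^+ 2 :> R by apply: exprn_gt0; lra.
have e9 : L%:R ^+ 9 = L%:R ^+ 2 * (L%:R * L%:R ^+ 6) :> R by rewrite -exprS -exprD.
have h6 : L%:R * L%:R ^+ 6 <= 4 * x by rewrite -(ler_pM2l l2) -e9; lra.
have h7 : 0 <= L%:R ^+ 6 :> R by apply: exprn_ge0.
move: h6 h7 L16'; move: (L%:R ^+ 6) => a; nra.
Qed.

Lemma part_degree_ge_pow3 : L%:R ^+ 3 <= x /\ 4096 <= x.
Proof.
have L16' := L_ge16.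
have h3 : 4096 <= L%:R ^+ 3 :> R.
  by rewrite (_ : 4096 = 16 ^+ 3) ?lerXn2r ?nnegrE //; ring.
have h0 : L%:R ^+ 3 <= x.
  apply: le_trans part_degree_ge_pow6; rewrite (_ : L%:R ^+ 6 = L%:R ^+ 3 * L%:R ^+ 3); last by ring.
  by rewrite -[leLHS]mul1r ler_wpM2r //; lra.
by split=> //; apply: le_trans h0.
Qed.

Lemma part_degree_le : 2 * L%:R ^+ 2 * x <= p * n%:R.
Proof.
have [_ _ h3 _] := part_size_bounds; case/andP: (hp) => p0 p1.
have -> : 2 * L%:R ^+ 2 * x = p * (q * m)%:R by rewrite /x /q /h !natrM; ring.
by rewrite ler_wpM2l // ler_nat.
Qed.

Lemma third_degree_ge_pow6 : L%:R ^+ 6 <= p * k%:R.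
Proof.
have [_ _ h3 h4] := part_size_bounds; case/andP: (hp) => p0 p1; have L16' := L_ge16.
have h5 : (n <= 4 * k)%N by rewrite /k; clear -h4; lia.
have h6 : n%:R <= 4 * k%:R :> R by rewrite -(natrM _ 4) ler_nat.
have h7 : p * n%:R <= p * (4 * k%:R) by rewrite ler_wpM2l.
have h8 : L%:R ^+ 9 = L%:R ^+ 3 * L%:R ^+ 6 :> R by rewrite -exprD.
have h9 : 4 <= L%:R ^+ 3 :> R.
  rewrite (_ : L%:R ^+ 3 = L%:R * (L%:R * L%:R)); last by ring.
  nra.
have h10 : 4 * L%:R ^+ 6 <= L%:R ^+ 9 :> R by rewrite h8 ler_wpM2r // exprn_ge0.
move: np h7 h10; move: (L%:R ^+ 9) (L%:R ^+ 6) => a b; lra.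
Qed.

(* [Delta0] bounds the degrees between consecutive parts in the zigzag rounds, [Delta1] those of
   the graph of missed edges; a round with degree bound [Delta] uses [cost Delta] cycles. *)
Definition Delta0 := (Num.truncn ((1 + 1 / L%:R) * x)).+1.
Definition Delta1 := (Num.truncn (6 * x)).+1.
Definition cost Delta := (Delta + (Delta %/ L).+1)%N.

Lemma part_degree_gt0 : 0 < x. Proof. by have [_] := part_degree_ge_pow3; lra. Qed.

Lemma inv_L_bounds : [/\ 0 < 1 / L%:R :> R, L%:R * (1 / L%:R) = 1 :> R & 1 / L%:R <= 1 / 16 :> R].
Proof.
have L16' := L_ge16; split; [by rewrite divr_gt0 //; lra | by field; lra |].
by rewrite !div1r lef_pV2 // posrE; lra.
Qed.

Lemma Delta0_bounds : (1 + 1 / L%:R) * x <= Delta0%:R <= (1 + 1 / L%:R) * x + 1.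
Proof.
have [l0 _ _] := inv_L_bounds; have x0 := part_degree_gt0.
have y0 : 0 <= (1 + 1 / L%:R) * x by rewrite mulr_ge0 //; lra.
have /andP[h1 h2] := truncn_itv y0; rewrite /Delta0; apply/andP; split; first exact: ltW.
by rewrite -[leLHS]natr1 lerD2r.
Qed.

Lemma Delta1_bounds : 6 * x <= Delta1%:R <= 6 * x + 1.
Proof.
have x0 := part_degree_gt0; have y0 : 0 <= 6 * x by lra.
have /andP[h1 h2] := truncn_itv y0; rewrite /Delta1; apply/andP; split; first exact: ltW.
by rewrite -[leLHS]natr1 lerD2r.
Qed.

Lemma cost_le Delta : (cost Delta)%:R <= (1 + 1 / L%:R) * Delta%:R + 1 :> R.
Proof.
have [l0 lL _] := inv_L_bounds; have h0 : (Delta %/ L)%:R * L%:R <= Delta%:R :> R.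
  by rewrite -natrM ler_nat leq_trunc_div.
have : (Delta %/ L)%:R * L%:R * (1 / L%:R) <= Delta%:R * (1 / L%:R) :> R.
  by apply: ler_wpM2r => //; apply: ltW.
rewrite -mulrA lL mulr1 /cost natrD -natr1; lra.
Qed.

(** Two factors 1 + 1/L arise, from the degree bound and from the surplus of matchings; the
    roundings are absorbed because x >= L^3. *)
Lemma cost0_le : (cost Delta0)%:R <= (1 + 4 / L%:R) * x.
Proof.
have [l0 lL l16] := inv_L_bounds; have [h3 _] := part_degree_ge_pow3; have L16' := L_ge16.
case/andP: Delta0_bounds => _ hD; have := cost_le Delta0.
have -> : 4 / L%:R = 4 * (1 / L%:R) :> R by rewrite mulrA mulr1.
have hx : 3 <= 1 / L%:R * x / 2.
  have : L%:R <= 1 / L%:R * x.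
    have := ler_pM2l l0 (L%:R ^+ 3) x; rewrite h3 => {h3} h3.
    apply: le_trans (_ : 1 / L%:R * L%:R ^+ 3 <= _); last by rewrite h3.
    rewrite (_ : _ * L%:R ^+ 3 = L%:R * (1 / L%:R) * L%:R ^+ 2); last by ring.
    rewrite lL mul1r; nra.
  lra.
move: hD hx l0 l16; move: (1 / L%:R) => y hD hx l0 l16.
have : (1 + y) * Delta0%:R <= (1 + y) * ((1 + y) * x + 1) by rewrite ler_wpM2l //; lra.
have : y * y * x <= 1 / 16 * y * x.
  have x0 := part_degree_gt0; by rewrite ler_wpM2r ?ler_wpM2r //; lra.
move: (Delta0%:R) => d; nra.
Qed.

Lemma cost1_le : (cost Delta1)%:R <= 13 * x.
Proof.
have [l0 lL l16] := inv_L_bounds; have [_ h3] := part_degree_ge_pow3.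
case/andP: Delta1_bounds => _ hD; have := cost_le Delta1.
have : 1 / L%:R * Delta1%:R <= 1 / 16 * Delta1%:R :> R by rewrite ler_wpM2r.
move: hD; move: (Delta1%:R) => d; move: (1 / L%:R) => y; nra.
Qed.

Definition total := (h * cost Delta0 + K * cost Delta1)%N.

(** The zigzag rounds cost at most (L^2 + 4 L) x and the extra rounds at most 9 L times 13 x, while
    n p / 2 is at least L^2 x; and 4 + 117 is below 200. *)
Lemma total_le : total%:R <= (1 + 200 / L%:R) * n%:R * p / 2.
Proof.
have [l0 lL l16] := inv_L_bounds; have L16' := L_ge16; have x0 := part_degree_gt0.
have c0 := cost0_le; have c1 := cost1_le.
have -> : (1 + 200 / L%:R) * n%:R * p / 2 = (1 + 200 * (1 / L%:R)) / 2 * (p * n%:R).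
  by field; lra.
apply: le_trans (_ : (1 + 200 * (1 / L%:R)) / 2 * (2 * L%:R ^+ 2 * x) <= _); last first.
  by rewrite ler_wpM2l ?part_degree_le //; lra.
rewrite /total natrD !natrM -[L.+1%:R]natr1.
have e4 : 4 / L%:R = 4 * (1 / L%:R) :> R by rewrite mulrA mulr1.
have h1 : L%:R * L%:R * (cost Delta0)%:R <= L%:R * L%:R * ((1 + 4 * (1 / L%:R)) * x).
  by rewrite ler_wpM2l ?mulr_ge0 // -e4.
have h2 : 8 * (L%:R + 1) * (cost Delta1)%:R <= 9 * L%:R * (13 * x).
  apply: ler_pM; rewrite ?mulr_ge0 //; lra.
apply: le_trans (lerD h1 h2) _.
have -> : (1 + 200 * (1 / L%:R)) / 2 * (2 * L%:R ^+ 2 * x) =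
   L%:R * L%:R * x + 200 * (L%:R * (1 / L%:R)) * L%:R * x by field; lra.
have -> : L%:R * L%:R * ((1 + 4 * (1 / L%:R)) * x) =
   L%:R * L%:R * x + 4 * (L%:R * (1 / L%:R)) * L%:R * x by field; lra.
rewrite lL; have : 0 <= L%:R * x by rewrite mulr_ge0 // ltW.
lra.
Qed.

End Main.

(** * Union bound over all rounds *)

Section Failure.
Variables (R : realType) (n L : nat) (p : R).
Hypotheses (hp : 0 <= p <= 1) (L16 : (16 <= L)%N) (nL : (n < 2 ^ L.+1)%N)
  (np : L%:R ^+ 9 <= p * n%:R).
Let h := (L * L)%N.
Let q := (2 * h)%N.
Let m := (n %/ q)%N.
Let K := (8 * L.+1)%N.
Let x : R := p * m%:R.
Let E : R := expR (- L.+1%:R).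
Let mu (e : {set 'I_n}) : R := if e \in pairs n then p else 0.

Let hmu : probv mu. Proof. exact: probv_pairs. Qed.
Let L8 : (8 <= L)%N. Proof. exact: leq_trans L16. Qed.
Let D0 := Delta0 n L p.
Let D1 := Delta1 n L p.

Lemma mu_le e : mu e <= p.
Proof. by rewrite /mu; case: ifP => // _; case/andP: hp. Qed.

Lemma tail_le_E4 (y : R) : 4 * (L%:R + 1) <= y -> expR (- y) <= E ^+ 4.
Proof. by move=> hy; rewrite /E -expRM_natr ler_expR -natr1; lra. Qed.

Lemma vertices_tail_le1 : n%:R * E <= 1.
Proof.
by rewrite /E expRN ler_pdivrMr ?expR_gt0 // mul1r; apply: (nat_le_expR R nL).
Qed.

Lemma parameter_bounds : [/\ (0 < n)%N, (h <= m)%N, (h <= n)%N, (K <= n)%N & (q.-1 * m <= n)%N].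
Proof.
have [h1 h2 h3 h4] := part_size_bounds hp L16 nL np.
have h5 : (L * L <= L ^ 6)%N.
  by rewrite -(expnD L 1 1 : L ^ 2 = L * L)%N leq_pexp2l //; lia.
have hm : (h <= m)%N by apply: leq_trans h5 h1.
have q0 : (0 < q)%N by rewrite /q /h; lia.
have mn : (m <= n)%N by apply: leq_trans h3; rewrite -/m -/q leq_pmull.
have hn := leq_trans hm mn.
split=> //; first by apply: leq_trans h4.
  by apply: leq_trans hn; rewrite /K /h; nia.
by apply: leq_trans h3; rewrite -/m -/q leq_mul2r leq_pred orbT.
Qed.

Let n0 : (0 < n)%N. Proof. by case: parameter_bounds. Qed.
Let h0 : (0 < h)%N. Proof. by rewrite /h; lia. Qed.
Let hm : (h <= m)%N. Proof. by case: parameter_bounds. Qed.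

(** All missed pairs at [v], whether or not they are edges of the random graph; they control the
    degrees in every extra round at once. *)
Definition uncovered_star (v : 'I_n) : {set {set 'I_n}} :=
  [set [set v; u] | u in [set u | uncovered h n0 [set v; u]]].

Lemma card_uncovered_star v : (#|uncovered_star v| <= 4 * m)%N.
Proof.
apply: leq_trans (leq_imset_card _ _) _; apply: leq_trans (uncovered_degree n0 h0 hm v) _.
rewrite -/q -/m; have [h1 _ _ _] := part_size_bounds hp L16 nL np.
have h2 : (2 * (L * L) + 3 <= L ^ 6)%N.
  have -> : (L ^ 6 = L ^ 4 * (L * L))%N by rewrite -(expnD L 1 1 : L ^ 2 = L * L)%N -expnD.
  have : (3 <= L ^ 4)%N by rewrite !expnS; nia.
  nia.
by move: (leq_trans h2 h1); rewrite -/h -/m /q; lia.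
Qed.

Lemma grid_inj_round (i : 'I_h) j j' a a' : (j <= q.-1)%N -> (j' <= q.-1)%N ->
  grid (h := h) n0 i j a = grid (h := h) n0 i j' a' -> j = j' /\ a = a'.
Proof. exact: grid_inj. Qed.

Lemma prob_level0_degree :
  prob mu (fun S => [exists i : 'I_h, ~~ bounded_degree q.-1 (grid (h := h) n0 i) xpredT D0 S])
  <= 2 * E ^+ 2.
Proof.
have [E0 E1] := E_bounds R L8; rewrite -/E in E0 E1.
have [_ _ hn _ qmn] := parameter_bounds.
have [l0 lL l16] := inv_L_bounds R L16; have xL := part_degree_ge_pow6 hp L16 nL np.
have each (C : {set {set 'I_n}}) : (#|C| <= m)%N -> prob mu (fun S => (D0 < #|S :&: C|)%N) <= E ^+ 4.
  move=> Cm; case/andP: (Delta0_bounds hp L16 nL np) => hD _.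
  case/andP: (hp) => p0 p1.
  apply: le_trans (chernoff hmu (fun e _ => mu_le e) p0 Cm (erefl _) _ hD) _.
    by rewrite l0 /=; lra.
  apply: tail_le_E4; rewrite -/m -/q -/h -/x.
  (* With eps = 1/L the Chernoff exponent x / (8 L^2) is at least L^4 / 8, well above 4 (L + 1). *)
  have -> : (1 / L%:R) ^+ 2 * x / 8 = (1 / L%:R) ^+ 2 / 8 * x by ring.
  apply: le_trans (_ : (1 / L%:R) ^+ 2 / 8 * L%:R ^+ 6 <= _); last first.
    by rewrite ler_wpM2l // divr_ge0 // exprn_ge0 // ltW.
  have -> : (1 / L%:R) ^+ 2 / 8 * L%:R ^+ 6 = (L%:R * (1 / L%:R)) ^+ 2 * (L%:R * (L%:R * (L%:R * L%:R))) / 8 :> R by ring.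
  rewrite lL expr1n mul1r; have := L_ge16 R L16; move: (L%:R) => y y16.
  have y2 : 16 * y <= y * y by rewrite ler_wpM2r //; lra.
  have y4 : 16 * (y * y) <= y * (y * y) by rewrite ler_wpM2r //; nra.
  have : 16 * (y * (y * y)) <= y * (y * (y * y)) by rewrite ler_wpM2r //; nra.
  lra.
have bad (i : 'I_h) : prob mu (fun S => ~~ bounded_degree q.-1 (grid (h := h) n0 i) xpredT D0 S) <=
    (q.-1)%:R * (m%:R * (2 * E ^+ 4)).
  pose c := grid (h := h) n0 i.
  apply: (@le_trans _ _ (prob mu (fun S => [exists j : 'I_q.-1, exists a : 'I_m,
      (D0 < #|S :&: star c j a|)%N || (D0 < #|S :&: costar c j a|)%N]))).
    apply: prob_sub => // S; apply: contraR; rewrite negb_exists => /forallP ok.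
    apply: (bounded_degree_inj (@grid_inj_round i)) => j a X jl hX XS.
    have := ok (Ordinal jl); rewrite negb_exists => /forallP/(_ a).
    rewrite negb_or -!leqNgt => /andP[ok1 ok2].
    by case: hX => hX; [apply: leq_trans ok1 | apply: leq_trans ok2];
      apply: subset_leq_card; rewrite subsetI hX andbT; apply/subsetP => e /XS[].
  rewrite -[X in X%:R * _]card_ord; apply: prob_exists_le => // j.
  rewrite -[X in X%:R * _]card_ord; apply: prob_exists_le => // a.
  apply: le_trans (prob_or _ _ hmu) _; rewrite mulr_natl mulr2n.
  by apply: lerD; apply: each; [apply: card_star | apply: card_costar].
have := prob_exists_le hmu bad; rewrite card_ord => hb; apply: le_trans hb _.
have -> : h%:R * ((q.-1)%:R * (m%:R * (2 * E ^+ 4))) = 2 * (h%:R * (q.-1 * m)%:R) * E ^+ 4 :> R.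
  by rewrite natrM; ring.
have nE := vertices_tail_le1.
have b1 : h%:R * (q.-1 * m)%:R <= n%:R * n%:R :> R by apply: ler_pM; rewrite ?ler_nat.
apply: le_trans (_ : 2 * (n%:R * n%:R) * E ^+ 4 <= _).
  by rewrite ler_wpM2r ?exprn_ge0 ?ler_pM2l // ltW.
have -> : 2 * (n%:R * n%:R) * E ^+ 4 = 2 * ((n%:R * E) ^+ 2 * E ^+ 2) by ring.
rewrite ler_pM2l // -[leRHS]mul1r ler_wpM2r ?exprn_ge0 ?exprn_ile1 ?mulr_ge0 // ltW //.
Qed.

Lemma prob_uncovered_degree :
  prob mu (fun S => [exists v : 'I_n, (D1 < #|S :&: uncovered_star v|)%N]) <= E ^+ 2.
Proof.
have [E0 E1] := E_bounds R L8; rewrite -/E in E0 E1.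
have [x3 x4] := part_degree_ge_pow3 hp L16 nL np; case/andP: (hp) => p0 p1.
have each v : prob mu (fun S => (D1 < #|S :&: uncovered_star v|)%N) <= E ^+ 4.
  case/andP: (Delta1_bounds hp L16 nL np) => hD _.
  (* At most 4 m missed pairs give mean at most 4 x; with eps = 1/2 the bound (1 + eps) 4 x is the 6
     x in [Delta1]. *)
  apply: le_trans (@chernoff _ _ mu hmu _ p (4 * x) (1 / 2) (4 * m)%N D1 (fun e _ => mu_le e) p0
    (card_uncovered_star v) _ _ _) _.
  - by rewrite /x natrM; ring.
  - by apply/andP; split; lra.
  - apply: le_trans hD; rewrite -/h -/q -/m -/x; lra.
  apply: tail_le_E4; have L16' := L_ge16 R L16.
  have h2 : 256 * L%:R <= x.
    apply: (le_trans _ x3); rewrite (_ : L%:R ^+ 3 = L%:R * L%:R * L%:R); last by ring.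
    by rewrite ler_wpM2r //; nra.
  by lra.
have := prob_exists_le hmu each; rewrite card_ord => hb; apply: le_trans hb _.
have -> : n%:R * E ^+ 4 = n%:R * E * (E * E ^+ 2) by ring.
have E2 : 0 <= E ^+ 2 by rewrite exprn_ge0 // ltW.
apply: (@le_trans _ _ (1 * (E * E ^+ 2))).
  by rewrite ler_wpM2r ?vertices_tail_le1 // mulr_ge0 // ltW.
by rewrite mul1r -[leRHS]mul1r ler_wpM2r //; lra.
Qed.

Lemma cost_le_vertices : ((2 * q.-1 + cost L D0 <= 2 * n)%N /\ (2 * 2 + cost L D1 <= 2 * n)%N).
Proof.
have [h1 h2 h3 h4] := part_size_bounds hp L16 nL np; have L16' := L_ge16 R L16.
have [l0 lL l16] := inv_L_bounds R L16.
have x0 := part_degree_gt0 hp L16 nL np; rewrite -/h -/q -/m -/x in x0.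
have c0 := cost0_le hp L16 nL np; have c1 := cost1_le hp L16 nL np.
rewrite -/h -/q -/m -/x in c0 c1.
have xm : x <= m%:R by rewrite /x; case/andP: hp => p0 p1; rewrite ler_piMl.
have cm0 : (cost L D0 <= 2 * m)%N.
  rewrite -(ler_nat R) natrM; apply: (le_trans c0).
  have -> : 4 / L%:R = 4 * (1 / L%:R) :> R by rewrite mulrA mulr1.
  by move: xm l16; move: (1 / L%:R) => y xm l16; nra.
have cm1 : (cost L D1 <= 13 * m)%N by rewrite -(ler_nat R) natrM; apply: (le_trans c1); lra.
have LL : (16 * 16 <= L * L)%N by apply: leq_mul.
have q512 : (512 <= q)%N by rewrite /q /h (leq_mul2l 2 256).
have m2 : (2 <= m)%N.
  apply: leq_trans h1; apply: leq_trans (_ : (L ^ 1 <= _)%N); last by rewrite leq_pexp2l // (leq_trans _ L16).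
  by rewrite expn1 (leq_trans _ L16).
have qm : (512 * m <= n)%N by apply: leq_trans h3; rewrite leq_mul2r q512 orbT.
have q2 : (q * 2 <= n)%N by apply: leq_trans h3; rewrite leq_mul2l m2 orbT.
clear -cm0 cm1 qm q2 m2 q512.
by split; lia.
Qed.

Lemma union_bound_small (N a : nat) : (N <= n)%N -> (a <= 2 * n)%N -> N%:R * (a%:R * E ^+ 4) <= 2 * E ^+ 2.
Proof.
move=> Nn an; have [E0 E1] := E_bounds R L8; rewrite -/E in E0 E1.
have nE := vertices_tail_le1.
apply: (@le_trans _ _ (n%:R * ((2 * n%:R) * E ^+ 4))).
  apply: ler_pM; rewrite ?mulr_ge0 ?exprn_ge0 ?ler_nat // ?(ltW E0) //.
  by rewrite ler_wpM2r ?exprn_ge0 ?(ltW E0) // -(natrM _ 2) ler_nat.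
have -> : n%:R * (2 * n%:R * E ^+ 4) = 2 * ((n%:R * E) ^+ 2 * E ^+ 2) by ring.
by rewrite ler_pM2l // -[leRHS]mul1r ler_wpM2r ?exprn_ge0 ?exprn_ile1 ?mulr_ge0 // ltW.
Qed.

Lemma prob_level0_cover :
  prob mu (fun S => [exists i : 'I_h, bounded_degree q.-1 (grid (h := h) n0 i) xpredT D0 S &&
     ~~ round_covered q.-1 (grid (h := h) n0 i) xpredT (cost L D0) S]) <= 2 * E ^+ 2.
Proof.
have l2 : (1 < q.-1)%N by rewrite /q /h; nia.
have [cn _] := cost_le_vertices; have [_ _ hn _ _] := parameter_bounds.
apply: le_trans (union_bound_small hn cn); rewrite -[X in X%:R * _]card_ord.
apply: prob_exists_le => // i.
exact: (prob_round_failure_small xpredT (@grid_inj_round i) l2 hp L8 nL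
  (part_degree_ge_pow6 hp L16 nL np) (erefl _)).
Qed.

Lemma prob_level1_cover (s : K.-tuple {perm 'I_n}) :
  prob mu (fun S => [exists t : 'I_K,
     bounded_degree 2 (triple n0 (tnth s t)) (uncovered h n0) D1 S &&
     ~~ round_covered 2 (triple n0 (tnth s t)) (uncovered h n0) (cost L D1) S]) <= 2 * E ^+ 2.
Proof.
have [_ cn] := cost_le_vertices; have [_ _ _ Kn _] := parameter_bounds.
apply: le_trans (union_bound_small Kn cn); rewrite -[X in X%:R * _]card_ord.
apply: prob_exists_le => // t.
exact: (prob_round_failure_small (uncovered h n0) (@triple_inj n n0 (tnth s t)) (ltnSn 1) hp L8 nL
  (third_degree_ge_pow6 hp L16 nL np) (erefl _)).
Qed.

(** The constant 7 is 2 + 2 + 1 + 2, from the events [B1], [B2], [B3] and [B4]. *)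
Lemma prob_not_coverable :
  prob mu (fun S => (S \subset pairs n) && ~~ ham_coverable S (total n L p)) <= 7 * E ^+ 2.
Proof.
have [_ _ _ n100] := part_size_bounds hp L16 nL np.
(* The extra rounds are fixed in advance, independently of the random graph. *)
have [s hs] := capture_all n0 (third_square_bound n100) (pow4_5_bound nL).
pose B1 S := [exists i : 'I_h, ~~ bounded_degree q.-1 (grid (h := h) n0 i) xpredT D0 S].
pose B2 S := [exists i : 'I_h, bounded_degree q.-1 (grid (h := h) n0 i) xpredT D0 S &&
     ~~ round_covered q.-1 (grid (h := h) n0 i) xpredT (cost L D0) S].
pose B3 S := [exists v : 'I_n, (D1 < #|S :&: uncovered_star v|)%N].
pose B4 S := [exists t : 'I_K,
     bounded_degree 2 (triple n0 (tnth s t)) (uncovered h n0) D1 S &&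
     ~~ round_covered 2 (triple n0 (tnth s t)) (uncovered h n0) (cost L D1) S].
apply: (@le_trans _ _ (prob mu (fun S => (B1 S || B2 S) || (B3 S || B4 S)))); last first.
  apply: le_trans (prob_or _ _ hmu) _.
  have h12 := le_trans (prob_or B1 B2 hmu) (lerD prob_level0_degree prob_level0_cover).
  have h34 := le_trans (prob_or B3 B4 hmu) (lerD prob_uncovered_degree (prob_level1_cover s)).
  apply: le_trans (lerD h12 h34) _; lra.
apply: prob_sub => // S /andP[sS]; apply: contraR.
rewrite !negb_or => /andP[/andP[nb1 nb2] /andP[nb3 nb4]].
apply: (coverable_of_rounds (n0 := n0) hs sS).
  move=> i; move: nb1 nb2; rewrite !negb_exists => /forallP/(_ i); rewrite negbK => b1 /forallP/(_ i).
  by rewrite b1 /= negbK.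
move=> t; move: nb4; rewrite negb_exists => /forallP/(_ t).
rewrite negb_and negbK => /orP[nb|//]; case/negP: nb.
apply: (bounded_degree_inj (@triple_inj n n0 (tnth s t))) => j a X j2 hX XS.
(* Whatever the arrangement, the missed edges from a vertex to a neighbouring part are among all
   missed edges at that vertex. *)
have [v hv] : exists v, X \subset S :&: uncovered_star v.
  case: hX => hX; [exists (triple n0 (tnth s t) j a) | exists (triple n0 (tnth s t) j.+1 a)];
    apply/subsetP => e eX; have [eS eU] := XS e eX; rewrite inE eS /=;
    have /imsetP[b _ eb] := subsetP hX e eX; rewrite eb /edge_at in eU *.
    by apply/imsetP; exists (triple n0 (tnth s t) j.+1 b); rewrite ?inE.
  by apply/imsetP; exists (triple n0 (tnth s t) j b); rewrite ?inE // setUC.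
apply: leq_trans (subset_leq_card hv) _.
by move: nb3; rewrite negb_exists => /forallP/(_ v); rewrite -leqNgt.
Qed.

End Failure.

(** * Asymptotics *)

Section Gnp.
Variables (R : realType) (n : nat) (p : R).
Let mu (e : {set 'I_n}) : R := if e \in pairs n then p else 0.

Lemma gnp_weight_bern (G : {set {set 'I_n}}) : gnp_weight p G = bern mu G.
Proof.
rewrite /gnp_weight; case: ifP => [sG|/negbT/subsetPn[e eG eP]]; last first.
  by rewrite /bern (bigD1 e) //= eG /mu (negbTE eP) mul0r.
rewrite /bern (bigID (mem G)) /=; congr (_ * _).
  rewrite (eq_bigr (fun=> p)) ?prodr_const // => e eG.
  by rewrite eG /mu (subsetP sG _ eG).
rewrite (bigID (mem (pairs n))) /= [X in _ * X]big1 ?mulr1 => [|e /andP[/negbTE-> /negbTE eP]]; last first.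
  by rewrite /mu eP subr0.
have -> : (#|pairs n| - #|G| = #|pairs n :\: G|)%N.
  by rewrite cardsD (setIidPr sG).
rewrite -prodr_const; apply: eq_big => [e|e]; rewrite in_setD // => /andP[/negbTE-> eP].
by rewrite /mu eP.
Qed.

Lemma gnp_prob_prob (P : pred {set {set 'I_n}}) : gnp_prob p P = prob mu P.
Proof.
rewrite /gnp_prob big_mkcond; apply: eq_bigr => G _.
by rewrite gnp_weight_bern; case: (P G); rewrite ?mulr1 ?mulr0.
Qed.

Lemma prob_subset_pairs (P : pred {set {set 'I_n}}) :
  prob mu (fun S => (S \subset pairs n) && P S) = prob mu P.
Proof.
apply: eq_bigr => S _; rewrite -gnp_weight_bern /gnp_weight.
by case: ifP; rewrite ?mul0r.
Qed.

End Gnp.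

From mathcomp Require Import all_classical all_reals all_analysis.
Import numFieldNormedType.Exports.
Local Open Scope classical_set_scope.

Section Asymptotics.
Variable R : realType.
Implicit Types (C e : R) (n : nat).

Local Notation lg n := (trunc_log 2 n).

Lemma near_trunc_log C : \forall n \near \oo, C <= (lg n)%:R.
Proof.
exists (2 ^ Num.bound `|C|)%N => // n /= hn.
apply: le_trans (ler_norm C) _; apply: ltW; apply: lt_le_trans (archi_boundP (normr_ge0 C)) _.
by rewrite ler_nat trunc_log_max.
Qed.

(** With c = alpha ln 2 and y the logarithm, n^alpha >= e^(c y), and the term of degree 10 of the
    exponential series exceeds y^9 once y >= 10! / c^10. *)
Lemma pow_trunc_log_le (alpha : R) : 0 < alpha ->
  \forall n \near \oo, (lg n)%:R ^+ 9 <= (n%:R : R) `^ alpha.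
Proof.
move=> a0; have l2 : 0 < ln 2 :> R by rewrite ln_gt0 // ltr1n.
pose c := alpha * ln 2; have c0 : 0 < c by rewrite mulr_gt0.
pose B : R := (10`!)%:R.
have B0 : 0 < B by rewrite /B ltr0n fact_gt0.
apply: filterS2 (near_trunc_log 1) (near_trunc_log (B / c ^+ 10)) => n.
set y : R := (lg n)%:R => y1 yB.
have n0 : (0 < n)%N.
  have : (1 <= lg n)%N by rewrite -(ler_nat R).
  by case: (n) => //; rewrite trunc_log0.
have h1 : expR (c * y) <= n%:R `^ alpha.
  rewrite /powR pnatr_eq0 (gtn_eqF n0) ler_expR /c -mulrA ler_pM2l //.
  have -> : ln 2 * y = ln (2 ^+ lg n) by rewrite lnXn // /y mulr_natr.
  by rewrite ler_ln ?posrE ?exprn_gt0 ?ltr0n // -natrX ler_nat trunc_logP.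
apply: le_trans h1; apply: le_trans (expR_ge1Dxn 9 _); last by rewrite mulr_ge0 // ltW // (lt_le_trans _ y1).
rewrite -/B; apply: (@le_trans _ _ ((c * y) ^+ 10 / B)); last by rewrite lerDr.
rewrite ler_pdivlMr // exprMn.
move: yB; rewrite ler_pdivrMr ?exprn_gt0 // => yB.
have y0 : 0 <= y by apply: le_trans y1.
by rewrite mulrC [y ^+ 10]exprS [leRHS]mulrA ler_wpM2r ?exprn_ge0 // mulrC.
Qed.

Lemma cvg_of_log_bound (f : nat -> R) (l C : R) : 0 <= C ->
  (\forall n \near \oo, `|l - f n| <= C / (lg n)%:R) -> f @ \oo --> l.
Proof.
move=> C0 hf; apply/cvgrPdist_le => e e0.
apply: filterS3 hf (near_trunc_log 1) (near_trunc_log (C / e)) => n h1 y1 h2.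
apply: le_trans h1 _; have y0 : 0 < (lg n)%:R :> R by apply: lt_le_trans y1.
by rewrite ler_pdivrMr // mulrC -ler_pdivrMr.
Qed.

End Asymptotics.

Theorem theorem1p1 (R : realType) (alpha : R) (p : nat -> R) :
  0 < alpha ->
  (forall n, 0 <= p n <= 1) ->
  (\forall n \near \oo, (n%:R : R) `^ (alpha - 1) <= p n) ->
  exists eps : nat -> R,
    eps @ \oo --> (0 : R) /\
    (fun n => gnp_prob (p n)
       (fun G : {set {set 'I_n}} =>
          `[< exists k : nat,
                (k%:R <= (1 + eps n) * n%:R * p n / 2) /\ ham_coverable G k >]))
      @ \oo --> (1 : R).
Proof.
(* The error term is the one in [total_le]. *)
move=> a0 hp hpa; exists (fun n => 200 / (trunc_log 2 n)%:R); split.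
  apply: (@cvg_of_log_bound _ _ _ 200) => //; apply: nearW => n.
  by rewrite sub0r normrN ger0_norm // divr_ge0.
apply: (@cvg_of_log_bound _ _ _ 7) => //.
apply: filterS3 hpa (near_trunc_log (16 : R)) (pow_trunc_log_le a0) => n.
set L := trunc_log 2 n => h1 L16 h2.
have {}L16 : (16 <= L)%N by rewrite -(ler_nat R).
have n0 : (0 < n)%N by move: L16; rewrite /L; case: (n) => //; rewrite trunc_log0.
have nL : (n < 2 ^ L.+1)%N by rewrite trunc_log_ltn.
have np : L%:R ^+ 9 <= p n * n%:R.
  apply: (le_trans h2).
  have -> : n%:R `^ alpha = n%:R `^ (alpha - 1) * n%:R.
    rewrite -[in X in _ * X](@powRr1 R n%:R) // -powRD ?subrK //.
    by apply/implyP => _; rewrite pnatr_eq0 -lt0n.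
  by rewrite ler_wpM2r.
rewrite gnp_prob_prob; set P := (P in prob _ P).
have hmu := @probv_pairs n R (p n) (hp n).
have P1 := prob_le1 P hmu.
rewrite ger0_norm ?subr_ge0 // prob_predC subKr.
(* The failure probability is at most 7 E^2 <= 7 E <= 7 / L, where E = e^(-(L + 1)). *)
apply: (@le_trans _ _ (7 * expR (- L.+1%:R) ^+ 2)).
  apply: le_trans (prob_not_coverable (hp n) L16 nL np).
  rewrite prob_subset_pairs; apply: prob_sub => // S /=.
  apply: contra => hS; apply/asboolP; exists (total n L (p n)); split=> //.
  exact: total_le.
rewrite ler_pM2l //; have L0 : 0 < L%:R :> R by rewrite ltr0n; apply: leq_trans L16.
apply: (@le_trans _ _ (expR (- L.+1%:R))).
  rewrite expr2 -[leRHS]mulr1 ler_wpM2l ?expR_ge0 // -[leRHS](@expR0 R) ler_expR.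
rewrite expRN lef_pV2 ?posrE ?expR_gt0 //; apply: le_trans (expR_ge1Dx _).
by rewrite -natr1; lra.
Qed.
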